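(* There exist absolute constants $C, C'>0$ such that the following holds. Let $K \geq 1$ and let $P$ be a finite set of $n$ points in the plane spanning at most $Kn$ ordinary lines, where $n \geq \exp\exp(C K^C)$. Then all but at most $C' K^{C'}$ points of $P$ lie on an algebraic curve $\gamma$ of degree at most $3$ (not necessarily irreducible).
   Context: An ordinary line of a finite point set $P$ is a line containing exactly two points of $P$. The curve $\gamma$ may be reducible, e.g. an irreducible cubic, the union of a conic and a line, or a union of three lines. *)

(* Defs.v *)
From HB Require Import structures.
From mathcomp Require Import all_boot all_order all_algebra finmap.
From mathcomp Require Import boolp classical_sets functions cardinality.
From mathcomp Require Import reals.
From mathcomp Require Import ring.
From mathcomp Require Import -(notations) mpoly.

Set Implicit Arguments.
Unset Strict Implicit.
Unset Printing Implicit Defensive.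

Import Order.TTheory GRing.Theory Num.Theory.

Local Open Scope classical_set_scope.
Local Open Scope ring_scope.

Definition is_line (R : realType) (l : set (R * R)) : Prop :=
  exists a b c : R, (a, b) != (0, 0) /\
    l = [set z : R * R | a * z.1 + b * z.2 + c = 0].

Definition ordinary_lines (R : realType) (P : {fset (R * R)}) :
    set (set (R * R)) :=
  [set l | is_line l /\ #|` [fset z in P | z \in l]%fset| = 2%N].

Lemma finite_ordinary_lines (R : realType) (P : {fset (R * R)}) :
  finite_set (ordinary_lines P).
Proof.
pose f (w : (R * R) * (R * R)) : set (R * R) :=
  [set z | (w.2.1 - w.1.1) * (z.2 - w.1.2) = (w.2.2 - w.1.2) * (z.1 - w.1.1)].
apply: (@sub_finite_set _ _ (f @` ([set` P] `*` [set` P]))); last first.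
  by apply: finite_image; apply: finite_setX; apply: finite_fset.
move=> l [[a [b [c [ab0 le]]]]].
set S := [fset z in P | z \in l]%fset => Scard.
have [x [y [xy xS yS]]] : exists x y, [/\ x != y, x \in S & y \in S].
  have mS z : z \in enum_fset S -> z \in S by [].
  move: Scard mS (fset_uniq S); case: (enum_fset S) => [|x [|y s]] //= _ mS.
  rewrite inE negb_or => /andP[/andP[xy _] _].
  by exists x, y; split=> //; apply: mS; rewrite !inE eqxx ?orbT.
move: xS yS; rewrite !inE /= => /andP[xP]; rewrite le in_setE /= => xl.
move=> /andP[yP]; rewrite in_setE /= => yl.
exists (x, y); first by split.
move: xy ab0 xl yl {S Scard xP yP}; case: x => x1 x2; case: y => y1 y2 /=.
rewrite !xpair_eqE !negb_and => xy ab0 xl yl.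
pose e z w : R := a * z + b * w + c.
pose g z w : R := (y1 - x1) * (w - x2) - (y2 - x2) * (z - x1).
rewrite -/(e x1 x2) -/(e y1 y2) in xl yl.
apply/seteqP; split => -[z1 z2] /=; rewrite -/(e z1 z2) => h.
  have {}h : g z1 z2 = 0 by rewrite /g h subrr.
  case/orP: xy; rewrite eq_sym -subr_eq0 => ne; apply: (mulfI ne).
    transitivity ((y1 - x1) * e x1 x2 + (z1 - x1) * (e y1 y2 - e x1 x2)
                  + b * g z1 z2); first by rewrite /e /g; ring.
    by rewrite xl yl h; ring.
  transitivity ((y2 - x2) * e x1 x2 + (z2 - x2) * (e y1 y2 - e x1 x2)
                - a * g z1 z2); first by rewrite /e /g; ring.
  by rewrite xl yl h; ring.
apply/eqP; rewrite -subr_eq0 -/(g z1 z2); apply/eqP.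
case/orP: ab0 => ne; apply: (mulfI ne).
  transitivity ((e y1 y2 - e x1 x2) * (z2 - x2)
                - (y2 - x2) * (e z1 z2 - e x1 x2)); first by rewrite /e /g; ring.
  by rewrite xl yl h; ring.
transitivity ((y1 - x1) * (e z1 z2 - e x1 x2)
              - (z1 - x1) * (e y1 y2 - e x1 x2)); first by rewrite /e /g; ring.
by rewrite xl yl h; ring.
Qed.

(* [fset_set] sends infinite sets to [fset0]; [finite_ordinary_lines] shows
   that this case does not arise, so this is the true number of lines. *)
Definition ordinary_line_count (R : realType) (P : {fset (R * R)}) : nat :=
  #|` fset_set (ordinary_lines P)|.

Definition zero_locus (R : realType) (f : mpoly 2 R) : set (R * R) :=
  [set z : R * R | meval (fun i : 'I_2 => if i == ord0 then z.1 else z.2) f = 0].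

(* [mmeasure mdeg f] is 1 + the total degree of [f], and 0 if [f = 0], so [f] has
   total degree between 1 and [d]; it need not be irreducible or squarefree. *)
Definition is_curve_deg_le (R : realType) (d : nat) (G : set (R * R)) : Prop :=
  exists f : mpoly 2 R,
    (1 < mmeasure mdeg f <= d.+1)%N /\ G = zero_locus f.

(* Main.v *)
(* Dualise the points to lines [y = a x + b] (after a shear making the slopes [a]
   distinct), so that ordinary lines become vertices on exactly two lines.
   Charging pairs of consecutive slopes at a vertex to pairs of extremal slopes, in
   place of Euler's formula, shows that all but O(Kn) vertices lie on exactly three
   lines and are surrounded by six triangular cells. Hence, away from [d_p] breaks with
   [sum_p d_p = O(Kn)], the arrangement along the line dual to [p] looks like a
   strip of the triangular lattice, and Chasles' theorem puts the points of each
   strip on a cubic: all but [d_p] of the lines through [p] contain three points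
   and lie, as far as [P] is concerned, on one of [d_p] cubics through [p].

   The rest is counting, with Bezout-type bounds for degree at most 3. If one of
   these cubics is not mostly covered by few lines and conics, every typical
   point lies on it, and a point off it yields many three-point lines with two
   points off it, so few points are off it. Otherwise few lines and conics
   cover [P]. At most one conic can be large, since three-point lines from a point
   off a large conic pair up its points, so [P], or [P] minus that conic, is
   covered by few lines. Let [l] be the richest of them: rotating a line about a
   point of [l] meets the remaining points in an order hardly depending on the
   centre, so if many points were off [l] the first three-point lines found this
   way would bound the number of points on [l]. *)

Require Import Defs.
From mathcomp Require Import all_boot all_order all_algebra finmap.
From mathcomp Require Import boolp classical_sets functions cardinality.
From mathcomp Require Import reals sequences exp.
From mathcomp Require Import zify ring lra.
From mathcomp Require Import -(notations) mpoly.

Set Implicit Arguments.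
Unset Strict Implicit.
Unset Printing Implicit Defensive.

Import Order.TTheory GRing.Theory Num.Theory.

Local Open Scope ring_scope.

(** The charging sees only cells to the right of a vertex, so it is run for the arrangement and for
    its point reflection [opp]. A vertex charged by a bottom edge in one run and by a reflected top
    edge in the other has a triangle directly above it; counting triangles by their left corners
    then handles the remaining cells.

    Following a strip along the dual line [p] takes two rows of vertices on one side of [p] and one
    row on the other. The lines [p1], [p2], [q] carrying these rows are the auxiliary points of the
    Chasles configurations that pass a cubic from one three-point line to the next. Hence vertices
    at most two edges away from a bad one are discarded, each enlargement costing a factor 7.

    Curves are never decomposed into components. Irreducibility is replaced by the condition that
    the points on the curve are not covered by few lines and conics, which is all that the counting
    uses. The thresholds are multiples of [D = 100 M], where [M] bounds the average of [d], so that
    at most one point in a hundred has [d p > D]. *)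

Lemma card_le_rel (T U : finType) (A : {set T}) (B : {set U})
    (r : T -> U -> Prop) :
    (forall x, x \in A -> exists2 y, y \in B & r x y) ->
    (forall x x' y, x \in A -> x' \in A -> r x y -> r x' y -> x = x') ->
  (#|A| <= #|B|)%N.
Proof.
move=> ex inj.
have [->|[x0 x0A]] := set_0Vmem A; first by rewrite cards0.
have [y0 _ _] := ex _ x0A.
have /choice[f fP] : forall x, exists y, x \in A -> y \in B /\ r x y.
  move=> x; case: (boolP (x \in A)) => xA; last by exists y0.
  by have [y yB rxy] := ex _ xA; exists y.
rewrite -(@card_in_imset _ _ f A) => [|x x' xA x'A ff].
  by apply/subset_leq_card/fintype.subsetP => _ /imsetP[x xA ->]; have [] := fP _ xA.
have [_ r1] := fP _ xA; have [_ r2] := fP _ x'A.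
by apply: (inj _ _ (f x)) => //; rewrite ff.
Qed.

(** * Arrangements of lines *)

Section Arrangement.
Variables (R : realFieldType) (I : finType) (a : I -> R).
Hypothesis a_inj : injective a.
Implicit Types (b : I -> R) (i j k l : I) (s t u : R).

Definition ht b i s := a i * s + b i.

Definition cross b i j := (b j - b i) / (a i - a j).

Lemma slope_neq i j : i != j -> a i - a j != 0.
Proof. by move=> ij; rewrite subr_eq0; apply: contra ij => /eqP/a_inj ->. Qed.

Lemma ht_diff b i j s :
  i != j -> ht b i s - ht b j s = (a i - a j) * (s - cross b i j).
Proof. by move=> /slope_neq ij; rewrite /ht /cross; field. Qed.

Lemma crossC b i j : cross b i j = cross b j i.
Proof.
by rewrite /cross -opprB -(opprB (a j)) invrN mulrNN.
Qed.

Lemma ht_cross b i j : i != j -> ht b i (cross b i j) = ht b j (cross b i j).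
Proof.
by move=> ij; apply/eqP; rewrite -subr_eq0 ht_diff // subrr mulr0.
Qed.

Lemma cross_uniq b i j s : i != j -> ht b i s = ht b j s -> s = cross b i j.
Proof.
move=> ij /eqP; rewrite -subr_eq0 ht_diff // mulf_eq0 (negbTE (slope_neq ij)) /=.
by rewrite subr_eq0 => /eqP.
Qed.

Lemma cross_between b i j s t : i != j -> s < t ->
  (ht b i s - ht b j s) * (ht b i t - ht b j t) < 0 ->
  s < cross b i j < t.
Proof.
move=> ij st; rewrite !ht_diff //; set c := cross _ _ _ => h.
have h2 : 0 < (a i - a j) ^+ 2 by rewrite exprn_even_gt0 //= slope_neq.
have {h2} h : (s - c) * (t - c) < 0.
  by rewrite -(pmulr_rlt0 _ h2); apply: le_lt_trans h; rewrite le_eqVlt; apply/orP; left; apply/eqP; ring.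
by apply/andP; split; rewrite ltNge; apply/negP => hc; nra.
Qed.

Definition vert b i s : Prop := exists2 j, j != i & ht b j s = ht b i s.

Definition thru b i s : {set I} := [set k | ht b k s == ht b i s].

Definition blk b i j := thru b i (cross b i j).

(** A pair stands for the cell to the right of a vertex between two neighbouring lines; a vertex on
    m lines has m - 1 of them. *)
Definition consec b : {set I * I} :=
  [set p | (a p.1 < a p.2) &&
    [forall k in blk b p.1 p.2, ~~ (a p.1 < a k < a p.2)]].

(** There is one such pair per vertex, so these pairs serve as names of the vertices. *)
Definition extremal b : {set I * I} :=
  [set p | (a p.1 < a p.2) &&
    [forall k in blk b p.1 p.2, a p.1 <= a k <= a p.2]].

Lemma consecP b i j : reflect (a i < a j /\
    forall k, ht b k (cross b i j) = ht b i (cross b i j) ->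
      ~ (a i < a k < a j)) ((i, j) \in consec b).
Proof.
rewrite inE /=; apply: (iffP andP) => -[-> h]; split=> //.
  move=> k hk; apply/negP; apply: (forall_inP h).
  by rewrite inE hk.
by apply/forall_inP => k; rewrite inE => /eqP hk; apply/negP/h.
Qed.

Lemma extremalP b i j : reflect (a i < a j /\
    forall k, ht b k (cross b i j) = ht b i (cross b i j) ->
      a i <= a k <= a j) ((i, j) \in extremal b).
Proof.
rewrite inE /=; apply: (iffP andP) => -[-> h]; split=> //.
  by move=> k hk; apply: (forall_inP h); rewrite inE hk.
by apply/forall_inP => k; rewrite inE => /eqP/h.
Qed.

Lemma lt_slope_neq i j : a i < a j -> i != j.
Proof. by apply: contraTneq => ->; rewrite ltxx. Qed.

Lemma vert_cross b i j : i != j -> vert b i (cross b i j).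
Proof. by move=> ij; exists j; rewrite 1?eq_sym // ht_cross. Qed.

Lemma succ_slope b i j s : ht b j s = ht b i s -> a i < a j ->
  exists k, [/\ (i, k) \in consec b, cross b i k = s & a k <= a j].
Proof.
move=> ji aij.
have Pj : (j \in thru b i s) && (a i < a j) by rewrite inE ji eqxx.
case: (@arg_minP _ _ _ j (fun j => (j \in thru b i s) && (a i < a j)) a Pj) => k /andP[]; rewrite inE => /eqP ki aik kmin.
have sE : cross b i k = s by rewrite -(cross_uniq (lt_slope_neq aik) (esym ki)).
exists k; split => //; last exact: kmin.
apply/consecP; split=> // l; rewrite sE => li /andP[ail]; apply/negP.
by rewrite -leNgt; apply: kmin; rewrite inE li eqxx.
Qed.

Lemma min_thru b i s : exists2 k, ht b k s = ht b i s &
  forall l, ht b l s = ht b i s -> a k <= a l.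
Proof.
have Pi : i \in thru b i s by rewrite inE.
case: (@arg_minP _ _ _ i (fun k => k \in thru b i s) a Pi) => k; rewrite inE => /eqP ki kmin.
by exists k => // l li; apply: kmin; rewrite inE li.
Qed.

Lemma max_thru b i s : exists2 k, ht b k s = ht b i s &
  forall l, ht b l s = ht b i s -> a l <= a k.
Proof.
have Pi : i \in thru b i s by rewrite inE.
case: (@arg_maxP _ _ _ i (fun k => k \in thru b i s) a Pi) => k; rewrite inE => /eqP ki kmin.
by exists k => // l li; apply: kmin; rewrite inE li.
Qed.

Lemma next_vert b i s : (forall t, s < t -> ~ vert b i t) \/
  exists t, [/\ s < t, vert b i t & forall u, s < u < t -> ~ vert b i u].
Proof.
case: (pickP [pred j | (j != i) && (s < cross b i j)]) => [j0 /= Pj0|none].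
  right; case: (@arg_minP _ _ _ j0 (fun j => (j != i) && (s < cross b i j)) (cross b i) Pj0) => j /andP[ji sj] jmin.
  exists (cross b i j); split=> //; first by apply: vert_cross; rewrite eq_sym.
  move=> u /andP[su uj] [k ki hk].
  have uE : u = cross b i k by apply: cross_uniq; rewrite 1?eq_sym.
  by move: uj; apply/negP; rewrite -leNgt uE; apply: jmin; rewrite ki -uE su.
left=> t st [k ki hk]; have /= := none k; rewrite ki -(@cross_uniq b i k t) ?st //.
by rewrite eq_sym.
Qed.

Definition novert b i s t : Prop := forall u, s < u < t -> ~ vert b i u.

(** The cell with left corner [(i, j)] is charged to the vertex [(i, k)] ending its bottom edge. In
    [top_edge] the top edge ends strictly first, so a tie goes to the bottom edge. *)
Definition bottom_edge b j i k : Prop :=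
  [/\ (i, j) \in consec b, (i, k) \in extremal b, cross b i j < cross b i k,
      novert b i (cross b i j) (cross b i k) &
      novert b j (cross b i j) (cross b i k)].

Definition top_edge b j i k : Prop :=
  [/\ (j, k) \in consec b, (i, k) \in extremal b, cross b j k < cross b i k,
      novert b k (cross b j k) (cross b i k) &
      forall u, cross b j k < u <= cross b i k -> ~ vert b j u].

Definition unbounded b i j : Prop := forall t, cross b i j < t ->
  ~ vert b i t /\ ~ vert b j t.

Lemma ht_lt b i j s t : ht b i s = ht b j s -> a i < a j -> s < t ->
  ht b i t < ht b j t.
Proof. by rewrite /ht => h ij st; nra. Qed.

Lemma ht_gt b i j s t : ht b i s = ht b j s -> a i < a j -> t < s ->
  ht b j t < ht b i t.
Proof. by rewrite /ht => h ij st; nra. Qed.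

(** Follow both edges from the left corner to the first vertex, say on [i]. A line of smaller slope
    through it would be above the corner and would have had to cross [j] earlier; so [i] has the
    least slope there and begins the extremal pair. *)
Lemma right_corner_next b i j : (i, j) \in consec b ->
  [\/ unbounded b i j, exists k, bottom_edge b j i k
    | exists i', top_edge b i i' j].
Proof.
move=> ijC; have /consecP[ij cij] := ijC.
have ne := lt_slope_neq ij; have hc := ht_cross b ne.
set s0 := cross b i j in hc cij *.
have bot t : s0 < t -> vert b i t -> novert b i s0 t -> novert b j s0 t ->
    exists k, bottom_edge b j i k.
  move=> st vi ni nj.
  have imin l : ht b l t = ht b i t -> a i <= a l.
    move=> li; rewrite leNgt; apply/negP => al.
    have lj : l != j by apply: lt_slope_neq; apply: lt_trans ij.
    have lti : ht b i s0 < ht b l s0 by apply: (ht_gt li).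
    have itj : ht b i t < ht b j t by apply: (ht_lt hc).
    apply: (nj (cross b l j)); last by rewrite crossC; apply: vert_cross; rewrite eq_sym.
    by apply: cross_between => //; rewrite li -hc; nra.
  have [k ki kmax] := max_thru b i t.
  have ik : a i < a k.
    have [l li hl] := vi; rewrite (lt_le_trans _ (kmax _ hl)) // lt_neqAle imin // andbT.
    by apply: contra li => /eqP/a_inj->.
  have tE : t = cross b i k by apply: cross_uniq; rewrite ?lt_slope_neq.
  exists k; rewrite /bottom_edge -tE; split => //.
  by apply/extremalP; split=> // l; rewrite -tE => hl; rewrite imin //= kmax.
have top t : s0 < t -> vert b j t -> novert b j s0 t ->
    (forall u, s0 < u <= t -> ~ vert b i u) -> exists i', top_edge b i i' j.
  move=> st vj nj ni.
  have jmax l : ht b l t = ht b j t -> a l <= a j.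
    move=> lj; rewrite leNgt; apply/negP => al.
    have li : l != i by rewrite eq_sym; apply: lt_slope_neq; apply: lt_trans al.
    have lti : ht b l s0 < ht b j s0 by apply: (ht_gt (esym lj)).
    have itj : ht b i t < ht b j t by apply: (ht_lt hc).
    have /andP[c1 c2] : s0 < cross b l i < t.
      by apply: cross_between => //; rewrite lj hc; nra.
    apply: (ni (cross b l i)); first by rewrite c1 ltW.
    by rewrite crossC; apply: vert_cross; rewrite eq_sym.
  have [k kj kmin] := min_thru b j t.
  have ik : a k < a j.
    have [l li hl] := vj; rewrite (le_lt_trans (kmin _ hl)) // lt_neqAle jmax // andbT.
    by apply: contra li => /eqP/a_inj->.
  have tE : t = cross b k j by apply: cross_uniq; rewrite ?lt_slope_neq.
  exists k; rewrite /top_edge -/s0 -tE; split => //.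
  apply/extremalP; split=> // l; rewrite -tE kj => hl.
  by rewrite kmin //= jmax.
have [ni|[ti [sti vi ni]]] := next_vert b i s0.
  have [nj|[tj [stj vj nj]]] := next_vert b j s0.
    by constructor 1 => t st; split; [apply: ni|apply: nj].
  constructor 3; apply: (top tj) => // u /andP[su _]; exact: ni.
have [nj|[tj [stj vj nj]]] := next_vert b j s0.
  constructor 2; apply: (bot ti) => // u /andP[su _]; exact: nj.
have [le|lt] := leP ti tj.
  constructor 2; apply: (bot ti) => // u /andP[su ut]; apply: nj.
  by rewrite su (lt_le_trans ut).
constructor 3; apply: (top tj) => // u /andP[su ut]; apply: ni.
by rewrite su (le_lt_trans ut).
Qed.

Lemma consec_same_l b i j j' : (i, j) \in consec b -> (i, j') \in consec b ->
  cross b i j = cross b i j' -> j = j'.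
Proof.
move=> /consecP[ij c] /consecP[ij' c'] e; apply: a_inj.
have h := ht_cross b (lt_slope_neq ij); have h' := ht_cross b (lt_slope_neq ij').
case: (ltgtP (a j) (a j')) => // lt.
  by case: (c' j); rewrite ?ij // -e h.
by case: (c j'); rewrite ?ij' // e h'.
Qed.

Lemma consec_same_r b i i' j : (i, j) \in consec b -> (i', j) \in consec b ->
  cross b i j = cross b i' j -> i = i'.
Proof.
move=> /consecP[ij c] /consecP[ij' c'] e; apply: a_inj.
have h := ht_cross b (lt_slope_neq ij); have h' := ht_cross b (lt_slope_neq ij').
case: (ltgtP (a i) (a i')) => // lt.
  by case: (c i'); rewrite ?ij' ?lt // e h' -e -h.
by case: (c' i); rewrite ?ij ?lt // -e h e -h'.
Qed.

Lemma novert_eq b i s s' t : s < t -> s' < t -> vert b i s -> vert b i s' ->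
  novert b i s t -> novert b i s' t -> s = s'.
Proof.
move=> st s't vs vs' n n'; case: (ltgtP s s') => // lt.
  by case: (n s') => //; rewrite lt.
by case: (n' s) => //; rewrite lt.
Qed.

(** Walking back along [i] to the preceding vertex recovers the corner, and [j] is the successor of
    [i] in slope there. *)
Lemma bottom_edge_inj b j j' i k :
  bottom_edge b j i k -> bottom_edge b j' i k -> j = j'.
Proof.
move=> [c _ s n _] [c' _ s' n' _]; apply: (consec_same_l c c').
by apply: (novert_eq s s' _ _ n n'); apply: vert_cross; apply: lt_slope_neq;
  [case/consecP: c|case/consecP: c'].
Qed.

Lemma top_edge_inj b j j' i k : top_edge b j i k -> top_edge b j' i k -> j = j'.
Proof.
move=> [c _ s n _] [c' _ s' n' _]; apply: (consec_same_r c c').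
by apply: (novert_eq s s' _ _ n n'); rewrite crossC; apply: vert_cross;
  rewrite eq_sym lt_slope_neq //; [case/consecP: c|case/consecP: c'].
Qed.

Definition bottom_edges b : {set I * I} :=
  [set p in extremal b | `[< exists j, bottom_edge b j p.1 p.2 >]].

Definition top_edges b : {set I * I} :=
  [set p in extremal b | `[< exists j, top_edge b j p.1 p.2 >]].

(** A vertex is charged at most once by a bottom and once by a top edge, and an unbounded cell is
    determined by its bottom line. *)
Lemma card_consec_le b :
  (#|consec b| <= #|I| + #|bottom_edges b| + #|top_edges b|)%N.
Proof.
pose U := [set p in consec b | `[< unbounded b p.1 p.2 >]].
pose T := [set p in consec b | `[< exists k, bottom_edge b p.2 p.1 k >]].
pose B := [set p in consec b | `[< exists i, top_edge b p.1 i p.2 >]].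
have sub : consec b \subset U :|: T :|: B.
  apply/fintype.subsetP => -[i j] h; rewrite !inE -!andb_orr; apply/andP; split.
    by move: h; rewrite inE.
  case: (right_corner_next h) => [u|t|t]; apply/orP;
    [left; apply/orP; left|left; apply/orP; right|right]; exact/asboolP.
have cU : (#|U| <= #|I|)%N.
  rewrite -cardsT; apply: (@card_le_rel _ _ _ _ (fun p i => p.1 = i)).
    by move=> [i j] _; exists i.
  move=> [i j] [i' j'] k /setIdP[h /asboolP u] /setIdP[h' /asboolP u'] /= ? ?.
  subst i' k.
  rewrite (@consec_same_l b i j j') //.
  have ij : i != j by apply: lt_slope_neq; case/consecP: h.
  have ij' : i != j' by apply: lt_slope_neq; case/consecP: h'.
  case: (ltgtP (cross b i j) (cross b i j')) => // lt.
    by have [+ _] := u _ lt; case; apply: vert_cross.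
  by have [+ _] := u' _ lt; case; apply: vert_cross.
have cT : (#|T| <= #|bottom_edges b|)%N.
  apply: (@card_le_rel _ _ _ _ (fun p q => bottom_edge b p.2 q.1 q.2 /\ p.1 = q.1)).
    move=> [i j]; rewrite !inE /= => /andP[_ /asboolP[k h]].
    exists (i, k) => //; rewrite inE /=; apply/andP; split; first by case: h.
    by apply/asboolP; exists j.
  move=> [i j] [i' j'] [k l] _ _ /= [h e] [h' e']; subst.
  by rewrite (bottom_edge_inj h h').
have cB : (#|B| <= #|top_edges b|)%N.
  apply: (@card_le_rel _ _ _ _ (fun p q => top_edge b p.1 q.1 q.2 /\ p.2 = q.2)).
    move=> [i j]; rewrite !inE /= => /andP[_ /asboolP[k h]].
    exists (k, j) => //; rewrite inE /=; apply/andP; split; first by case: h.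
    by apply/asboolP; exists i.
  move=> [i j] [i' j'] [k l] _ _ /= [h e] [h' e']; subst.
  by rewrite (top_edge_inj h h').
apply: leq_trans (subset_leq_card sub) _.
apply: leq_trans (leq_card_setU _ _) _; apply: leq_add => //.
by apply: leq_trans (leq_card_setU _ _) _; apply: leq_add.
Qed.

(** * Vertices and their multiplicities *)

Definition verts b : {set {set I}} := [set blk b p.1 p.2 | p in extremal b].

Definition double_verts b : {set {set I}} := [set T in verts b | #|T| == 2%N].

Lemma blk_l b i j : i \in blk b i j.
Proof. by rewrite inE. Qed.

Lemma blk_r b i j : i != j -> j \in blk b i j.
Proof. by move=> ij; rewrite inE -ht_cross. Qed.

Lemma cross_blk b i j i' j' : i' \in blk b i j -> j' \in blk b i j ->
  i' != j' -> cross b i' j' = cross b i j.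
Proof.
by rewrite !inE => /eqP hi /eqP hj ne; rewrite -(@cross_uniq b i' j' (cross b i j) ne) // hi hj.
Qed.

Lemma blk_eq b i j i' j' : i' \in blk b i j -> j' \in blk b i j ->
  i' != j' -> blk b i' j' = blk b i j.
Proof.
move=> hi hj ne; apply/setP => k; rewrite !inE (cross_blk hi hj ne).
by move: hi; rewrite inE => /eqP ->.
Qed.

Lemma extremal_neq b i j : (i, j) \in extremal b -> i != j.
Proof. by case/extremalP => + _; apply: lt_slope_neq. Qed.

Lemma consec_neq b i j : (i, j) \in consec b -> i != j.
Proof. by case/consecP => + _; apply: lt_slope_neq. Qed.

Lemma blk_extremal_inj b :
  {in extremal b &, injective (fun p => blk b p.1 p.2)}.
Proof.
move=> [i j] [i' j'] h h' /= e.
have ne := extremal_neq h; have ne' := extremal_neq h'.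
have /extremalP[_ m] := h; have /extremalP[_ m'] := h'.
have r k : k \in blk b i j -> a i <= a k <= a j by rewrite inE => /eqP/m.
have r' k : k \in blk b i j -> a i' <= a k <= a j'.
  by rewrite e inE => /eqP/m'.
have /andP[i1 _] := r' _ (blk_l _ _ _); have /andP[_ j1] := r' _ (blk_r _ ne).
have i'T : i' \in blk b i j by rewrite e blk_l.
have j'T : j' \in blk b i j by rewrite e blk_r.
have /andP[i2 _] := r _ i'T; have /andP[_ j2] := r _ j'T.
by congr pair; apply: a_inj; apply/eqP; rewrite eq_le ?i1 ?i2 ?j1 ?j2.
Qed.

Lemma card_verts b : #|verts b| = #|extremal b|.
Proof. exact/card_in_imset/blk_extremal_inj. Qed.

Lemma blk_verts b i j : i != j -> blk b i j \in verts b.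
Proof.
move=> ij; have hij := ht_cross b ij.
have [k hk kmin] := min_thru b i (cross b i j).
have [l hl lmax] := max_thru b i (cross b i j).
have kT : k \in blk b i j by rewrite inE hk.
have lT : l \in blk b i j by rewrite inE hl.
have kl : a k < a l.
  rewrite lt_neqAle (le_trans (kmin i _) (lmax i _)) // andbT.
  apply: contra ij => /eqP kl.
  have := kmin i erefl; have := lmax i erefl.
  have := kmin j (esym hij); have := lmax j (esym hij) => *.
  by apply/eqP/a_inj/eqP; rewrite eq_le; apply/andP; split; lra.
apply/imsetP; exists (k, l) => /=; last by rewrite (blk_eq kT lT) ?lt_slope_neq.
apply/extremalP; split=> // m; rewrite (cross_blk kT lT) ?lt_slope_neq // hk => hm.
by rewrite kmin ?lmax.
Qed.

Lemma vertsP b T : T \in verts b -> exists i j, [/\ a i < a j, i \in T, j \in T,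
  T = blk b i j & forall k, k \in T -> a i <= a k <= a j].
Proof.
case/imsetP => -[i j] h ->; exists i, j; have /extremalP[ij m] := h.
split; rewrite ?blk_l ?blk_r ?lt_slope_neq //= => k; rewrite inE => /eqP; exact: m.
Qed.

Lemma blk_vertsE b T i j : T \in verts b -> i \in T -> j \in T -> i != j ->
  T = blk b i j.
Proof. by case/vertsP => i' [j' [_ _ _ -> _]] hi hj ne; rewrite (blk_eq hi hj). Qed.

Lemma card_vert_ge2 b T : T \in verts b -> (1 < #|T|)%N.
Proof.
case/vertsP => i [j [ij iT jT _ _]]; apply/card_gt1P; exists i, j.
by split=> //; apply: lt_slope_neq.
Qed.

(** Every line through a vertex except the one of largest slope has a successor in slope; the
    extremal pair accounts for the exception. *)
Lemma sum_card_verts b :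
  (\sum_(T in verts b) #|T| <= #|consec b| + #|extremal b|)%N.
Proof.
have pCP : #|consec b| =
    (\sum_(T in verts b) #|[set p in consec b | blk b p.1 p.2 == T]|)%N.
  rewrite -sum1_card (partition_big (fun p => blk b p.1 p.2) (mem (verts b))) /=.
    by apply: eq_bigr => T _; rewrite -sum1_card; apply: eq_bigl => p; rewrite inE.
  by move=> [i j] /consec_neq ij; apply: blk_verts.
rewrite pCP -card_verts -sum1_card -big_split /=; apply: leq_sum => T TV.
have [i [j [ij iT jT TE m]]] := vertsP TV.
rewrite (cardsD1 j) jT addnC leq_add2r.
apply: (@card_le_rel _ _ _ _ (fun k p => p.1 = k)); last by move=> x x' y _ _ -> ->.
move=> k; rewrite !inE => /andP[kj kT].
have kaj : a k < a j.
  by rewrite lt_neqAle (inj_eq a_inj) kj; case/andP: (m _ kT).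
have [l [lC lE lj]] := succ_slope (esym (ht_cross b kj)) kaj.
exists (k, l) => //; rewrite inE lC /= /blk lE -/(blk b k j).
by rewrite -(blk_vertsE TV kT jT kj).
Qed.

Lemma consec_ge b : (2 * #|extremal b| <= #|consec b| + #|double_verts b|)%N.
Proof.
have h := sum_card_verts b.
suff : (3 * #|extremal b| <= \sum_(T in verts b) #|T| + #|double_verts b|)%N by lia.
rewrite -card_verts mulnC -sum_nat_const.
have -> : #|double_verts b| = (\sum_(T in verts b) (#|T| == 2%N))%N.
  by rewrite -sum1_card big_mkcond /= [RHS]big_mkcond /=; apply: eq_bigr => T _; rewrite inE; case: (_ \in _); case: eqP.
rewrite -big_split /=; apply: leq_sum => T /card_vert_ge2.
by case: eqP => /=; lia.
Qed.

(** The previous bounds give that the sum of [|T| - 3] is at most [|I|], with negative terms only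
    from double vertices. The weights come from [|T| [|T| != 3] + 12 <= 4 |T| + 6 [|T| = 2]], valid
    for [|T| >= 2]. *)
Lemma sum_non3_verts b : (\sum_(T in verts b | #|T| != 3%N) #|T| <=
  4 * #|I| + 6 * #|double_verts b|)%N.
Proof.
have h := sum_card_verts b; have h2 := card_consec_le b.
have s1 : (#|bottom_edges b| <= #|extremal b|)%N.
  by apply/subset_leq_card/fintype.subsetP => p /setIdP[].
have s2 : (#|top_edges b| <= #|extremal b|)%N.
  by apply/subset_leq_card/fintype.subsetP => p /setIdP[].
suff : (\sum_(T in verts b | #|T| != 3%N) #|T| + 12 * #|extremal b| <=
    4 * \sum_(T in verts b) #|T| + 6 * #|double_verts b|)%N by lia.
rewrite -card_verts mulnC -sum_nat_const big_distrr /=.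
have -> : #|double_verts b| = (\sum_(T in verts b) (#|T| == 2%N))%N.
  by rewrite -sum1_card big_mkcond /= [RHS]big_mkcond /=; apply: eq_bigr => T _; rewrite inE; case: (_ \in _); case: eqP.
rewrite big_distrr big_mkcondr /= -!big_split /=; apply: leq_sum => T /card_vert_ge2.
by case: eqP; case: eqP => /=; lia.
Qed.

(** * Point reflection, and triangles above and below vertices *)

(** Reflection of the arrangement in the origin: slopes are kept, left and right are exchanged, and
    so are above and below. *)
Definition opp b : I -> R := fun i => - b i.

Lemma oppK b : opp (opp b) = b.
Proof. by apply/funext => i; rewrite /opp opprK. Qed.

Lemma cross_opp b i j : cross (opp b) i j = - cross b i j.
Proof. by rewrite /cross /opp -mulNr; congr (_ / _); ring. Qed.

Lemma ht_opp b i s : ht (opp b) i s = - ht b i (- s).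
Proof. by rewrite /ht /opp; ring. Qed.

Lemma thru_opp b i s : thru (opp b) i s = thru b i (- s).
Proof. by apply/setP => k; rewrite !inE !ht_opp eqr_opp. Qed.

Lemma blk_opp b i j : blk (opp b) i j = blk b i j.
Proof. by rewrite /blk thru_opp cross_opp opprK. Qed.

Lemma consec_opp b : consec (opp b) = consec b.
Proof. by apply/setP => p; rewrite !inE blk_opp. Qed.

Lemma extremal_opp b : extremal (opp b) = extremal b.
Proof. by apply/setP => p; rewrite !inE blk_opp. Qed.

Lemma vert_opp b i s : vert (opp b) i s <-> vert b i (- s).
Proof.
split=> -[k ki]; rewrite ?ht_opp => h; exists k => //.
  exact: oppr_inj.
by rewrite !ht_opp h.
Qed.

Lemma novert_opp b i s t : novert (opp b) i s t <-> novert b i (- t) (- s).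
Proof.
split=> h u /andP[u1 u2].
  have := h (- u); rewrite vert_opp opprK; apply; lra.
by rewrite vert_opp; apply: h; lra.
Qed.

Definition side b l (v : R * R) : R := v.2 - ht b l v.1.

(** A line through one of the points does not count as separating; for two points of a common line
    this means that no vertex of that line lies strictly between them. *)
Definition nosep b (v w : R * R) : Prop := forall l, 0 <= side b l v * side b l w.

Definition vpt b i j : R * R := (cross b i j, ht b i (cross b i j)).

(** The triangular cell directly above the vertex of [i] and [k]: its other corners lie to the left
    on [i] and to the right on [k], and [j] carries the top side. Over [opp b] it is the cell below
    the vertex. Emptiness is expressed by the corners alone. *)
Definition tri b i j k : Prop :=
  [/\ a i < a j < a k, cross b i j < cross b i k < cross b j k,
      nosep b (vpt b i j) (vpt b i k), nosep b (vpt b i k) (vpt b j k)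
    & nosep b (vpt b i j) (vpt b j k)].

Lemma nosepC b v w : nosep b v w -> nosep b w v.
Proof. by move=> h l; rewrite mulrC. Qed.

Lemma nosep_weak b (u v w : R * R) :
  (forall l, (0 <= side b l u /\ 0 <= side b l v /\ 0 <= side b l w) \/
     (side b l u <= 0 /\ side b l v <= 0 /\ side b l w <= 0)) ->
  [/\ nosep b u v, nosep b v w & nosep b u w].
Proof. by move=> h; split=> l; have := h l; nra. Qed.

Lemma nosep_novert b i s t : nosep b (s, ht b i s) (t, ht b i t) -> novert b i s t.
Proof.
move=> h u /andP[su ut] [l li hl]; have := h l; rewrite /side /=.
rewrite !ht_diff 1?eq_sym //; rewrite -(@cross_uniq b i l u) // 1?eq_sym //.
have h2 : 0 < (a i - a l) ^+ 2 by rewrite exprn_even_gt0 //= slope_neq // eq_sym.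
apply/negP; rewrite -ltNge.
have -> : (a i - a l) * (s - u) * ((a i - a l) * (t - u)) =
  (a i - a l) ^+ 2 * ((s - u) * (t - u)) by ring.
by rewrite pmulr_rlt0 //; nra.
Qed.

Lemma no_cross_above b j l s t : s < t -> j != l ->
  (forall u, s < u < t -> ~ vert b j u) ->
  ht b l t < ht b j t -> ht b l s <= ht b j s.
Proof.
move=> st jl nj lt; rewrite leNgt; apply/negP => lt'.
apply: (nj (cross b j l)); last exact: vert_cross.
by apply: cross_between => //; nra.
Qed.

Lemma no_cross_below b j l s t : s < t -> j != l ->
  (forall u, s < u < t -> ~ vert b j u) ->
  ht b j t < ht b l t -> ht b j s <= ht b l s.
Proof.
move=> st jl nj lt; rewrite leNgt; apply/negP => lt'.
apply: (nj (cross b j l)); last exact: vert_cross.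
by apply: cross_between => //; nra.
Qed.

Lemma no_cross_above_r b j l s t : s < t -> j != l ->
  (forall u, s < u < t -> ~ vert b j u) ->
  ht b l s < ht b j s -> ht b l t <= ht b j t.
Proof.
move=> st jl nj lt; rewrite leNgt; apply/negP => lt'.
apply: (nj (cross b j l)); last exact: vert_cross.
by apply: cross_between => //; nra.
Qed.

Lemma no_cross_below_r b j l s t : s < t -> j != l ->
  (forall u, s < u < t -> ~ vert b j u) ->
  ht b j s < ht b l s -> ht b j t <= ht b l t.
Proof.
move=> st jl nj lt; rewrite leNgt; apply/negP => lt'.
apply: (nj (cross b j l)); last exact: vert_cross.
by apply: cross_between => //; nra.
Qed.

(* Both edges see the line immediately above the vertex [vpt b i k]; the
   different tie-breaking in [bottom_edge] and [top_edge] makes it unique. *)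
Lemma tri_of_edges b i j j' k :
  bottom_edge b j i k -> top_edge (opp b) j' i k -> tri b i j k.
Proof.
case=> ijC ikV s12 ni nj [].
rewrite consec_opp !cross_opp ltrN2 => jkC _ s23.
rewrite novert_opp !opprK => nk njr.
have {}njr u : cross b i k <= u < cross b j' k -> ~ vert b j' u.
  move=> /andP[u1 u2]; have := njr (- u); rewrite vert_opp opprK; apply.
  by rewrite ltrN2 lerN2 u1 u2.
have ne_ij := consec_neq ijC; have ne_j'k := consec_neq jkC.
have ne_ik := extremal_neq ikV.
have /consecP[aij cij] := ijC; have /consecP[aj'k cj'k] := jkC.
have /extremalP[aik mik] := ikV.
set s1 := cross b i j in s12 ni nj cij *; set s2 := cross b i k in s12 s23 mik ni nj nk njr *.
set s3 := cross b j' k in s23 nk njr cj'k.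
have h1 : ht b i s1 = ht b j s1 by apply: ht_cross.
have h2 : ht b i s2 = ht b k s2 by apply: ht_cross.
have h3 : ht b j' s3 = ht b k s3 by apply: ht_cross.
have lt_j : ht b i s2 < ht b j s2 by apply: (ht_lt h1).
have lt_j' : ht b i s2 < ht b j' s2 by rewrite h2; apply: (ht_gt h3).
(* A line [l] passing between the vertex and [j] would be forced through the corner of [i] and [j],
   with a slope between theirs. *)
have above l : ht b i s2 < ht b l s2 -> ht b j s2 <= ht b l s2.
  move=> lt; rewrite leNgt; apply/negP => ltj.
  have ne_jl : j != l by apply: contraTneq ltj => ->; rewrite ltxx.
  have ne_il : i != l by apply: contraTneq lt => ->; rewrite ltxx.
  have l1 := no_cross_above s12 ne_jl nj ltj.
  have l2 := no_cross_below s12 ne_il ni lt.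
  have l3 : ht b l s1 = ht b i s1 by apply/eqP; rewrite eq_le l2 h1 l1.
  apply: (cij l l3); apply/andP; split; rewrite ltNge; apply/negP => h; move: l3 h1 lt ltj; rewrite /ht; nra.
have above' l : ht b i s2 < ht b l s2 -> ht b j' s2 <= ht b l s2.
  move=> lt; rewrite leNgt; apply/negP => ltj.
  have ne_jl : j' != l by apply: contraTneq ltj => ->; rewrite ltxx.
  have ne_kl : k != l by apply: contraTneq lt => <-; rewrite h2 ltxx.
  have nj' u : s2 < u < s3 -> ~ vert b j' u.
    by move=> /andP[u1 u2]; apply: njr; rewrite ltW.
  have l1 := no_cross_above_r s23 ne_jl nj' ltj.
  have l2 : ht b k s3 <= ht b l s3 by apply: (no_cross_below_r s23 ne_kl nk); rewrite -h2.
  have l3 : ht b l s3 = ht b j' s3 by apply/eqP; rewrite eq_le l1 h3 l2.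
  apply: (cj'k l l3); apply/andP; split; rewrite ltNge; apply/negP => h; move: l3 h3 lt ltj; rewrite h2 /ht; nra.
have jj' : j = j'.
  apply/eqP/negPn/negP => ne; apply: (njr s2); first by rewrite lexx.
  by exists j => //; apply/eqP; rewrite eq_le above // above'.
have s3E : s3 = cross b j k by rewrite /s3 jj'.
rewrite -jj' in h3 njr aj'k.
have nj3 u : s2 < u < s3 -> ~ vert b j u.
  by move=> /andP[u1 u2]; apply: njr; rewrite (ltW u1).
have [|n1 n2 n3] := @nosep_weak b (vpt b i j) (vpt b i k) (vpt b j k).
  move=> l; rewrite /side /vpt /= -/s1 -/s2 -s3E.
  have [lt|lt|eq2] := ltgtP (ht b i s2) (ht b l s2).
  - right; rewrite !subr_le0 (ltW lt).
    have [jl|ne_jl] := eqVneq j l; first by subst l; rewrite h1 !lexx.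
    have lt' : ht b j s2 < ht b l s2.
      rewrite lt_neqAle above // andbT; apply/negP => /eqP e.
      apply: (njr s2); first by rewrite lexx.
      by exists l; rewrite 1?eq_sym.
    by rewrite h1 (no_cross_below s12 ne_jl nj lt') (no_cross_below_r s23 ne_jl nj3 lt').
  - left; rewrite !subr_ge0 (ltW lt) h3.
    have [il|ne_il] := eqVneq i l; first by subst l; move: lt; rewrite ltxx.
    have [kl|ne_kl] := eqVneq k l; first by subst l; move: lt; rewrite h2 ltxx.
    have lt' : ht b l s2 < ht b k s2 by rewrite -h2.
    rewrite (no_cross_above s12 ne_il ni lt).
    by rewrite (no_cross_above_r s23 ne_kl nk lt').
  - left; rewrite !subr_ge0 eq2 lexx h3.
    have /andP[il lk] := mik _ (esym eq2).
    by split; [|split=> //]; move: h2 eq2; rewrite /ht; nra.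
split=> //; first by rewrite aij.
by rewrite s12 -/s2 -s3E s23.
Qed.

Lemma side_opp b l v : side (opp b) l v = - side b l (- v.1, - v.2).
Proof. by rewrite /side /= ht_opp; ring. Qed.

Lemma nosep_vpt_opp b i j i' j' :
  nosep (opp b) (vpt (opp b) i j) (vpt (opp b) i' j') ->
  nosep b (vpt b i j) (vpt b i' j').
Proof.
move=> h l; have := h l; rewrite !side_opp /= !cross_opp !ht_opp !opprK.
by rewrite mulrNN.
Qed.

Definition top_tri b : {set I * I} :=
  [set p in extremal b | `[< exists j, tri b p.1 j p.2 >]].

Lemma verts_opp b : verts (opp b) = verts b.
Proof.
rewrite /verts extremal_opp; apply: eq_imset => p; exact: blk_opp.
Qed.

Lemma double_verts_opp b : double_verts (opp b) = double_verts b.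
Proof. by rewrite /double_verts verts_opp. Qed.

(** Inclusion-exclusion: a vertex charged in both ways has a triangle above it. *)
Lemma top_tri_ge b : (#|bottom_edges b| + #|top_edges (opp b)| <=
  #|extremal b| + #|top_tri b|)%N.
Proof.
rewrite -cardsUI; apply: leq_add; apply/subset_leq_card/fintype.subsetP => p.
  by move=> /setUP[]/setIdP[//]; rewrite extremal_opp.
move=> /setIP[/setIdP[pV /asboolP[j h]] /setIdP[_ /asboolP[j' h']]].
apply/setIdP; split=> //; apply/asboolP; exists j; exact: tri_of_edges h h'.
Qed.

(** The four charge counts of the arrangement and its reflection are regrouped: one bottom and one
    reflected top count concern the cell above a vertex, the other two the cell below. *)
Lemma top_tri_card b : (2 * #|consec b| <=
  2 * #|I| + 2 * #|extremal b| + #|top_tri b| + #|top_tri (opp b)|)%N.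
Proof.
have h1 := top_tri_ge b; have h2 := top_tri_ge (opp b).
have h3 := card_consec_le b; have h4 := card_consec_le (opp b).
rewrite oppK extremal_opp in h2; rewrite consec_opp in h4; lia.
Qed.

Lemma top_tri_sub b : top_tri b \subset extremal b.
Proof. by apply/fintype.subsetP => p /setIdP[]. Qed.

(** Since [|consec b|] is at least twice the number of vertices minus the number of double ones, the
    previous bound is almost an equality, and few triangles can be missing. *)
Lemma card_nontop b : (#|extremal b :\: top_tri b| +
  #|extremal b :\: top_tri (opp b)| <= 2 * #|double_verts b| + 2 * #|I|)%N.
Proof.
have s1 := top_tri_sub b; have s2 := top_tri_sub (opp b).
rewrite extremal_opp in s2.
rewrite !cardsD (finset.setIidPr s1) (finset.setIidPr s2).
have := subset_leq_card s1; have := subset_leq_card s2.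
have := top_tri_card b; have := consec_ge b; lia.
Qed.

(** * Triangles to the right and left of vertices *)

(** [s] and [t] are where the two edges leaving the left corner end. The cell determines them, and
    for a triangle they determine the third side. *)
Definition corner b i j s t : Prop :=
  [/\ cross b i j < s, cross b i j < t, vert b i s, vert b j t &
      novert b i (cross b i j) s /\ novert b j (cross b i j) t].

Lemma first_vert_uniq b i c s t : c < s -> c < t -> vert b i s -> vert b i t ->
  novert b i c s -> novert b i c t -> s = t.
Proof.
move=> cs ct vs vt ns nt; case: (ltgtP s t) => // lt.
  by case: (nt s) => //; rewrite cs.
by case: (ns t) => //; rewrite ct.
Qed.

Lemma corner_uniq b i j s t s' t' : corner b i j s t -> corner b i j s' t' ->
  s = s' /\ t = t'.
Proof.
move=> [cs ct vs vt [ns nt]] [cs' ct' vs' vt' [ns' nt']].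
by split; [exact: (first_vert_uniq cs cs' vs vs' ns ns')
  |exact: (first_vert_uniq ct ct' vt vt' nt nt')].
Qed.

Lemma tri_neq b i j k : tri b i j k -> [/\ i != j, j != k & i != k].
Proof.
case=> /andP[ij jk] _ _ _ _; split; apply: lt_slope_neq => //.
exact: lt_trans jk.
Qed.

Lemma vpt_r b i j : i != j -> vpt b i j = (cross b i j, ht b j (cross b i j)).
Proof. by move=> ij; rewrite /vpt ht_cross. Qed.

Lemma tri_novert b i j k : tri b i j k ->
  [/\ novert b i (cross b i j) (cross b i k),
      novert b k (cross b i k) (cross b j k) &
      novert b j (cross b i j) (cross b j k)].
Proof.
move=> h; have [ij jk ik] := tri_neq h; case: h => _ _ h1 h2 h3.
split; apply: nosep_novert.
- exact: h1.
- by move: h2; rewrite !vpt_r.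
- by move: h3; rewrite (vpt_r b ij).
Qed.

Lemma corner_tri b i j k : tri b i j k -> corner b i j (cross b i k) (cross b j k).
Proof.
move=> h; have [ij jk ik] := tri_neq h; have [n1 _ n3] := tri_novert h.
case: h => _ /andP[c1 c2] _ _ _.
by split=> //; [apply: lt_trans c2|apply: vert_cross|apply: vert_cross].
Qed.

Lemma corner_tri_opp b i j k : tri (opp b) k i j ->
  corner b i j (cross b k i) (cross b k j).
Proof.
move=> h; have [ki ij kj] := tri_neq h; have [_ n1 n2] := tri_novert h.
case: h => _; rewrite !cross_opp !ltrN2 => /andP[c1 c2] _ _ _.
rewrite !cross_opp !novert_opp !opprK in n1 n2.
split=> //; first exact: lt_trans c1.
- by rewrite crossC; apply: vert_cross; rewrite eq_sym.
- by rewrite crossC; apply: vert_cross; rewrite eq_sym.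
Qed.

Lemma cross_triple b i j k k' : i != j -> i != k -> i != k' -> j != k -> j != k' ->
  cross b i k = cross b i k' -> cross b j k = cross b j k' ->
  cross b i k != cross b j k -> k = k'.
Proof.
move=> ij ik ik' jk jk' ei ej; apply: contraNeq => kk'.
have e1 : ht b k (cross b i k) = ht b k' (cross b i k).
  by rewrite -ht_cross // ei ht_cross.
have e2 : ht b k (cross b j k) = ht b k' (cross b j k).
  by rewrite -ht_cross // ej ht_cross.
by rewrite (cross_uniq kk' e1) (cross_uniq kk' e2).
Qed.

Lemma tri_uniq_l b i j k k' : tri b i j k -> tri b i j k' -> k = k'.
Proof.
move=> h h'; have [e1 e2] := corner_uniq (corner_tri h) (corner_tri h').
have [ij jk ik] := tri_neq h; have [_ jk' ik'] := tri_neq h'.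
apply: (@cross_triple b i j) => //.
by case: h => _ /andP[_ c] _ _ _; rewrite lt_eqF.
Qed.

Lemma tri_uniq_r b i j k k' : tri (opp b) k i j -> tri (opp b) k' i j -> k = k'.
Proof.
move=> h h'; have [e1 e2] := corner_uniq (corner_tri_opp h) (corner_tri_opp h').
have [ki ij kj] := tri_neq h; have [k'i _ k'j] := tri_neq h'.
rewrite !(crossC b k) !(crossC b k') in e1 e2.
apply: (@cross_triple b i j) => //; rewrite 1?eq_sym //.
case: h => _ /andP[c _] _ _ _; move: c; rewrite !cross_opp ltrN2 => c.
by rewrite !(crossC b _ k) lt_eqF.
Qed.

Lemma tri_not_both b i j k l : tri b i j k -> ~ tri (opp b) l i j.
Proof.
move=> h h'; have [e1 e2] := corner_uniq (corner_tri h) (corner_tri_opp h').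
case: h h' => _ /andP[_ c] _ _ _ [_ /andP[c' _] _ _ _].
by move: c'; rewrite !cross_opp ltrN2 -e1 -e2 ltNge (ltW c).
Qed.

(** The third side of a triangle with left corner [(i, j)] is either steeper than [j] or less steep
    than [i], never in between; the triangle is then above or below its middle vertex. *)
Definition right_tri b i j : Prop :=
  (exists k, tri b i j k) \/ (exists k, tri (opp b) k i j).

Definition nonright b : {set I * I} :=
  [set p in consec b | ~~ `[< right_tri b p.1 p.2 >]].

Lemma tri_consec_l b i j k : tri b i j k -> (i, j) \in consec b.
Proof.
move=> h; have [ij jk ik] := tri_neq h.
have [/andP[aij ajk] /andP[c1 c2] _ h2 _] := h.
apply/consecP; split=> // l el /andP[il lj]; have := h2 l.
apply/negP; rewrite -ltNge /side /=.
have g1 := ht_lt (esym el) il c1.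
have el' : ht b l (cross b i j) = ht b j (cross b i j) by rewrite el ht_cross.
have g2 := ht_lt el' lj (lt_trans c1 c2).
by rewrite nmulr_rlt0 ?subr_gt0 ?subr_lt0.
Qed.

Lemma tri_consec_r b i j k : tri b i j k -> (j, k) \in consec b.
Proof.
move=> h; have [ij jk ik] := tri_neq h.
have [/andP[aij ajk] /andP[c1 c2] h1 _ _] := h.
apply/consecP; split=> // l el /andP[jl lk]; have := h1 l.
apply/negP; rewrite -ltNge /side (vpt_r b ij) (vpt_r b ik) /=.
have g1 := ht_gt (esym el) jl (lt_trans c1 c2).
have el' : ht b l (cross b j k) = ht b k (cross b j k) by rewrite el ht_cross.
have g2 := ht_gt el' lk c2.
by rewrite pmulr_rlt0 ?subr_gt0 ?subr_lt0.
Qed.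

(** Sending a triangle to its left corner is injective, and there are enough triangles by
    [top_tri_card] to use up almost all consecutive pairs. *)
Lemma card_nonright b :
  (#|nonright b| <= #|double_verts b| + 2 * #|I|)%N.
Proof.
pose A := [set q : I * I * bool |
  q.1 \in (if q.2 then top_tri b else top_tri (opp b))].
have cA : #|A| = (#|top_tri b| + #|top_tri (opp b)|)%N.
  rewrite -(cardsID [set q : I * I * bool | q.2]); congr addn.
    have -> : A :&: [set q | q.2] = [set (p, true) | p in top_tri b].
      apply/setP => -[p c]; rewrite !inE; apply/andP/imsetP => /=.
        by case=> + cT; rewrite cT => h; exists p.
      by case=> p' h [-> ->].
    by apply: card_imset => p p' [].
  have -> : A :\: [set q | q.2] = [set (p, false) | p in top_tri (opp b)].
    apply/setP => -[p c]; rewrite !inE; apply/andP/imsetP => /=.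
      by case=> /negbTE-> h; exists p.
    by case=> p' h [-> ->].
  by apply: card_imset => p p' [].
have : (#|A| <= #|consec b :\: nonright b|)%N.
  apply: (@card_le_rel _ _ _ _ (fun q p => if q.2 then
      q.1.1 = p.1 /\ tri b p.1 p.2 q.1.2
    else q.1.2 = p.2 /\ tri (opp b) q.1.1 p.1 p.2)).
    move=> [[i k] []]; rewrite inE /= => /setIdP[_ /asboolP/= [j h]].
      exists (i, j) => //; have hC := tri_consec_l h; apply/setDP; split=> //.
      apply/negP => /setIdP[_ /negP]; apply; apply/asboolP; left; by exists k.
    exists (j, k) => //; have := tri_consec_r h; rewrite consec_opp => hC.
    apply/setDP; split=> //.
    by apply/negP => /setIdP[_ /negP]; apply; apply/asboolP; right; exists i.
  move=> [[i k] []] [[i' k'] []] [j l] /= _ _ [e h] [e' h']; subst.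
  - by rewrite (tri_uniq_l h h').
  - by case: (tri_not_both h h').
  - by case: (tri_not_both h' h).
  - by rewrite (tri_uniq_r h h').
have sub : nonright b \subset consec b by apply/fintype.subsetP => p /setIdP[].
rewrite cA cardsD (finset.setIidPr sub).
have := subset_leq_card sub; have := top_tri_card b; have := consec_ge b; lia.
Qed.

(** The six conditions are for the six cells around the vertex; those with [opp b] concern the cell
    below and the two cells on the left. *)
Definition good_vert b (T : {set I}) : Prop := exists i j k,
  [/\ a i < a j < a k, T = [set i; j; k] /\ T \in verts b,
      (exists l, tri b i l k) /\ (exists l, tri (opp b) i l k),
      right_tri b i j /\ right_tri b j k &
      right_tri (opp b) i j /\ right_tri (opp b) j k].

Definition bad_verts b : {set {set I}} := [set T in verts b | ~~ `[< good_vert b T >]].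

Lemma card3_vertsP b T : T \in verts b -> #|T| = 3%N -> exists i j k,
  [/\ T = [set i; j; k], (i, k) \in extremal b, (i, j) \in consec b &
      (j, k) \in consec b].
Proof.
move=> TV T3; have [i [k [ik iT kT TE m]]] := vertsP TV.
have /card_gt0P[j] : (0 < #|T :\ i :\ k|)%N.
  have := cardsD1 i T; have := cardsD1 k (T :\ i); rewrite T3 iT !inE kT.
  by rewrite eq_sym (lt_slope_neq ik); lia.
rewrite !inE => /and3P[jk ji jT].
have TE3 : T = [set i; j; k].
  apply/esym/eqP; rewrite eqEcard T3; apply/andP; split.
    by apply/fintype.subsetP => x; rewrite !inE => /orP[/orP[]|] /eqP->.
  by rewrite -finset.setUA cardsU1 cards2 !inE jk (negbTE (lt_slope_neq ik)) eq_sym (negbTE ji).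
have aij : a i < a j.
  by rewrite lt_neqAle (inj_eq a_inj) eq_sym ji; case/andP: (m _ jT).
have ajk : a j < a k.
  by rewrite lt_neqAle (inj_eq a_inj) jk; case/andP: (m _ jT).
have h l x y : a x < a y -> x \in T -> y \in T ->
    ht b l (cross b x y) = ht b x (cross b x y) -> [\/ l = i, l = j | l = k].
  move=> xy xT yT hl.
  have : l \in blk b x y by rewrite inE hl.
  rewrite -(blk_vertsE TV xT yT) ?lt_slope_neq // TE3 !inE => /orP[/orP[]|] /eqP->;
    by [constructor 1|constructor 2|constructor 3].
exists i, j, k; split=> //.
- apply/extremalP; split=> // l hl; apply: m; rewrite TE inE; exact/eqP.
- apply/consecP; split=> // l hl /andP[l1 l2].
  by case: (h l i j aij iT jT hl) => e; subst l; rewrite ?ltxx // in l1 l2; clear T3; lra.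
- apply/consecP; split=> // l hl /andP[l1 l2].
  by case: (h l j k ajk jT kT hl) => e; subst l; rewrite ?ltxx // in l1 l2; clear T3; lra.
Qed.

(** With [v] double vertices, those not on three lines weigh at most [4 |I| + 6 v]. Any other bad
    vertex weighs 3 and lacks one of its six triangles, hence comes from a pair in [N], which has at
    most [6 |I| + 4 v] elements. *)
Lemma sum_bad_verts b : (\sum_(T in bad_verts b) #|T| <=
  22 * #|I| + 18 * #|double_verts b|)%N.
Proof.
have h := sum_non3_verts b.
pose N := (extremal b :\: top_tri b) :|: (extremal b :\: top_tri (opp b)) :|:
  (nonright b :|: nonright (opp b)).
have hN : (#|N| <= 4 * #|double_verts b| + 6 * #|I|)%N.
  have := card_nontop b; have := card_nonright b; have := card_nonright (opp b).
  rewrite double_verts_opp => h1 h2 h3.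
  apply: leq_trans (leq_card_setU _ _) _.
  apply: leq_trans (leq_add (leq_card_setU _ _) (leq_card_setU _ _)) _.
  by apply: leq_trans (leq_add h3 (leq_add h2 h1)) _; lia.
pose B3 := [set T in bad_verts b | #|T| == 3%N].
have hB : (#|B3| <= #|N|)%N.
  apply: leq_trans (leq_imset_card (fun p => blk b p.1 p.2) N).
  apply/subset_leq_card/fintype.subsetP => T /setIdP[/setIdP[TV /negP bad] /eqP T3].
  have [i [j [k [TE ikV ijC jkC]]]] := card3_vertsP TV T3.
  have [iT jT kT] : [/\ i \in T, j \in T & k \in T] by rewrite TE !inE !eqxx !orbT.
  have bE x y : x \in T -> y \in T -> x != y -> T = blk b x y by apply: blk_vertsE.
  have [t1|n1] := pselect (exists l, tri b i l k); last first.
    apply/imsetP; exists (i, k); rewrite /= -?bE ?(extremal_neq ikV) //.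
    rewrite !finset.in_setU !finset.in_setD ikV !andbT /top_tri; apply/orP; left; apply/orP; left.
    by apply/negP => /setIdP[_ /asboolP].
  have [t2|n2] := pselect (exists l, tri (opp b) i l k); last first.
    apply/imsetP; exists (i, k); rewrite /= -?bE ?(extremal_neq ikV) //.
    rewrite !finset.in_setU !finset.in_setD ikV !andbT /top_tri; apply/orP; left; apply/orP; right.
    by apply/negP => /setIdP[_ /asboolP].
  have nr x y c : (x, y) \in consec b -> x \in T -> y \in T ->
      c = b \/ c = opp b -> ~ right_tri c x y ->
      T \in [set blk b p.1 p.2 | p in N].
    move=> xyC xT yT hc n3.
    apply/imsetP; exists (x, y); rewrite /= -?bE ?(consec_neq xyC) //.
    rewrite finset.in_setU; apply/orP; right; rewrite finset.in_setU; apply/orP.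
    case: hc n3 => -> n3; [left|right]; apply/setIdP; split;
      rewrite ?consec_opp //; exact/asboolP.
  have [t3|/nr] := pselect (right_tri b i j); last by apply=> //; left.
  have [t4|/nr] := pselect (right_tri b j k); last by apply=> //; left.
  have [t5|/nr] := pselect (right_tri (opp b) i j); last by apply=> //; right.
  have [t6|/nr] := pselect (right_tri (opp b) j k); last by apply=> //; right.
  case: bad; apply/asboolP; exists i, j, k; split=> //.
  by case/consecP: ijC => ->; case/consecP: jkC => ->.
rewrite (bigID (fun T : {set I} => #|T| == 3%N)) /=.
have -> : (\sum_(T in bad_verts b | #|T| == 3%N) #|T| = #|B3| * 3)%N.
  rewrite -sum_nat_const; apply: eq_big => T; first by rewrite [in RHS]inE.
  by case/andP => _ /eqP.
have : (\sum_(T in bad_verts b | #|T| != 3%N) #|T| <=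
    \sum_(T in verts b | #|T| != 3%N) #|T|)%N.
  rewrite big_mkcond [leqRHS]big_mkcond; apply: leq_sum => T _.
  case: ifP => // /andP[/setIdP[-> _] ->] //.
move=> hs; apply: leq_trans (leq_add (leq_mul hB (leqnn 3)) hs) _.
apply: leq_trans (leq_add (leq_mul hN (leqnn 3)) h) _.
set v := #|double_verts b|; set n := #|I|; lia.
Qed.

End Arrangement.

(** * Locally triangular arrangements *)

Section Wheels.
Variables (R : realFieldType) (I : finType) (a b : I -> R).
Hypothesis a_inj : injective a.
Implicit Types (l : I) (u v w : R * R).
Local Notation side := (side a b).
Local Notation nosep := (nosep a b).
Local Notation vpt := (vpt a b).
Local Notation tri := (tri a).
Local Notation ht := (ht a b).
Local Notation cross := (cross a b).

(** Twice the signed area, positive for a counterclockwise triangle. *)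
Definition orient u v w : R :=
  (v.1 - u.1) * (w.2 - u.2) - (v.2 - u.2) * (w.1 - u.1).

Definition joined u v : Prop := exists2 l, side l u = 0 & side l v = 0.

Definition triangle u v w : Prop :=
  [/\ 0 < orient u v w, [/\ joined u v, joined v w & joined u w],
      nosep u v, nosep v w & nosep u w].

Lemma triangle_rot u v w : triangle u v w -> triangle v w u.
Proof.
case=> o [[l1 u1 v1] [l2 v2 w2] [l3 u3 w3]] n1 n2 n3.
split; [|split|exact: n2|exact: nosepC|exact: nosepC].
- by move: o; rewrite /orient; nra.
- by exists l2.
- by exists l3.
- by exists l1.
Qed.

Lemma side_vpt_l i j : side i (vpt i j) = 0.
Proof. exact: subrr. Qed.

Lemma side_vpt_r i j : i != j -> side j (vpt i j) = 0.
Proof. by move=> ij; rewrite /side vpt_r //= subrr. Qed.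

Lemma on_line_r l u v : side l u = 0 -> side l v = 0 -> v.2 - u.2 = a l * (v.1 - u.1).
Proof. by rewrite /side /ht; lra. Qed.

Lemma on_line l u v w : side l u = 0 -> side l v = 0 -> side l w = 0 ->
  orient u v w = 0.
Proof.
move=> lu lv lw; rewrite /orient (on_line_r lu lv) (on_line_r lu lw); ring.
Qed.

Lemma line_uniq l l' u v : side l u = 0 -> side l v = 0 -> side l' u = 0 ->
  side l' v = 0 -> u != v -> l = l'.
Proof.
move=> lu lv l'u l'v; apply: contraNeq => ll'.
have e1 : u.1 = cross l l'.
  by apply: (cross_uniq a_inj ll'); move: lu l'u; rewrite /side; lra.
have e2 : v.1 = cross l l'.
  by apply: (cross_uniq a_inj ll'); move: lv l'v; rewrite /side; lra.
have h := on_line_r lu lv.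
by apply/eqP; move: u v e1 e2 h {lu lv l'u l'v} => [u1 u2] [v1 v2] /= -> -> h; congr pair; lra.
Qed.

Lemma orient_side l u v w : side l u = 0 -> side l v = 0 ->
  orient u v w = (v.1 - u.1) * side l w.
Proof.
move=> lu lv; rewrite /orient (on_line_r lu lv).
by move: lu; rewrite /side /ht => h; have -> : u.2 = a l * u.1 + b l; [lra|ring].
Qed.

Lemma orient_nosep u v w w' : joined u v -> nosep w w' ->
  0 <= orient u v w * orient u v w'.
Proof.
case=> l lu lv ns; rewrite !(orient_side _ lu lv) mulrACA.
by rewrite mulr_ge0 ?ns // -expr2 sqr_ge0.
Qed.

(** Both apexes are on the same side of [u v]. As [u w] does not separate [v] from [w'], nor [u w']
    separate [v] from [w], the points [u], [w], [w'] are collinear; likewise with [v] for [u], and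
    the two lines meet in one point. *)
Lemma triangle_uniq u v w w' : triangle u v w -> triangle u v w' -> w = w'.
Proof.
case=> o [_ j2 j3] _ n2 n3 [o' [_ j2' j3'] _ n2' n3'].
have h1 := orient_nosep j3 n2'.
have h2 := orient_nosep j3' n2.
have h3 := orient_nosep j2 n3'.
have h4 := orient_nosep j2' n3.
case: w o j2 j3 n2 n3 h1 h2 h3 h4 => w1 w2 o _ _ _ _.
case: w' o' {j2' j3' n2' n3'} => x1 x2 o'.
rewrite /orient /= in o o' *.
set u1 := u.1 in o o' *; set u2 := u.2 in o o' *.
set v1 := v.1 in o o' *; set v2 := v.2 in o o' *.
pose p := (w1 - u1) * (x2 - u2) - (w2 - u2) * (x1 - u1).
pose q := (w1 - v1) * (x2 - v2) - (w2 - v2) * (x1 - v1).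
set D := _ - _ in o; set D' := _ - _ in o'.
have -> : (w1 - u1) * (v2 - u2) - (w2 - u2) * (v1 - u1) = - D by rewrite /D; ring.
have -> : (x1 - u1) * (v2 - u2) - (x2 - u2) * (v1 - u1) = - D' by rewrite /D'; ring.
have -> : (x1 - u1) * (w2 - u2) - (x2 - u2) * (w1 - u1) = - p by rewrite /p; ring.
have -> : (w1 - v1) * (u2 - v2) - (w2 - v2) * (u1 - v1) = D by rewrite /D; ring.
have -> : (x1 - v1) * (u2 - v2) - (x2 - v2) * (u1 - v1) = D' by rewrite /D'; ring.
have -> : (x1 - v1) * (w2 - v2) - (x2 - v2) * (w1 - v1) = - q by rewrite /q; ring.
rewrite -/p -/q => h1 h2 h3 h4.
have p0 : p = 0 by nra.
have q0 : q = 0 by nra.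
have e1 : (x1 - w1) * D = 0.
  transitivity (p * (w1 - v1) - q * (w1 - u1)); last by rewrite p0 q0; ring.
  by rewrite /p /q /D; ring.
have e2 : (x2 - w2) * D = 0.
  transitivity (p * (w2 - v2) - q * (w2 - u2)); last by rewrite p0 q0; ring.
  by rewrite /p /q /D; ring.
by congr pair; nra.
Qed.

Lemma triangle_other u v w l : triangle u v w -> side l u = 0 -> side l v = 0 ->
  exists2 m, m != l & side m v = 0.
Proof.
case=> o [_ [m mv mw] _] _ _ _ lu lv; exists m => //.
by apply: contraTneq o => ml; rewrite (on_line lu lv) ?ltxx // -ml.
Qed.

Definition same_dir v u u' : Prop := 0 < (u.1 - v.1) * (u'.1 - v.1).

Lemma side0 l v : side l v = 0 -> v = (v.1, ht l v.1).
Proof. by case: v => v1 v2; rewrite /side /= => h; congr pair; lra. Qed.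

Lemma near_uniq l m m' v u u' : side l v = 0 -> side l u = 0 -> side l u' = 0 ->
  m != l -> side m u = 0 -> m' != l -> side m' u' = 0 ->
  nosep v u -> nosep v u' -> same_dir v u u' -> u = u'.
Proof.
move=> lv lu lu' ml mu ml' mu' n n' d.
have ev := side0 lv; have eu := side0 lu; have eu' := side0 lu'.
have novertP x y t : side l x = 0 -> side l y = 0 -> nosep x y -> x.1 < t < y.1 ->
    vert a b l t -> False.
  move=> /side0 ex /side0 ey ns; rewrite ex ey in ns.
  exact: (nosep_novert a_inj ns).
have vu : vert a b l u.1.
  by exists m => //; move: mu lu; rewrite /side; lra.
have vu' : vert a b l u'.1.
  by exists m' => //; move: mu' lu'; rewrite /side; lra.
have nuv := nosepC n; have nu'v := nosepC n'.
suff e : u.1 = u'.1 by rewrite eu eu' e.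
move: d; rewrite /same_dir => d.
have [vlt|vge] := ltP v.1 u.1.
  have vlt' : v.1 < u'.1 by nra.
  case: (ltgtP u.1 u'.1) => // lt; exfalso.
    by apply: (novertP _ _ u.1 lv lu') => //; rewrite vlt.
  by apply: (novertP _ _ u'.1 lv lu) => //; rewrite vlt'.
have vlt : u.1 < v.1.
  by rewrite lt_neqAle vge andbT; apply: contraTneq d => ->; rewrite subrr mul0r ltxx.
have vlt' : u'.1 < v.1 by nra.
case: (ltgtP u.1 u'.1) => // lt; exfalso.
  by apply: (novertP _ _ u'.1 lu lv) => //; rewrite lt.
by apply: (novertP _ _ u.1 lu' lv) => //; rewrite lt.
Qed.

Lemma triangle_near l v u w u' w' : side l v = 0 -> side l u = 0 ->
  side l u' = 0 -> triangle v u w \/ triangle v w u ->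
  triangle v u' w' \/ triangle v w' u' -> same_dir v u u' -> u = u'.
Proof.
move=> lv lu lu' t t' d.
have ex x y : side l x = 0 -> triangle v x y \/ triangle v y x ->
    (exists2 m, m != l & side m x = 0) /\ nosep v x.
  move=> lx [] h; first by split; [exact: triangle_other h lv lx|case: h].
  split; last by case: h.
  case: h => o [_ [m my mx] _] _ _ _; exists m => //.
  apply: contraTneq o => ml; rewrite ml in my.
  by rewrite (on_line lv my) ?ltxx.
have [[m ml mu] n] := ex _ _ lu t; have [[m' ml' mu'] n'] := ex _ _ lu' t'.
exact: (near_uniq lv lu lu' ml mu ml' mu').
Qed.

Definition star v : {set I} := [set l | side l v == 0].

Lemma starP l v : reflect (side l v = 0) (l \in star v).
Proof. by rewrite inE; apply: eqP. Qed.

(* The neighbours [n 0], ..., [n 5] of [v] in counterclockwise order, indexed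
   modulo 6; [L k] is the line of the opposite rays towards [n k] and [n (k+3)]. *)
Definition wheel v (n : nat -> R * R) (L : nat -> I) : Prop :=
  [/\ forall k, n (k + 6)%N = n k /\ L (k + 3)%N = L k,
      forall k, triangle v (n k) (n k.+1),
      forall k, side (L k) v = 0 /\ side (L k) (n k) = 0,
      forall k, ((n k).1 - v.1) * ((n (k + 3)%N).1 - v.1) < 0 &
      star v = [set L 0%N; L 1%N; L 2%N] /\ #|star v| = 3%N].

Lemma wheel_shift1 v n L : wheel v n L ->
  wheel v (fun k => n k.+1) (fun k => L k.+1).
Proof.
case=> p t s o [c c3]; split=> [k|k|k|k|].
- exact: (p k.+1).
- exact: (t k.+1).
- exact: (s k.+1).
- exact: (o k.+1).
split=> //; rewrite c; have [_ e] := p 0%N; rewrite -e.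
by apply/setP => x; rewrite !inE; do 3!case: (x == _).
Qed.

Lemma wheel_shift m v n L : wheel v n L ->
  wheel v (fun k => n (k + m)%N) (fun k => L (k + m)%N).
Proof.
move=> w; elim: m => [|m /wheel_shift1 IH].
  by move: w; congr wheel; apply/funext => k; rewrite addn0.
by move: IH; congr wheel; apply/funext => k; rewrite addnS.
Qed.

Lemma mk_wheel v i j k (u : 6.-tuple (R * R)) :
    (forall m, (m < 6)%N -> triangle v (nth v u m) (nth v u (m.+1 %% 6))) ->
    (forall m, (m < 6)%N -> side (nth i [:: i; j; k] (m %% 3)) (nth v u m) = 0) ->
    [/\ side i v = 0, side j v = 0 & side k v = 0] ->
    (forall m, (m < 3)%N -> ((nth v u m).1 - v.1) * ((nth v u (m + 3)).1 - v.1) < 0) ->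
    star v = [set i; j; k] -> #|star v| = 3%N ->
  wheel v (fun m => nth v u (m %% 6)) (fun m => nth i [:: i; j; k] (m %% 3)).
Proof.
move=> t s [si sj sk] o c c3; split=> [m|m|m|m|].
- by rewrite !modnDr.
- have h := t (m %% 6)%N (@ltn_pmod m 6 isT).
  by have -> : (m.+1 %% 6 = (m %% 6).+1 %% 6)%N by lia; apply: h.
- have h := s (m %% 6)%N (@ltn_pmod m 6 isT).
  have e : ((m %% 6) %% 3 = m %% 3)%N by lia.
  rewrite e in h; split; last exact: h.
  by have := ltn_mod m 3; move: (m %% 3)%N => [|[|[|]]].
- have [lt|ge] := ltnP (m %% 6) 3.
    have -> : ((m + 3) %% 6 = m %% 6 + 3)%N by lia.
    exact: (o _ lt).
  have e : (m %% 6 = (m + 3) %% 6 + 3)%N by lia.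
  by rewrite e mulrC; apply: o; lia.
- by [].
Qed.

Lemma tri_triangle i j k : tri b i j k -> triangle (vpt i k) (vpt j k) (vpt i j).
Proof.
move=> h; have [ij jk ik] := tri_neq h.
case: h => /andP[aij ajk] /andP[c1 c2] n1 n2 n3.
have [s1 s2 s3] : [/\ side i (vpt i k) = 0, side k (vpt i k) = 0 & side i (vpt i j) = 0].
  by rewrite !side_vpt_l side_vpt_r.
have [s4 s5 s6] : [/\ side j (vpt i j) = 0, side j (vpt j k) = 0 & side k (vpt j k) = 0].
  by rewrite !side_vpt_l !side_vpt_r.
split; [|split|exact: n2|exact: nosepC|exact: nosepC].
- rewrite /orient (on_line_r s1 s3) (on_line_r s2 s6) /=.
  have -> : forall x y p q : R, x * (p * y) - q * x * y = (p - q) * (x * y) by move=> *; ring.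
  by rewrite nmulr_rgt0 ?subr_lt0 ?(lt_trans aij) // pmulr_rlt0 ?subr_gt0 // subr_lt0.
- by exists k.
- by exists j.
- by exists i.
Qed.

Lemma tri_opp_triangle i j k :
  tri (opp b) i j k -> triangle (vpt i k) (vpt j k) (vpt i j).
Proof.
move=> h; have [ij jk ik] := tri_neq h.
case: h => /andP[aij ajk]; rewrite !cross_opp !ltrN2 => /andP[c1 c2].
move=> /nosep_vpt_opp n1 /nosep_vpt_opp n2 /nosep_vpt_opp n3.
have [s1 s2 s3] : [/\ side i (vpt i k) = 0, side k (vpt i k) = 0 & side i (vpt i j) = 0].
  by rewrite !side_vpt_l side_vpt_r.
have [s4 s5 s6] : [/\ side j (vpt i j) = 0, side j (vpt j k) = 0 & side k (vpt j k) = 0].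
  by rewrite !side_vpt_l !side_vpt_r.
split; [|split|exact: n2|exact: nosepC|exact: nosepC].
- rewrite /orient (on_line_r s1 s3) (on_line_r s2 s6) /=.
  have -> : forall x y p q : R, x * (p * y) - q * x * y = (p - q) * (x * y) by move=> *; ring.
  by rewrite nmulr_rgt0 ?subr_lt0 ?(lt_trans aij) // nmulr_rlt0 ?subr_gt0 // subr_lt0.
- by exists k.
- by exists j.
- by exists i.
Qed.

Lemma right_corner_triangle i j : right_tri a b i j -> exists u w,
  [/\ triangle (vpt i j) u w, side i u = 0, side j w = 0,
      (vpt i j).1 < u.1 & (vpt i j).1 < w.1].
Proof.
case=> -[k h]; have [n1 n2 n3] := tri_neq h.
  exists (vpt i k), (vpt j k); have [_ /andP[c1 c2] _ _ _] := h.
  rewrite !side_vpt_l; split=> //; last exact: lt_trans c2.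
  exact/triangle_rot/triangle_rot/tri_triangle.
exists (vpt k i), (vpt k j); have [_ + _ _ _] := h.
rewrite !cross_opp !ltrN2 => /andP[c1 c2]; rewrite !side_vpt_r //.
by split=> //; [apply/triangle_rot/tri_opp_triangle|exact: lt_trans c1].
Qed.

Lemma left_corner_triangle i j : right_tri a (opp b) i j -> exists u w,
  [/\ triangle (vpt i j) u w, side i u = 0, side j w = 0,
      u.1 < (vpt i j).1 & w.1 < (vpt i j).1].
Proof.
case=> -[k h]; rewrite ?oppK in h; have [n1 n2 n3] := tri_neq h.
  exists (vpt i k), (vpt j k); have [_ + _ _ _] := h.
  rewrite !cross_opp !ltrN2 => /andP[c1 c2].
  rewrite !side_vpt_l; split=> //; last exact: lt_trans c1.
  exact/triangle_rot/triangle_rot/tri_opp_triangle.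
exists (vpt k i), (vpt k j); have [_ /andP[c1 c2] _ _ _] := h.
rewrite !side_vpt_r //.
by split=> //; [apply/triangle_rot/tri_triangle|exact: lt_trans c2].
Qed.

Lemma top_corner_triangle i k : (exists l, tri b i l k) -> exists u w,
  [/\ triangle (vpt i k) u w, side k u = 0, side i w = 0,
      (vpt i k).1 < u.1 & w.1 < (vpt i k).1].
Proof.
case=> l h; have [n1 n2 n3] := tri_neq h; have [_ /andP[c1 c2] _ _ _] := h.
exists (vpt l k), (vpt i l); rewrite side_vpt_l side_vpt_r //; split=> //.
exact: tri_triangle.
Qed.

Lemma bottom_corner_triangle i k : (exists l, tri (opp b) i l k) -> exists u w,
  [/\ triangle (vpt i k) u w, side k u = 0, side i w = 0,
      u.1 < (vpt i k).1 & (vpt i k).1 < w.1].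
Proof.
case=> l h; have [n1 n2 n3] := tri_neq h; have [_ + _ _ _] := h.
rewrite !cross_opp !ltrN2 => /andP[c1 c2].
exists (vpt l k), (vpt i l); rewrite side_vpt_l side_vpt_r //; split=> //.
exact: tri_opp_triangle.
Qed.

Lemma star_vpt i j : star (vpt i j) = blk a b i j.
Proof. by apply/setP => l; rewrite !inE /side /= subr_eq0 eq_sym. Qed.

Lemma vpt_blk i j i' j' : i' \in blk a b i j -> j' \in blk a b i j ->
  i' != j' -> vpt i' j' = vpt i j.
Proof.
move=> hi hj ne; rewrite /vpt (cross_blk a_inj hi hj ne).
by move: hi; rewrite inE => /eqP ->.
Qed.

Lemma same_dir_r v u w : v.1 < u.1 -> v.1 < w.1 -> same_dir v u w.
Proof. by rewrite /same_dir => *; rewrite mulr_gt0 ?subr_gt0. Qed.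

Lemma same_dir_l v u w : u.1 < v.1 -> w.1 < v.1 -> same_dir v u w.
Proof. by rewrite /same_dir => *; rewrite nmulr_rgt0 ?subr_lt0. Qed.

(** Cyclically consecutive triangles have an edge on the same ray from the vertex, and the next
    vertex along a ray is unique, so the six triangles close up. *)
Lemma good_vert_wheel i j : i != j -> good_vert a b (blk a b i j) ->
  exists n L, wheel (vpt i j) n L.
Proof.
move=> ij [i0 [j0 [k0 [/andP[aij ajk] [TE _] [top bot] [r1 r2] [l1 l2]]]]].
have iT : i0 \in blk a b i j by rewrite TE !inE eqxx.
have jT : j0 \in blk a b i j by rewrite TE !inE eqxx !orbT.
have kT : k0 \in blk a b i j by rewrite TE !inE eqxx !orbT.
have nij := lt_slope_neq aij; have njk := lt_slope_neq ajk.
have nik := lt_slope_neq (lt_trans aij ajk).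
have [u0 [w0 [t0 s0 s0' c0 c0']]] := right_corner_triangle r1.
have [u1 [w1 [t1 s1 s1' c1 c1']]] := right_corner_triangle r2.
have [u2 [w2 [t2 s2 s2' c2 c2']]] := top_corner_triangle top.
have [u3 [w3 [t3 s3 s3' c3 c3']]] := left_corner_triangle l1.
have [u4 [w4 [t4 s4 s4' c4 c4']]] := left_corner_triangle l2.
have [u5 [w5 [t5 s5 s5' c5 c5']]] := bottom_corner_triangle bot.
have hi : side i0 (vpt i j) = 0 by rewrite -(vpt_blk iT jT nij) side_vpt_l.
have hj : side j0 (vpt i j) = 0 by rewrite -(vpt_blk iT jT nij) side_vpt_r.
have hk : side k0 (vpt i j) = 0 by rewrite -(vpt_blk iT kT nik) side_vpt_r.
move: t0 t1 t2 t3 t4 t5 c0 c0' c1 c1' c2 c2' c3 c3' c4 c4' c5 c5'.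
rewrite !(vpt_blk iT jT nij) !(vpt_blk jT kT njk) !(vpt_blk iT kT nik).
have TE' := star_vpt i j; rewrite TE in TE'.
move: (vpt i j) hi hj hk TE' => v hi hj hk TE'.
move=> t0 t1 t2 t3 t4 t5 c0 c0' c1 c1' c2 c2' c3 c3' c4 c4' c5 c5'.
have e0 : w0 = u1 := triangle_near hj s0' s1 (or_intror t0) (or_introl t1) (same_dir_r c0' c1).
have e1 : w1 = u2 := triangle_near hk s1' s2 (or_intror t1) (or_introl t2) (same_dir_r c1' c2).
have e2 : w2 = u3 := triangle_near hi s2' s3 (or_intror t2) (or_introl t3) (same_dir_l c2' c3).
have e3 : w3 = u4 := triangle_near hj s3' s4 (or_intror t3) (or_introl t4) (same_dir_l c3' c4).
have e4 : w4 = u5 := triangle_near hk s4' s5 (or_intror t4) (or_introl t5) (same_dir_l c4' c5).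
have e5 : w5 = u0 := triangle_near hi s5' s0 (or_intror t5) (or_introl t0) (same_dir_r c5' c0).
subst w0 w1 w2 w3 w4 w5.
eexists; eexists; apply: (@mk_wheel v i0 j0 k0 [tuple u0; u1; u2; u3; u4; u5]).
- by case=> [|[|[|[|[|[|]]]]]].
- by case=> [|[|[|[|[|[|]]]]]].
- by [].
- by case=> [|[|[|]]] //= _; rewrite pmulr_rlt0 ?subr_lt0 ?subr_gt0.
- exact: TE'.
- by rewrite TE' -finset.setUA cardsU1 cards2 !inE njk (negbTE nij) (negbTE nik).
Qed.

Lemma triangle_neq u v w : triangle u v w -> [/\ u != v, v != w & u != w].
Proof.
case=> o _ _ _ _; split; apply: contraTneq o => ->; rewrite -leNgt /orient;
  lra.
Qed.

Lemma line_dir l u v : side l u = 0 -> side l v = 0 -> u != v -> u.1 != v.1.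
Proof.
move=> /side0 eu /side0 ev; apply: contra => /eqP e.
by rewrite eu ev e.
Qed.

(** Lattice structure out to distance [K - 1] from [v]. The wheels at different vertices are not
    assumed to be aligned; [wheel_turn] does that. *)
Fixpoint goodn K v : Prop :=
  if K is K'.+1 then exists n L, wheel v n L /\ forall m, goodn K' (n m) else True.

(* Consecutive vertices [v 0], ..., [v N] of the line [l], each on exactly two
   other lines [A i] and [B i], in counterclockwise order after [l]. *)
Definition layer N l (v : nat -> R * R) (n : nat -> nat -> R * R)
    (A B : nat -> I) : Prop :=
  (forall i, (i <= N)%N -> exists L,
    [/\ wheel (v i) (n i) L, L 0%N = l, L 1%N = A i & L 2%N = B i]) /\
  (forall i, (i < N)%N -> n i 0%N = v i.+1 /\ n i.+1 3%N = v i).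

(** One line of the wheel at [w] passes through [v]; of its two opposite indices one has the
    direction of [v], and the triangle fixes the neighbour after it. Indices 4 and 5 are those under
    which an apex sees the edge it belongs to. *)
Lemma wheel_turn K v v' w : triangle w v v' -> goodn K.+1 w ->
  exists n L, [/\ wheel w n L, n 4%N = v, n 5%N = v' & forall m, goodn K (n m)].
Proof.
move=> t [m [M [W Gm]]]; have [p tm sm om [cm c3]] := W.
have [l lw lv] : joined w v by case: t => _ [].
have [c Mc] : exists c, M c = l.
  have : l \in star w by apply/starP.
  by rewrite cm !inE => /orP[/orP[]|] /eqP ->; eexists.
have [wv _ _] := triangle_neq t.
have [c' [Mc' dc']] : exists c', M c' = l /\ same_dir w v (m c').
  have := om c; have := line_dir lw lv wv; rewrite /same_dir => ne h.
  have [pos|npos] := ltP 0 ((v.1 - w.1) * ((m c).1 - w.1)); first by exists c.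
  exists (c + 3)%N; split; first by rewrite (p c).2.
  have : v.1 - w.1 != 0 by rewrite subr_eq0 eq_sym.
  move: npos h; set x := v.1 - w.1; set y := (m c).1 - w.1; set z := _ - w.1.
  move=> h1 h2 x0; have x2 : 0 < x ^+ 2 by rewrite exprn_even_gt0.
  have y0 : y != 0 by apply: contraTneq h2 => ->; rewrite mul0r ltxx.
  have y2 : 0 < y ^+ 2 by rewrite exprn_even_gt0.
  have xy : x * y < 0 by rewrite lt_neqAle h1 mulf_neq0.
  rewrite -(pmulr_lgt0 _ y2).
  have -> : x * z * y ^+ 2 = (x * y) * (y * z) by ring.
  by rewrite nmulr_rgt0.
have e1 : v = m c'.
  apply: (@triangle_near l w v v' (m c') (m c'.+1)) => //; try by left.
  by rewrite -Mc'; case: (sm c').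
have e2 : v' = m c'.+1.
  by apply: (triangle_uniq t); rewrite e1; apply: tm.
(* Modulo 6 this shift renumbers the old index [c'] as 4. *)
exists (fun k => m (k + (c' + 2))%N), (fun k => M (k + (c' + 2))%N).
split=> [|||k]; [exact: wheel_shift| | |exact: Gm].
  by rewrite e1 -(p c').1; congr m; lia.
by rewrite e2 -(p c'.+1).1; congr m; lia.
Qed.

Lemma layer_apex N l (v : nat -> R * R) n A B i : layer N l v n A B -> (i < N)%N ->
  n i.+1 2%N = n i 1%N /\ triangle (v i) (v i.+1) (n i 1%N).
Proof.
move=> [hw hn] iN; have [e0 e3] := hn i iN.
have [L [[_ t _ _ _] _ _ _]] := hw i (ltnW iN).
have [L' [[_ t' _ _ _] _ _ _]] := hw i.+1 iN.
have t1 := t 0%N; have t2 := t' 2%N; rewrite e0 in t1; rewrite e3 in t2.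
split=> //; apply: (triangle_uniq (u := v i) (v := v i.+1)) => //.
exact/triangle_rot/triangle_rot.
Qed.

(** The apexes over the edges of one row form the next row, shorter by one. The line [A i] runs from
    vertex [i] to apex [i], and [B i.+1] from vertex [i.+1] to the same apex, whence the shift. One
    ring of goodness is spent. *)
Lemma layer_step K N l (v : nat -> R * R) n A B : layer N.+1 l v n A B ->
    (forall i m, (i <= N.+1)%N -> goodn K.+1 (n i m)) ->
  exists l' n', layer N l' (fun i => n i 1%N) n' A (fun i => B i.+1) /\
    forall i m, (i <= N)%N -> goodn K (n' i m).
Proof.
move=> hl hG; have [hw hn] := hl.
have /choice[f fP] : forall i, exists p : (nat -> R * R) * (nat -> I), (i <= N)%N ->
    [/\ wheel (n i 1%N) p.1 p.2, p.1 4%N = v i, p.1 5%N = v i.+1 &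
        forall m, goodn K (p.1 m)].
  move=> i; have [iN|Ni] := leqP i N; last by exists (n i, fun=> l).
  have [_ t] := layer_apex hl (i := i) iN.
  have [n' [L' h]] := wheel_turn (triangle_rot (triangle_rot t)) (hG i 1%N (leqW iN)).
  by exists (n', L').
pose n' i := (f i).1; pose L' i := (f i).2.
have next i : (i < N)%N -> n' i 0%N = n i.+1 1%N.
  move=> iN; have [[p t _ _ _] _ e5 _] := fP i (ltnW iN).
  have [L [W _ _ _]] := hw i.+1 (leqW iN).
  have [a2 _] := layer_apex hl (i := i) (leqW iN).
  have t5 := t 5; rewrite e5 -[6%N]/(0 + 6)%N (p 0%N).1 in t5.
  apply: (triangle_uniq t5); apply/triangle_rot/triangle_rot; rewrite -a2.
  by case: W => _ /(_ 1%N).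
have prev i : (i < N)%N -> n' i.+1 3%N = n i 1%N.
  move=> iN; have [[p t _ _ _] e4 _ _] := fP i.+1 iN.
  have [L [[_ tv _ _ _] _ _ _]] := hw i.+1 (leqW iN).
  have [a2 _] := layer_apex hl (i := i) (leqW iN).
  have t3 := t 3; rewrite e4 in t3.
  have t1 := tv 1%N; rewrite a2 in t1.
  apply: (triangle_uniq (u := v i.+1) (v := n i.+1 1%N)) => //.
  exact/triangle_rot/triangle_rot.
have line0 i : (i <= N)%N -> L' i 0%N = L' 0%N 0%N.
  elim: i => // i IH iN; rewrite -IH 1?ltnW //.
  have [[p t s _ _] e4 _ _] := fP i.+1 iN.
  have [[p' t' s' _ _] e4' _ _] := fP i (ltnW iN).
  have e0 := next i iN; have e3 := prev i iN.
  have l03 : L' i.+1 3%N = L' i.+1 0%N := (p 0%N).2.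
  have [s1 s2] : side (L' i.+1 0%N) (n i.+1 1%N) = 0 /\ side (L' i.+1 0%N) (n i 1%N) = 0.
    by rewrite -l03 -e3; apply: s.
  have [s3 s4] : side (L' i 0%N) (n i 1%N) = 0 /\ side (L' i 0%N) (n i.+1 1%N) = 0.
    by rewrite -e0; apply: s'.
  have [ne _ _] : [/\ n i 1%N != n i.+1 1%N, n i.+1 1%N != n' i 1%N & n i 1%N != n' i 1%N].
    by rewrite -e0; apply: (triangle_neq (t' 0%N)).
  exact: (line_uniq s2 s1 s3 s4 ne).
exists (L' 0%N 0%N), n'; split; last by move=> i m iN; have [_ _ _] := fP i iN; apply.
split; last by move=> i iN; split; [apply: next|apply: prev].
move=> i iN; exists (L' i); have [W e4 e5 _] := fP i iN.
have [p t s _ _] := W.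
have [L [[_ tv sv _ _] _ LA _]] := hw i (leqW iN).
have [M [[_ _ sw _ _] _ _ MB]] := hw i.+1 iN.
have [a2 ta] := layer_apex hl (i := i) iN; have [_ ne1 ne2] := triangle_neq ta.
split=> //; first exact: line0.
  have e14 : L' i 4%N = L' i 1%N := (p 1%N).2.
  have [s1 s2] := s 4; have [s3 s4] := sv 1%N; rewrite e4 in s2.
  by rewrite -LA -e14; apply: (line_uniq s2 s1 s3 s4).
have e25 : L' i 5%N = L' i 2%N := (p 2%N).2.
have [s1 s2] := s 5; have [s3 s4] := sw 2%N; rewrite e5 in s2; rewrite a2 in s4.
by rewrite -MB -e25; apply: (line_uniq s2 s1 s3 s4).
Qed.

(** A half turn: [layer_step] applied to the result finds the row on the other side of [l]. *)
Lemma layer_rev N l (v : nat -> R * R) n A B : layer N l v n A B ->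
  layer N l (fun i => v (N - i)%N) (fun i k => n (N - i)%N (k + 3)%N)
    (fun i => A (N - i)%N) (fun i => B (N - i)%N).
Proof.
move=> [hw hn]; split=> i iN.
  have [L [W L0 L1 L2]] := hw (N - i)%N (leq_subr _ _).
  exists (fun k => L (k + 3)%N); have [p _ _ _ _] := W.
  by rewrite !(p _).2; split=> //; apply: wheel_shift.
have e : (N - i = (N - i.+1).+1)%N by lia.
have [e0 e3] : n (N - i.+1)%N 0%N = v (N - i.+1).+1 /\
  n (N - i.+1).+1 3%N = v (N - i.+1)%N by apply: hn; lia.
have [L [[p _ _ _ _] _ _ _]] := hw (N - i.+1)%N (leq_subr _ _).
by rewrite e; split; [rewrite add0n|rewrite -[(3 + 3)%N]/(0 + 6)%N (p 0%N).1].
Qed.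

(** For the dual of a point set: three distinct points that are all the points of the set on some
    line. *)
Definition rich3 (x y z : I) : Prop :=
  [set x; y; z] \in verts a b /\ #|[set x; y; z]| = 3%N.

Lemma star_verts v : (1 < #|star v|)%N -> star v \in verts a b.
Proof.
case/card_gt1P => i [j [iS jS ij]].
have /side0 e1 := starP _ _ iS; have /side0 e2 := starP _ _ jS.
have -> : v = vpt i j.
  have e3 : v.1 = cross i j by apply: cross_uniq => //; move: e1; rewrite e2 => -[].
  by rewrite e1 /vpt -e3.
by rewrite star_vpt; apply: blk_verts.
Qed.

Lemma layer_rich3 N l (v : nat -> R * R) n A B i : layer N l v n A B -> (i <= N)%N ->
  rich3 l (A i) (B i).
Proof.
move=> [hw _] /hw[L [[_ _ _ _ [c c3]] <- <- <-]]; rewrite /rich3 -c c3.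
by split=> //; apply: star_verts; rewrite c3.
Qed.

(** [p1] and [p2] carry the first and second rows on one side of [l], and [q] carries the first row
    on the other side. *)
Lemma layer_strip N l (v : nat -> R * R) n A B : layer N l v n A B -> (1 < N)%N ->
    (forall i m, (i <= N)%N -> goodn 2 (n i m)) ->
  exists p1 p2 q, [/\ forall i, (i <= N)%N -> rich3 l (A i) (B i),
    forall i, (i + 1 <= N)%N -> rich3 p1 (A i) (B (i + 1)%N),
    forall i, (i + 2 <= N)%N -> rich3 p2 (A i) (B (i + 2)%N) &
    forall i, (i + 1 <= N)%N -> rich3 q (A (i + 1)%N) (B i)].
Proof.
case: N => [//|[//|N]] hl _ hG.
have [p1 [n1 [hl1 hG1]]] := layer_step hl hG.
have [p2 [n2 [hl2 _]]] := layer_step hl1 hG1.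
have [|q [n3 [hl3 _]]] := layer_step (K := 1) (layer_rev hl).
  by move=> i m iN; apply: hG; lia.
exists p1, p2, q; split=> i iN.
- exact: layer_rich3 hl iN.
- by rewrite addn1; apply: (layer_rich3 hl1); lia.
- by rewrite addn2; apply: (layer_rich3 hl2); lia.
have h : (N.+1 - i <= N.+1)%N by lia.
have := layer_rich3 hl3 h; cbv beta.
have -> : (N.+2 - (N.+1 - i) = i + 1)%N by lia.
by have -> : (N.+2 - (N.+1 - i).+1 = i)%N by lia.
Qed.

Lemma wheel_right K p v : goodn K.+1 v -> side p v = 0 -> exists n L,
  [/\ wheel v n L, L 0%N = p, v.1 < (n 0%N).1 & forall m, goodn K (n m)].
Proof.
move=> [n [L [W G]]] pv; have [pe _ _ o [c _]] := W.
have [m Lm] : exists m, L m = p.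
  have : p \in star v by apply/starP.
  by rewrite c !inE => /orP[/orP[]|] /eqP ->; eexists.
have om := o m.
have [lt|ge] := ltP v.1 (n m).1.
  exists (fun k => n (k + m)%N), (fun k => L (k + m)%N).
  by split=> [|||k]; [exact: wheel_shift| | |exact: G].
exists (fun k => n (k + (m + 3))%N), (fun k => L (k + (m + 3))%N).
split=> [|||k]; [exact: wheel_shift|by rewrite add0n (pe m).2| |exact: G].
rewrite add0n ltNge; apply/negP => ge'.
move: om; apply/negP; rewrite -leNgt mulr_le0 // subr_le0 //.
Qed.

(** Each wheel is numbered so that index 0 points to the right along [p]; as no vertex lies between,
    that neighbour is the next vertex of the run. *)
Lemma run_layer N p (s : nat -> R) :
    (forall i, (i <= N)%N -> goodn 3 (s i, ht p (s i))) ->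
    (forall i, (i < N)%N -> s i < s i.+1 /\ novert a b p (s i) (s i.+1)) ->
  exists n A B, layer N p (fun i => (s i, ht p (s i))) n A B /\
    forall i m, (i <= N)%N -> goodn 2 (n i m).
Proof.
move=> hG hs; pose v i := (s i, ht p (s i)).
have pv i : side p (v i) = 0 by rewrite /side /v /= subrr.
have /choice[f fP] : forall i, exists q : (nat -> R * R) * (nat -> I), (i <= N)%N ->
    [/\ wheel (v i) q.1 q.2, q.2 0%N = p, (v i).1 < (q.1 0%N).1 &
        forall m, goodn 2 (q.1 m)].
  move=> i; have [iN|Ni] := leqP i N; last by exists (fun=> v 0%N, fun=> p).
  by have [n [L h]] := wheel_right (hG i iN) (pv i); exists (n, L).
have nb i m : (i <= N)%N -> side p ((f i).1 m) = 0 ->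
    vert a b p ((f i).1 m).1 /\ nosep (v i) ((f i).1 m).
  move=> iN pm; have [[_ t _ _ _] _ _ _] := fP i iN.
  have [o [_ [k kx ky] _] n1 _ _] := t m; split=> //; exists k.
    by apply: contraTneq o => kp; rewrite (on_line (pv i) pm) ?ltxx // -kp.
  by move: kx pm; rewrite /side; lra.
have vs i : (i <= N)%N -> vert a b p (s i).
  move=> iN; have [[_ t sl _ _] f0 _ _] := fP i iN.
  have [o [[k kv kx] _ _] _ _ _] := t 1%N.
  have [_ s0] := sl 0%N; rewrite f0 in s0.
  have [o' _ _ _ _] := t 0%N.
  exists k; last by move: kv (pv i); rewrite /side /=; lra.
  by apply: contraTneq o' => kp; rewrite (on_line (pv i) s0) ?ltxx // -kp.
exists (fun i => (f i).1), (fun i => (f i).2 1%N), (fun i => (f i).2 2%N).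
split; last by move=> i m iN; case: (fP i iN).
split=> i iN; first by exists (f i).2; case: (fP i iN).
have [lts nv] := hs i iN.
have [[pe t sl o _] f0 lt0 _] := fP i (ltnW iN).
have [[pe' t' sl' o' _] f0' lt0' _] := fP i.+1 iN.
split.
  have [_ s0] := sl 0%N; rewrite f0 in s0.
  have [v0 ns0] := nb i 0%N (ltnW iN) s0.
  rewrite (side0 s0) in ns0 *.
  suff -> : ((f i).1 0%N).1 = s i.+1 by [].
  apply: (first_vert_uniq (i := p) (c := s i) lt0 lts v0 (vs _ iN) _ nv).
  exact: (nosep_novert a_inj ns0).
have [_ s3] := sl' 3; have := (pe' 0%N).2; rewrite add0n f0' => f3.
rewrite f3 in s3; have [v3 ns3] := nb i.+1 3 iN s3.
have lt3 : ((f i.+1).1 3%N).1 < s i.+1.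
  have := o' 0%N; rewrite add0n pmulr_rlt0 ?subr_gt0 // subr_lt0 //.
rewrite (side0 s3) in ns3 *.
suff -> : ((f i.+1).1 3%N).1 = s i by [].
apply: (novert_eq lt3 lts v3 (vs _ (ltnW iN)) _ nv).
exact: (nosep_novert a_inj (nosepC ns3)).
Qed.

Lemma run_strip N p (s : nat -> R) : (1 < N)%N ->
    (forall i, (i <= N)%N -> goodn 3 (s i, ht p (s i))) ->
    (forall i, (i < N)%N -> s i < s i.+1 /\ novert a b p (s i) (s i.+1)) ->
  exists A B p1 p2 q, [/\
    forall i, (i <= N)%N -> rich3 p (A i) (B i) /\
      thru a b p (s i) = [set p; A i; B i],
    forall i, (i + 1 <= N)%N -> rich3 p1 (A i) (B (i + 1)%N),
    forall i, (i + 2 <= N)%N -> rich3 p2 (A i) (B (i + 2)%N) &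
    forall i, (i + 1 <= N)%N -> rich3 q (A (i + 1)%N) (B i)].
Proof.
move=> N1 hG hs; have [n [A [B [hl hn]]]] := run_layer hG hs.
have [p1 [p2 [q [h0 h1 h2 h3]]]] := layer_strip hl N1 hn.
exists A, B, p1, p2, q; split=> // i iN; split; first exact: h0.
have [L [[_ _ _ _ [c _]] L0 L1 L2]] := hl.1 i iN.
rewrite -L0 -L1 -L2 -c L0; apply/setP => l.
by rewrite !inE /side /= subr_eq0 eq_sym.
Qed.

End Wheels.

Lemma card_bigcup_le (T J : finType) (P : {set J}) (A : J -> {set T}) :
  (#|\bigcup_(j in P) A j| <= \sum_(j in P) #|A j|)%N.
Proof.
elim/big_ind2: _ => [|x m y n hx hy|//]; first by rewrite cards0.
by apply: leq_trans (leq_card_setU _ _) (leq_add hx hy).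
Qed.

(** * Vertices at some distance from all bad vertices *)

Section Spoil.
Variables (R : realFieldType) (I : finType) (a b : I -> R).
Hypothesis a_inj : injective a.
Implicit Types (l : I) (u v w : R * R) (S : {set {set I}}).
Local Notation side := (side a b).
Local Notation nosep := (nosep a b).
Local Notation star := (star a b).
Local Notation verts := (verts a b).
Local Notation goodn := (goodn a b).

Definition adjacent v v' : Prop :=
  [/\ nosep v v', v != v' & exists2 l, side l v = 0 & side l v' = 0].

Definition spoil S : {set {set I}} := S :|:
  [set T in verts | `[< exists v v', [/\ star v = T, star v' \in S & adjacent v v'] >]].

Lemma star_inj v v' : (1 < #|star v|)%N -> star v = star v' -> v = v'.
Proof.
case/card_gt1P => i [j [iS jS ij]] e; apply/eqP; move: ij; apply: contraNT => vv'.
apply/eqP; move: (iS) (jS); rewrite e => iS' jS'.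
by apply: (line_uniq a_inj (starP _ _ _ _ iS) (starP _ _ _ _ iS') (starP _ _ _ _ jS)
  (starP _ _ _ _ jS')).
Qed.

Lemma other_line v l : (1 < #|star v|)%N -> exists2 m, m != l & side m v = 0.
Proof.
case/card_gt1P => i [j [/starP iS /starP jS ij]].
have [il|] := eqVneq i l; last by exists i.
by exists j; rewrite // -il eq_sym.
Qed.

Lemma star_vert_ge2 v : star v \in verts -> (1 < #|star v|)%N.
Proof. exact: card_vert_ge2. Qed.

(** A vertex on m lines has at most 2 m neighbours, and each one outside [S] is on three lines; so
    the weight m becomes at most [m + 6 m]. *)
Lemma card_spoil S : S \subset verts ->
    (forall T, T \in verts -> T \notin S -> #|T| = 3%N) ->
  (\sum_(T in spoil S) #|T| <= 7 * \sum_(T in S) #|T|)%N.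
Proof.
move=> SV S3; pose N := spoil S :\: S.
pose NT T' := [set T in N | `[< exists v v', [/\ star v = T, star v' = T' & adjacent v v'] >]].
have N3 T : T \in N -> T \in verts /\ #|T| = 3%N.
  rewrite !inE => /andP[TS /orP[TS'|/andP[TV _]]]; first by rewrite TS' in TS.
  by split=> //; apply: S3.
have sub : N \subset \bigcup_(T' in S) NT T'.
  apply/fintype.subsetP => T TN; have := TN; rewrite !inE => /andP[TS].
  rewrite (negbTE TS) /= => /andP[TV /asboolP[v [v' [vT vS ad]]]].
  apply/bigcupP; exists (star v') => //; rewrite inE TN /=.
  by apply/asboolP; exists v, v'.
have hNT T' : T' \in S -> (#|NT T'| <= 2 * #|T'|)%N.
  move=> TS'; rewrite mulnC -[2%N]card_bool -(cardsT bool) -cardsX.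
  (* A neighbour of a given vertex is identified by a common line and the side on which it lies. *)
  apply: (@card_le_rel _ _ _ _ (fun T q => exists v v', [/\ star v = T, star v' = T',
    adjacent v v' & side q.1 v = 0 /\ side q.1 v' = 0 /\ q.2 = (v.1 < v'.1)])).
    move=> T /setIdP[TN /asboolP[v [v' [vT vT' ad]]]].
    have [_ _ [l lv lv']] := ad; exists (l, v.1 < v'.1); last by exists v, v'.
    by rewrite !inE andbT -vT'; apply/starP.
  move=> T1 T2 [l d] /setIdP[T1N _] /setIdP[T2N _] /=.
  move=> [v1 [v1' [E1 e1 [n1 ne1 _] [s1 [s1' ->]]]]].
  move=> [v2 [v2' [E2 e2 [n2 ne2 _] [s2 [s2' d12]]]]].
  have e : v1' = v2'.
    by apply: star_inj; rewrite e1 ?e2 //; apply: (@card_vert_ge2 _ _ a a_inj b);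
      apply: (fintype.subsetP SV).
  subst v2'; rewrite -E1 -E2 in T1N T2N *; suff -> : v1 = v2 by [].
  have g T : T \in N -> (1 < #|T|)%N by move=> /N3[_ ->].
  have [m1 ml1 mv1] := other_line l (g _ T1N).
  have [m2 ml2 mv2] := other_line l (g _ T2N).
  apply: (near_uniq a_inj s1' s1 s2 ml1 mv1 ml2 mv2 (nosepC n1) (nosepC n2)).
  have := line_dir s1 s1' ne1; have := line_dir s2 s2' .
  move=> /(_ ne2); rewrite /same_dir; move: d12.
  by case: (ltgtP v1.1 v1'.1) => // c1; case: (ltgtP v2.1 v1'.1) => // c2 _ _ _;
    [rewrite nmulr_rgt0 ?subr_lt0|rewrite pmulr_rgt0 ?subr_gt0].
have hN : (#|N| <= 2 * \sum_(T in S) #|T|)%N.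
  apply: leq_trans (subset_leq_card sub) _; apply: leq_trans (card_bigcup_le _ _) _.
  by rewrite big_distrr; apply: leq_sum.
rewrite (bigID (mem S)) /= addnC.
have -> : (\sum_(T in spoil S | T \notin S) #|T| = #|N| * 3)%N.
  rewrite -sum_nat_const; apply: eq_big => T; first by rewrite [in RHS]inE andbC.
  move=> /andP[T1 T2]; apply: (N3 T _).2; rewrite inE T2; exact: T1.
have -> : (\sum_(T in spoil S | T \in S) #|T| = \sum_(T in S) #|T|)%N.
  by apply: eq_bigl => T; rewrite andb_idl // => TS; rewrite finset.in_setU TS.
move: hN; set s := (\sum_(T in S) _)%N; set c := #|_|; lia.
Qed.

Fixpoint bad_level K : {set {set I}} :=
  if K is K'.+1 then spoil (bad_level K') else bad_verts a b.

Lemma bad_level0 K : bad_verts a b \subset bad_level K.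
Proof.
elim: K => //= K IH; apply: fintype.subset_trans IH _; exact: finset.subsetUl.
Qed.

Lemma bad_level_verts K : bad_level K \subset verts.
Proof.
elim: K => /= [|K IH]; first by apply/fintype.subsetP => T /setIdP[].
by rewrite finset.subUset IH /=; apply/fintype.subsetP => T /setIdP[].
Qed.

Lemma not_bad_good K T : T \in verts -> T \notin bad_level K -> good_vert a b T.
Proof.
move=> TV nb; apply: contrapT => ng; case/negP: nb.
by apply: (fintype.subsetP (bad_level0 K)); apply/setIdP; split=> //; apply/asboolP.
Qed.

Lemma good_vert_card3 T : good_vert a b T -> #|T| = 3%N.
Proof.
move=> [i [j [k [/andP[ij jk] [-> _] _ _ _]]]].
rewrite -finset.setUA cardsU1 cards2 !inE (lt_slope_neq jk) (negbTE (lt_slope_neq ij)).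
by rewrite (negbTE (lt_slope_neq (lt_trans ij jk))).
Qed.

Lemma sum_bad_level K : (\sum_(T in bad_level K) #|T| <=
  7 ^ K * (22 * #|I| + 18 * #|double_verts a b|))%N.
Proof.
elim: K => [|K IH]; first by rewrite expn0 mul1n; apply: sum_bad_verts.
rewrite expnS -mulnA; apply: leq_trans (card_spoil (bad_level_verts K) _) _.
  by move=> T TV /(not_bad_good TV)/good_vert_card3.
by rewrite leq_mul2l IH.
Qed.

Lemma vpt_of_star v : (1 < #|star v|)%N -> exists i j, i != j /\ v = vpt a b i j.
Proof.
case/card_gt1P => i [j [iS jS ij]]; exists i, j; split=> //.
apply: star_inj; first by apply/card_gt1P; exists i, j.
rewrite star_vpt; apply: (blk_vertsE a_inj _ iS jS ij).
by apply: star_verts => //; apply/card_gt1P; exists i, j.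
Qed.

(** The neighbours of a vertex outside one level lie outside the preceding level, so the wheels
    extend ring by ring. *)
Lemma goodn_level K v : star v \in verts -> star v \notin bad_level K -> goodn K.+1 v.
Proof.
elim: K v => [|K IH] v vV nb.
  have [i [j [ij e]]] := vpt_of_star (star_vert_ge2 vV).
  have := not_bad_good vV nb; rewrite e star_vpt => g.
  by have [n [L W]] := good_vert_wheel a_inj ij g; exists n, L.
have [i [j [ij e]]] := vpt_of_star (star_vert_ge2 vV).
have := not_bad_good vV nb; rewrite e star_vpt => g.
have [n [L W]] := good_vert_wheel a_inj ij g; rewrite -e in W *.
exists n, L; split=> // m.
have [_ t s _ _] := W; have [s1 s2] := s m.
have [o [_ [k kx ky] _] ns _ _] := t m.
have nV : star (n m) \in verts.
  apply: star_verts => //; apply/card_gt1P; exists k, (L m); split; try exact/starP.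
  by apply: contraTneq o => kp; rewrite (on_line s1 s2) ?ltxx // -kp.
apply: IH => //; move: nb => /=; rewrite finset.in_setU negb_or => /andP[_].
apply: contra => nS; apply/setIdP; split=> //; apply/asboolP.
exists v, (n m); split=> //; split=> //; last by exists (L m).
by have [] := triangle_neq (t m).
Qed.

End Spoil.

(** * Polynomial functions on the plane *)

Section Poly2.
Variable R : realFieldType.
Implicit Types (f g h l : R * R -> R) (z w : R * R).

(** Polynomial functions of degree at most [d], with one variable peeled off at a time. The field
    being infinite, functions can stand for polynomials, and a nonzero polynomial is one that
    satisfies [nz]. *)
Fixpoint Pol (d : nat) f : Prop :=
  if d is d'.+1 then exists c g h,
    [/\ Pol d' g, Pol d' h & forall z, f z = c + z.1 * g z + z.2 * h z]
  else exists c, forall z, f z = c.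

Definition nz f : Prop := exists z, f z != 0.

Lemma Pol_ext d f g : (forall z, f z = g z) -> Pol d f -> Pol d g.
Proof. by move=> e; have -> : f = g by apply/funext. Qed.

Lemma Pol_cst d c : Pol d (fun=> c).
Proof.
elim: d c => [|d IH] c; first by exists c.
by exists c, (fun=> 0), (fun=> 0); split=> // z; ring.
Qed.

Lemma PolS d f : Pol d f -> Pol d.+1 f.
Proof.
elim: d f => [|d IH] f.
  move=> [c e]; apply: (@Pol_ext _ (fun=> c)); first by move=> z; rewrite e.
  exact: Pol_cst.
by move=> [c [g [h [Pg Ph e]]]]; exists c, g, h; split=> //; apply: IH.
Qed.

Lemma Pol_le d e f : (d <= e)%N -> Pol d f -> Pol e f.
Proof.
by move=> /subnK <-; elim: (e - d)%N => // k IH /IH; rewrite addSn; apply: PolS.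
Qed.

Lemma PolD d f g : Pol d f -> Pol d g -> Pol d (fun z => f z + g z).
Proof.
elim: d f g => [|d IH] f g.
  by move=> [c e] [c' e']; exists (c + c') => z; rewrite e e'.
move=> [c [f1 [f2 [P1 P2 e]]]] [c' [g1 [g2 [Q1 Q2 e']]]].
exists (c + c'), (fun z => f1 z + g1 z), (fun z => f2 z + g2 z).
by split=> [||z]; [exact: IH|exact: IH|rewrite e e'; ring].
Qed.

Lemma PolZ d c f : Pol d f -> Pol d (fun z => c * f z).
Proof.
elim: d f => [|d IH] f.
  by move=> [c' e]; exists (c * c') => z; rewrite e.
move=> [c' [f1 [f2 [P1 P2 e]]]].
exists (c * c'), (fun z => c * f1 z), (fun z => c * f2 z).
by split=> [||z]; [exact: IH|exact: IH|rewrite e; ring].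
Qed.

Lemma Pol_mulx d f : Pol d f -> Pol d.+1 (fun z => z.1 * f z).
Proof.
move=> Pf; exists 0, f, (fun=> 0); split=> // [|z]; [exact: Pol_cst|ring].
Qed.

Lemma Pol_muly d f : Pol d f -> Pol d.+1 (fun z => z.2 * f z).
Proof.
move=> Pf; exists 0, (fun=> 0), f; split=> // [|z]; [exact: Pol_cst|ring].
Qed.

Lemma PolM d e f g : Pol d f -> Pol e g -> Pol (d + e) (fun z => f z * g z).
Proof.
move=> + Pg; elim: d f => [|d IH] f.
  by move=> [c e1]; apply: Pol_ext (PolZ c Pg) => z; rewrite e1.
move=> [c [f1 [f2 [P1 P2 e1]]]].
have h0 : Pol (d + e).+1 (fun z => c * g z) by apply: (Pol_le _ (PolZ c Pg)); lia.
have h := PolD (PolD h0 (Pol_mulx (IH _ P1))) (Pol_muly (IH _ P2)).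
by apply: Pol_ext h => z /=; rewrite e1; ring.
Qed.

Definition affine (al be ga : R) z := al * z.1 + be * z.2 + ga.

Lemma Pol_affine al be ga : Pol 1 (affine al be ga).
Proof.
exists ga, (fun=> al), (fun=> be); split; [by exists al|by exists be|].
by move=> z; rewrite /affine; ring.
Qed.

Lemma Pol1P l : Pol 1 l -> exists al be ga, l = affine al be ga.
Proof.
move=> [c [g [h [[al eg] [be eh] e]]]]; exists al, be, c; apply/funext => z.
by rewrite e eg eh /affine; ring.
Qed.

Lemma Pol_line d f z w : Pol d f -> exists u : {poly R}, (size u <= d.+1)%N /\
  forall t, f (z.1 + t * w.1, z.2 + t * w.2) = u.[t].
Proof.
elim: d f => [|d IH] f.
  by move=> [c e]; exists c%:P; rewrite size_polyC; split=> [|t];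
    [case: eqP|rewrite e hornerC].
move=> [c [g [h [/IH[p [sp ep]] /IH[q [sq eq]] e]]]].
exists (c%:P + (z.1%:P + w.1%:P * 'X) * p + (z.2%:P + w.2%:P * 'X) * q).
have s1 (x y : R) : (size (x%:P + y%:P * 'X)%R <= 2)%N.
  apply: leq_trans (size_polyD _ _) _; rewrite geq_max.
  rewrite (leq_trans (size_polyC_leq1 _)) //.
  by apply: leq_trans (size_polyMleq _ _) _; rewrite size_polyX; have := size_polyC_leq1 y; lia.
split=> [|t]; last by rewrite e !hornerE /= ep eq; ring.
apply: leq_trans (size_polyD _ _) _; rewrite geq_max; apply/andP; split.
  apply: leq_trans (size_polyD _ _) _; rewrite geq_max; apply/andP; split.
    by rewrite (leq_trans (size_polyC_leq1 _)).
  by apply: leq_trans (size_polyMleq _ _) _; have := s1 z.1 w.1; lia.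
by apply: leq_trans (size_polyMleq _ _) _; have := s1 z.2 w.2; lia.
Qed.

Lemma poly_roots_eq0 (u : {poly R}) (s : seq R) : (size u <= size s)%N ->
  uniq s -> all (root u) s -> u = 0.
Proof.
move=> su us rs; apply/eqP/negPn/negP => u0.
by have := max_poly_roots u0 rs us; rewrite ltnNge su.
Qed.

Lemma Pol_eq0_ray d f z w : Pol d f ->
  (forall t, t != 0 -> f (z.1 + t * w.1, z.2 + t * w.2) = 0) -> f z = 0.
Proof.
move=> /(Pol_line z w)[u [su eu]] h.
suff u0 : u = 0 by have := eu 0; rewrite !mul0r !addr0 u0 horner0; case: z {eu h}.
apply: (@poly_roots_eq0 u [seq i.+1%:R | i <- iota 0 d.+1]).
- by rewrite size_map size_iota.
- rewrite map_inj_uniq ?iota_uniq // => i j /eqP; rewrite eqr_nat => /eqP[].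
  by [].
apply/allP => _ /mapP[i _ ->]; rewrite rootE -eu h ?pnatr_eq0 //.
Qed.

(** At a zero of [l], draw the line to a point where [l] is not zero: [f] vanishes on it except
    perhaps at the starting point, hence there too. *)
Lemma affine_mul_eq0 d l f : Pol 1 l -> nz l -> Pol d f ->
  (forall z, l z * f z = 0) -> forall z, f z = 0.
Proof.
move=> Pl [w lw] Pf h z; pose v := (w.1 - z.1, w.2 - z.2).
have [lz|lz] := eqVneq (l z) 0; last first.
  by apply/eqP; have /eqP := h z; rewrite mulf_eq0 (negbTE lz).
apply: (@Pol_eq0_ray d f z v Pf) => t t0; set x := (_, _).
have := h x; suff : l x != 0 by move=> lx /eqP; rewrite mulf_eq0 (negbTE lx) => /eqP.
have [al [be [ga e]]] := Pol1P Pl; rewrite e /affine /= in lz lw *.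
suff -> : al * (z.1 + t * (w.1 - z.1)) + be * (z.2 + t * (w.2 - z.2)) + ga =
  t * (al * w.1 + be * w.2 + ga) by rewrite mulf_neq0.
transitivity (t * (al * w.1 + be * w.2 + ga) + (1 - t) * (al * z.1 + be * z.2 + ga)).
  by ring.
by rewrite lz; ring.
Qed.

Lemma sqr_sum_eq0 (x y : R) : x ^+ 2 + y ^+ 2 = 0 -> x = 0 /\ y = 0.
Proof.
by move/eqP; rewrite paddr_eq0 ?sqr_ge0 // !sqrf_eq0 => /andP[/eqP -> /eqP ->].
Qed.

Definition line_fun z w : R * R -> R :=
  fun x => (w.1 - z.1) * (x.2 - z.2) - (w.2 - z.2) * (x.1 - z.1).

Lemma Pol_line_fun z w : Pol 1 (line_fun z w).
Proof.
apply: Pol_ext (Pol_affine (- (w.2 - z.2)) (w.1 - z.1)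
  ((w.2 - z.2) * z.1 - (w.1 - z.1) * z.2)) => x.
by rewrite /line_fun /affine; ring.
Qed.

Lemma line_fun_l z w : line_fun z w z = 0.
Proof. by rewrite /line_fun; ring. Qed.

Lemma line_fun_r z w : line_fun z w w = 0.
Proof. by rewrite /line_fun; ring. Qed.

Definition on_param z w t : R * R := (z.1 + t * (w.1 - z.1), z.2 + t * (w.2 - z.2)).

Lemma line_fun_param z w t : line_fun z w (on_param z w t) = 0.
Proof. by rewrite /line_fun /on_param /=; ring. Qed.

Lemma affine_param l z w t : Pol 1 l -> l (on_param z w t) = (1 - t) * l z + t * l w.
Proof. by move=> /Pol1P[al [be [ga ->]]]; rewrite /affine /on_param /=; ring. Qed.

Lemma on_param_inj z w : z != w -> injective (on_param z w).
Proof.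
move=> zw t t' [e1 e2]; apply/eqP; move: zw; apply: contraNT => tt'.
have {}tt' : t - t' != 0 by rewrite subr_eq0.
apply/eqP; case: z w e1 e2 => [z1 z2] [w1 w2] /= e1 e2.
have h1 : (t - t') * (w1 - z1) = 0 by lra.
have h2 : (t - t') * (w2 - z2) = 0 by lra.
move/eqP: h1; move/eqP: h2; rewrite !mulf_eq0 (negbTE tt') /= !subr_eq0.
by move=> /eqP -> /eqP ->.
Qed.

Lemma nz_line_fun z w : z != w -> nz (line_fun z w).
Proof.
case: z w => [z1 z2] [w1 w2] zw; exists (z1 - (w2 - z2), z2 + (w1 - z1)).
rewrite /line_fun /=.
have -> : (w1 - z1) * (z2 + (w1 - z1) - z2) - (w2 - z2) * (z1 - (w2 - z2) - z1) =
  (w1 - z1) ^+ 2 + (w2 - z2) ^+ 2 by ring.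
apply: contraNneq zw => h; rewrite xpair_eqE.
have [h1 h2] := sqr_sum_eq0 h.
by apply/andP; split; apply/eqP; lra.
Qed.

(* Euclidean division by the affine form [l], in the coordinates [(l, m)]. *)
Lemma Pol_split d f al be ga : al ^+ 2 + be ^+ 2 != 0 -> Pol d.+1 f ->
  exists (u : {poly R}) g, [/\ (size u <= d.+2)%N, Pol d g &
    forall z, f z = u.[affine (- be) al 0 z] + affine al be ga z * g z].
Proof.
set D := al ^+ 2 + be ^+ 2 => D0.
suff H e h : Pol e h -> exists (u : {poly R}) g, [/\ (size u <= e.+1)%N,
    Pol e.-1 g, e = 0%N -> g = (fun=> 0) &
    forall z, h z = u.[affine (- be) al 0 z] + affine al be ga z * g z].
  by move=> /H[u [g [su Pg _ e]]]; exists u, g.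
elim: e h => [|e IH] h.
  move=> [c eh]; exists c%:P, (fun=> 0); split=> //; first by rewrite size_polyC; case: eqP.
    exact: Pol_cst.
  by move=> z; rewrite eh hornerC; ring.
move=> [c [g1 [h1 [Pg Ph eh]]]].
have [u [G [su PG G0 eG]]] := IH _ (PolD (PolZ (- be / D) Pg) (PolZ (al / D) Ph)).
have [v [H [sv PH H0 eH]]] := IH _ (PolD (PolZ (- al * ga / D) Pg) (PolZ (- be * ga / D) Ph)).
exists (c%:P + 'X * u + v), (fun z => (al / D * g1 z + be / D * h1 z)
  + affine (- be) al 0 z * G z + H z); split=> //.
- apply: leq_trans (size_polyD _ _) _; rewrite geq_max (leq_trans sv) // andbT.
  apply: leq_trans (size_polyD _ _) _; rewrite geq_max.
  rewrite (leq_trans (size_polyC_leq1 _)) //=.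
  by apply: leq_trans (size_polyMleq _ _) _; rewrite size_polyX; lia.
- apply: PolD; last by apply: Pol_le PH; lia.
  apply: PolD; first by apply: PolD; apply: PolZ.
  case: e {IH u v su sv PH H0 eH eG} Pg Ph PG G0 => [|e] Pg Ph PG G0.
    by rewrite G0 //; apply: Pol_ext (Pol_cst 0 0) => z; ring.
  exact: (PolM (Pol_affine _ _ _) PG).
move=> z; rewrite eh !hornerE.
have -> : u.[affine (- be) al 0 z] = (- be / D * g1 z + al / D * h1 z) -
   affine al be ga z * G z by rewrite eG; ring.
have -> : v.[affine (- be) al 0 z] = (- al * ga / D * g1 z + - be * ga / D * h1 z) -
   affine al be ga z * H z by rewrite eH; ring.
by rewrite /affine /D; field.
Qed.

(** The remainder modulo [l] is a polynomial of degree at most [d + 1] in the coordinate along the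
    line, with [d + 2] roots. *)
Lemma line_factor d f l (s : seq (R * R)) : Pol 1 l -> nz l -> Pol d.+1 f -> uniq s ->
  (size s = d.+2)%N -> (forall z, z \in s -> l z = 0 /\ f z = 0) ->
  exists2 g, Pol d g & forall z, f z = l z * g z.
Proof.
move=> Pl [w lw] Pf us ss h.
have [al [be [ga e]]] := Pol1P Pl; subst l.
have D0 : al ^+ 2 + be ^+ 2 != 0.
  apply/negP => /eqP D0.
  have [a0 b0] := sqr_sum_eq0 D0.
  case: s us ss h => [//|x s] _ _ h; have [] := h x (mem_head _ _).
  by move: lw; rewrite /affine a0 b0 !mul0r => /eqP.
have [u [g [su Pg eg]]] := Pol_split ga D0 Pf.
exists g => // z; rewrite eg.
suff -> : u = 0 by rewrite horner0 add0r.
apply: (@poly_roots_eq0 u [seq affine (- be) al 0 x | x <- s]).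
- by rewrite size_map ss.
- rewrite map_inj_in_uniq // => x y xs ys.
  have [hx _] := h x xs; have [hy _] := h y ys.
  case: x y hx hy {xs ys} => [x1 x2] [y1 y2]; rewrite /affine /= => hx hy hxy.
  have e1 : (x1 - y1) * (al ^+ 2 + be ^+ 2) = 0.
    have -> : (x1 - y1) * (al ^+ 2 + be ^+ 2) = al * ((al * x1 + be * x2 + ga) - (al * y1 + be * y2 + ga))
      - be * ((- be * x1 + al * x2 + 0) - (- be * y1 + al * y2 + 0)) by ring.
    by rewrite hx hy hxy; ring.
  have e2 : (x2 - y2) * (al ^+ 2 + be ^+ 2) = 0.
    have -> : (x2 - y2) * (al ^+ 2 + be ^+ 2) = be * ((al * x1 + be * x2 + ga) - (al * y1 + be * y2 + ga))
      + al * ((- be * x1 + al * x2 + 0) - (- be * y1 + al * y2 + 0)) by ring.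
    by rewrite hx hy hxy; ring.
  move/eqP: e1; move/eqP: e2; rewrite !mulf_eq0 (negbTE D0) !orbF !subr_eq0.
  by move=> /eqP -> /eqP ->.
apply/allP => _ /mapP[x xs ->]; rewrite rootE; have [lx fx] := h x xs.
by have := eg x; rewrite fx lx mul0r addr0 => <-.
Qed.

End Poly2.

(** * Chasles' theorem and cubics through nine points *)

Section Curves.
Variable R : realFieldType.
Implicit Types (f g h l q : R * R -> R) (z w : R * R).

(* Subtracting a multiple of [c 0 * c 1 * c 2] makes [f] vanish at a fourth point
   of the row [r 0]; then the three rows split off one after the other. *)
Lemma chasles (x : nat -> nat -> R * R) (r c : nat -> R * R -> R) f :
    (forall i, (i < 3)%N -> Pol 1 (r i) /\ Pol 1 (c i)) ->
    (forall i j, (i < 3)%N -> (j < 3)%N -> r i (x i j) = 0 /\ c j (x i j) = 0) ->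
    (forall i k j, (i < 3)%N -> (k < 3)%N -> (j < 3)%N -> i != k ->
       r i (x k j) != 0 /\ c i (x j k) != 0) ->
    Pol 3 f ->
    (forall i j, (i < 3)%N -> (j < 3)%N -> (i, j) != (2%N, 2%N) -> f (x i j) = 0) ->
  f (x 2%N 2%N) = 0.
Proof.
move=> P inc off Pf fx.
(* The fourth point of the row must avoid the three columns. Parameters 0 and 1 are the first two
   columns, and the third column meets the row at most once, so 2 or 3 works. *)
have [t [t0 t1 t2]] : exists t : R, [/\ t != 0, 1 - t != 0 &
    (1 - t) * c 2%N (x 0%N 0%N) + t * c 2%N (x 0%N 1%N) != 0].
  have [_ c00] := off 2%N 0%N 0%N isT isT isT isT; have [_ c01] := off 2%N 1%N 0%N isT isT isT isT.
  have [h|h] := eqVneq ((1 - 2) * c 2%N (x 0%N 0%N) + 2 * c 2%N (x 0%N 1%N)) 0; last first.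
    by exists 2; split=> //; apply/eqP => h0; lra.
  exists 3; split; [by apply/eqP => h0; lra|by apply/eqP => h0; lra|].
  by apply: contraNneq c01 => h'; apply/eqP; lra.
pose w := on_param (x 0%N 0%N) (x 0%N 1%N) t.
have aw l : Pol 1 l -> l w = (1 - t) * l (x 0%N 0%N) + t * l (x 0%N 1%N) by apply: affine_param.
have r0w : r 0%N w = 0.
  by rewrite (aw _ (P 0%N isT).1) (inc 0%N 0%N isT isT).1 (inc 0%N 1%N isT isT).1; ring.
have c0w : c 0%N w != 0.
  rewrite (aw _ (P 0%N isT).2) (inc 0%N 0%N isT isT).2 mulr0 add0r mulf_neq0 //.
  by have [] := off 0%N 1%N 0%N isT isT isT isT.
have c1w : c 1%N w != 0.
  rewrite (aw _ (P 1%N isT).2) (inc 0%N 1%N isT isT).2 mulr0 addr0 mulf_neq0 //.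
  by have [] := off 1%N 0%N 0%N isT isT isT isT.
have c2w : c 2%N w != 0 by rewrite (aw _ (P 2%N isT).2).
pose ka z := c 0%N z * c 1%N z * c 2%N z.
have kaw : ka w != 0 by rewrite !mulf_neq0.
have Pka : Pol 3 ka := PolM (PolM (P 0%N isT).2 (P 1%N isT).2) (P 2%N isT).2.
have ka0 i j : (i < 3)%N -> (j < 3)%N -> ka (x i j) = 0.
  move=> i3 j3; have [_ cj] := inc i j i3 j3; rewrite /ka.
  by case: j j3 cj => [|[|[|]]] // _ ->; ring.
pose F z := f z + (- (f w / ka w)) * ka z.
have PF : Pol 3 F := PolD Pf (PolZ _ Pka).
have Fx i j : (i < 3)%N -> (j < 3)%N -> (i, j) != (2%N, 2%N) -> F (x i j) = 0.
  by move=> i3 j3 ij; rewrite /F fx // ka0 //; ring.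
have Fw : F w = 0 by rewrite /F; field.
have rx i j : (i < 3)%N -> (j < 3)%N -> r i (x i j) = 0.
  by move=> i3 j3; have [] := inc i j i3 j3.
have cx i j : (i < 3)%N -> (j < 3)%N -> c j (x i j) = 0.
  by move=> i3 j3; have [] := inc i j i3 j3.
have nzr i : (i < 3)%N -> nz (r i).
  move=> i3; case: i i3 => [|i] i3; first by exists (x 1%N 0%N); case: (off 0%N 1%N 0%N isT isT isT isT).
  by exists (x 0%N 0%N); case: (off i.+1 0%N 0%N i3 isT isT isT).
have ne i j j' : (i < 3)%N -> (j < 3)%N -> (j' < 3)%N -> j != j' -> x i j != x i j'.
  move=> i3 j3 j'3 jj'; have [_ h] := off j j' i j3 j'3 i3 jj'.
  by apply: contraNneq h => <-; rewrite (inc i j i3 j3).2.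
have [||g2 Pg2 e2] := @line_factor R 2 F (r 0%N) [:: x 0%N 0%N; x 0%N 1%N; x 0%N 2%N; w] (P 0%N isT).1 (nzr 0%N isT) PF _ erefl.
- rewrite /= !inE !negb_or !ne //=.
  by rewrite !andbT; apply/and3P; split; [apply: contraNneq c0w|apply: contraNneq c1w|
    apply: contraNneq c2w] => <-; rewrite cx.
- by move=> z; rewrite !inE => /or4P[] /eqP->; rewrite ?rx ?Fx ?r0w ?Fw.
have g2x i j : (0 < i < 3)%N -> (j < 3)%N -> (i, j) != (2%N, 2%N) -> g2 (x i j) = 0.
  move=> /andP[i0 i3] j3 ij; have := Fx i j i3 j3 ij; rewrite e2 => /eqP.
  have [] // := off 0%N i j isT i3 j3 _; first by rewrite eq_sym -lt0n.
  by rewrite mulf_eq0 => /negbTE -> _ /eqP.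
have [||g1 Pg1 e1] := @line_factor R 1 g2 (r 1%N) [:: x 1%N 0%N; x 1%N 1%N; x 1%N 2%N] (P 1%N isT).1 (nzr 1%N isT) Pg2 _ erefl.
- by rewrite /= !inE !negb_or !ne.
- by move=> z; rewrite !inE => /or3P[] /eqP->; rewrite rx ?g2x.
have g1x j : (j < 2)%N -> g1 (x 2%N j) = 0.
  move=> j2; have j3 : (j < 3)%N by lia.
  have := g2x 2%N j isT j3; rewrite xpair_eqE => /(_ _)/eqP.
  have [] // := off 1%N 2%N j isT isT j3 isT.
  by rewrite e1 mulf_eq0 => /negbTE -> _ h; apply/eqP/h; lia.
have [||g0 Pg0 e0] := @line_factor R 0 g1 (r 2%N) [:: x 2%N 0%N; x 2%N 1%N] (P 2%N isT).1 (nzr 2%N isT) Pg1 _ erefl.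
- by rewrite /= !inE ne.
- by move=> z; rewrite !inE => /orP[] /eqP->; rewrite rx ?g1x.
have : F (x 2%N 2%N) = 0 by rewrite e2 e1 e0 (inc 2%N 2%N isT isT).1; ring.
by rewrite /F ka0 // mulr0 addr0.
Qed.

(** A matrix with more rows than columns has a nonzero left kernel. *)
Lemma lin_dep m (e : nat -> R * R -> R) (s : seq (R * R)) : (size s < m)%N ->
  exists c : nat -> R, (exists2 k, (k < m)%N & c k != 0) /\
    forall z, z \in s -> \sum_(k < m) c k * e k z = 0.
Proof.
case: m => // m sm; pose M := \matrix_(k < m.+1, j < size s) e k (nth (0, 0) s j).
have rk : (0 < \rank (kermx M))%N.
  by rewrite mxrank_ker subn_gt0 (leq_ltn_trans (rank_leq_col M)).
have [v vM v0] : exists2 v : 'rV_m.+1, v *m M = 0 & v != 0.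
  have : kermx M != 0 by rewrite -mxrank_eq0 -lt0n.
  case/rowV0Pn => v vk v0; exists v => //; exact/sub_kermxP.
have [k vk] : exists k, v 0 k != 0.
  apply: contrapT => h; case/negP: v0; apply/eqP/rowP => k; rewrite mxE.
  by apply/eqP/negPn/negP => hk; apply: h; exists k.
exists (fun k => v 0 (inord k)); split; first by exists k; rewrite ?inord_val.
move=> z zs; have zi : (index z s < size s)%N by rewrite index_mem.
have := congr1 (fun A : 'rV_(size s) => A 0 (Ordinal zi)) vM; rewrite !mxE => h.
rewrite -[RHS]h; apply: eq_bigr => i _.
by rewrite mxE /= nth_index // inord_val.
Qed.

Definition mono10 (k : nat) z : R := nth 0 [:: 1; z.1; z.2; z.1 * z.1; z.1 * z.2; z.2 * z.2;
  z.1 * (z.1 * z.1); z.1 * (z.1 * z.2); z.1 * (z.2 * z.2); z.2 * (z.2 * z.2)] k.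

Lemma Pol_mono10 k : Pol 3 (mono10 k).
Proof.
have P1 := Pol_cst 0 1 : Pol 0 (fun _ : R * R => 1).
have P0 : Pol 3 (fun _ : R * R => 0) := Pol_cst 3 0.
have X := @Pol_mulx R.
have Y := @Pol_muly R.
have Px : Pol 1 (fun z : R * R => z.1) by apply: Pol_ext (X _ _ P1) => z; rewrite mulr1.
have Py : Pol 1 (fun z : R * R => z.2) by apply: Pol_ext (Y _ _ P1) => z; rewrite mulr1.
case: k => [|[|[|[|[|[|[|[|[|[|k]]]]]]]]]].
- exact: Pol_cst.
- exact: (Pol_le (d := 1)).
- exact: (Pol_le (d := 1)).
- exact: (Pol_le (isT : (2 <= 3)%N) (X _ _ Px)).
- exact: (Pol_le (isT : (2 <= 3)%N) (X _ _ Py)).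
- exact: (Pol_le (isT : (2 <= 3)%N) (Y _ _ Py)).
- exact: (X _ _ (X _ _ Px)).
- exact: (X _ _ (X _ _ Py)).
- exact: (X _ _ (Y _ _ Py)).
- exact: (Y _ _ (Y _ _ Py)).
- by apply: Pol_ext P0 => z; rewrite /mono10 /= nth_nil.
Qed.

Lemma Pol_sum d m (e : nat -> R * R -> R) (c : nat -> R) : (forall k, Pol d (e k)) ->
  Pol d (fun z => \sum_(k < m) c k * e k z).
Proof.
move=> Pe; elim: m => [|m IH].
  by apply: Pol_ext (Pol_cst d 0) => z; rewrite big_ord0.
by apply: Pol_ext (PolD IH (PolZ (c m) (Pe m))) => z; rewrite big_ord_recr.
Qed.

Lemma cubic_through (s : seq (R * R)) : (size s < 10)%N -> exists f,
  [/\ Pol 3 f, nz f & forall z, z \in s -> f z = 0].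
Proof.
move=> /(lin_dep mono10)[c [[k k10 ck] h]].
exists (fun z => \sum_(k < 10) c k * mono10 k z); split=> //.
  by apply: Pol_sum => i; apply: Pol_mono10.
apply: contrapT => nnz; case/negP: ck; apply/eqP.
have {}h x y : \sum_(k < 10) c k * mono10 k (x, y) = 0.
  by apply/eqP/negPn/negP => hxy; apply: nnz; exists (x, y).
have := h 0 0; have := h 1 0; have := h 0 1; have := h 2 0; have := h 0 2.
have := h 1 1; have := h 3 0; have := h 0 3; have := h 1 2; have := h 2 1.
rewrite !big_ord_recl !big_ord0 /mono10 /= /bump /= => *.
by move: k k10; do 10 (case => [_|]; first by lra).
Qed.

End Curves.

(** * Common zeros of curves of degree at most three *)

Section Intersections.
Variable R : realFieldType.
Implicit Types (f g h l q : R * R -> R) (z w : R * R).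

Definition form d f : Prop := Pol d f /\ nz f.

Lemma form_line a b : a != b -> form 1 (@line_fun R a b).
Proof. by move=> ab; split; [apply: Pol_line_fun|apply: nz_line_fun]. Qed.

Lemma nzMr f g h : nz f -> (forall z, f z = g z * h z) -> nz h.
Proof. by move=> [z fz] e; exists z; apply: contraNneq fz => h0; rewrite e h0 mulr0. Qed.

Lemma nzMl f g h : nz f -> (forall z, f z = g z * h z) -> nz g.
Proof. by move=> [z fz] e; exists z; apply: contraNneq fz => h0; rewrite e h0 mul0r. Qed.

Lemma two_or_line (S : R * R -> Prop) : (exists a b, [/\ a != b, S a & S b]) \/
  exists2 l, form 1 l & forall z, S z -> l z = 0.
Proof.
have [h|h] := pselect (exists a b, [/\ a != b, S a & S b]); first by left.
right; have [[a Sa]|n] := pselect (exists a, S a); last first.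
  exists (line_fun (0, 0) (1, 0)); last by move=> z Sz; case: n; exists z.
  by apply: form_line; rewrite xpair_eqE negb_and eq_sym oner_eq0.
exists (line_fun a (a.1 + 1, a.2)).
  by apply: form_line; case: a {Sa} => x y; rewrite xpair_eqE negb_and /= -subr_eq0 opprD addNKr oppr_eq0 oner_eq0.
move=> z Sz; suff -> : z = a by apply: line_fun_l.
by apply/eqP/negPn/negP => za; apply: h; exists z, a.
Qed.

Lemma chord_factor d f a b (ts : seq R) : a != b -> Pol d.+1 f -> uniq ts ->
  size ts = d.+2 -> (forall t, t \in ts -> f (on_param a b t) = 0) ->
  exists2 g, Pol d g & forall z, f z = line_fun a b z * g z.
Proof.
move=> ab Pf us ss h; apply: (@line_factor R d f _ [seq on_param a b t | t <- ts]).
- exact: Pol_line_fun.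
- exact: nz_line_fun.
- exact: Pf.
- by rewrite map_inj_uniq //; apply: on_param_inj.
- by rewrite size_map.
by move=> _ /mapP[t tts ->]; rewrite line_fun_param h.
Qed.

Lemma on_param0 a b : on_param a b 0 = a :> R * R.
Proof. by case: a => x y; rewrite /on_param /= !mul0r !addr0. Qed.

Lemma on_param1 a b : on_param a b 1 = b :> R * R.
Proof. by case: a b => x y [x' y']; rewrite /on_param /= !mul1r; congr pair; ring. Qed.

Lemma affine_root_uniq l a b t t' : Pol 1 l -> l a != 0 -> t != t' ->
  l (on_param a b t) = 0 -> l (on_param a b t') != 0.
Proof.
move=> Pl la tt'; rewrite !affine_param // => h; apply: contra la => /eqP h'.
have e : (t - t') * l a = 0.
  transitivity (t * ((1 - t') * l a + t' * l b) - t' * ((1 - t) * l a + t * l b)); first by ring.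
  by rewrite h h'; ring.
by move/eqP: e; rewrite mulf_eq0 subr_eq0 (negbTE tt') orFb.
Qed.

(** [l] has at most one zero on the line, so two of the parameters 2, 3, 4 are free. *)
Lemma two_off l a b : Pol 1 l -> l a != 0 -> exists t t', [/\ uniq [:: 0; 1; t; t'],
  l (on_param a b t) != 0 & l (on_param a b t') != 0].
Proof.
move=> Pl la.
have u (i j : nat) : (1 < i)%N -> (i < j)%N -> uniq [:: 0; 1; i%:R; j%:R : R].
  move=> i1 ij; rewrite -[0]/(0%:R) -[1]/(1%:R) /= !inE !eqr_nat; lia.
have ne (i j : nat) : i != j -> i%:R != j%:R :> R by rewrite eqr_nat.
have [h2|h2] := eqVneq (l (on_param a b 2)) 0.
  exists 3, 4; split; first exact: (u 3 4).
    by apply: (affine_root_uniq Pl la _ h2); apply: (ne 2 3).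
  by apply: (affine_root_uniq Pl la _ h2); apply: (ne 2 4).
have [h3|h3] := eqVneq (l (on_param a b 3)) 0.
  exists 2, 4; split=> //; first exact: (u 2 4).
  by apply: (affine_root_uniq Pl la _ h3); apply: (ne 3 4).
by exists 2, 3; split=> //; apply: (u 2 3).
Qed.

Lemma affine_cases l : form 1 l -> (exists2 c, c != 0 & forall z, l z = c) \/
  exists a b, [/\ a != b, l a = 0 & l b = 0].
Proof.
move=> [/Pol1P[al [be [ga e]]] [w lw]].
have [a0|a0] := eqVneq al 0; last first.
  right; exists (- ga / al, 0), (- (ga + be) / al, 1); split.
  - by rewrite xpair_eqE negb_and (eq_sym 0) oner_eq0 orbT.
  - by rewrite e /affine /=; field.
  - by rewrite e /affine /=; field.
have [b0|b0] := eqVneq be 0; last first.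
  right; exists (0, - ga / be), (1, - ga / be); split.
  - by rewrite xpair_eqE negb_and (eq_sym 0) oner_eq0.
  - by rewrite e /affine /= a0; field.
  - by rewrite e /affine /= a0; field.
left; have e' z : l z = ga by rewrite e /affine a0 b0; ring.
by exists ga => //; rewrite -(e' w).
Qed.

Lemma nat_seq_uniq m : uniq [seq i%:R : R | i <- iota 0 m].
Proof.
by rewrite map_inj_uniq ?iota_uniq // => i j /eqP; rewrite eqr_nat => /eqP.
Qed.

(** On the line [l = 0] both factors become polynomials in one variable with product zero; the one
    that vanishes identically there is divisible by [l]. *)
Lemma affine_prime d l l' f a b : form 1 l -> a != b -> l a = 0 -> l b = 0 ->
  Pol 1 l' -> Pol d.+1 f -> (forall z, l z = 0 -> l' z * f z = 0) ->
  (exists c, forall z, l' z = c * l z) \/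
  exists2 g, Pol d g & forall z, f z = l z * g z.
Proof.
move=> [Pl nl] ab la lb Pl' Pf h.
have l0 t : l (on_param a b t) = 0 by rewrite affine_param // la lb; ring.
pose w := (b.1 - a.1, b.2 - a.2).
have [u [su eu]] := Pol_line a w Pf; have [v [sv ev]] := Pol_line a w Pl'.
have uv0 : v * u = 0.
  apply: (@poly_roots_eq0 _ _ [seq i%:R | i <- iota 0 (d + 4)]).
  - rewrite size_map size_iota (leq_trans (size_polyMleq _ _)) //; lia.
  - exact: nat_seq_uniq.
  by apply/allP => _ /mapP[i _ ->]; rewrite rootE hornerM -eu -ev;
    apply/eqP/h/(l0 i%:R).
have fac e k : Pol e.+1 k -> (forall t, k (on_param a b t) = 0) ->
    exists2 g, Pol e g & forall z, k z = l z * g z.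
  move=> Pk k0; apply: (@line_factor R e k l [seq on_param a b i%:R | i <- iota 0 e.+2]) => //.
  - rewrite (map_comp (on_param a b) (fun i => i%:R)) map_inj_uniq ?nat_seq_uniq //.
    exact: on_param_inj.
  - by rewrite size_map size_iota.
  by move=> _ /mapP[i _ ->].
move/eqP: uv0; rewrite mulf_eq0 => /orP[]/eqP v0; [left|right]; last first.
  by apply: fac => // t; rewrite /on_param eu v0 horner0.
have [|g [c ec] eg] := fac 0%N l' Pl'; first by move=> t; rewrite /on_param ev v0 horner0.
by exists c => z; rewrite eg ec mulrC.
Qed.

Lemma syzygy f g l l' : form 3 f -> form 3 g -> Pol 1 l -> Pol 1 l' ->
  nz l \/ nz l' -> (forall z, l z * f z + l' z * g z = 0) ->
  (exists2 c, c != 0 & forall z, f z = c * g z) \/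
  exists l1 q, [/\ form 1 l1, form 2 q &
    forall z, f z = 0 -> g z = 0 -> l1 z = 0 \/ q z = 0].
Proof.
move=> [Pf nf] [Pg ng] Pl Pl' nll h.
have dec k : nz k \/ forall z, k z = 0.
  have [|n] := pselect (nz k); [by left|right=> z].
  by apply/eqP/negPn/negP => kz; apply: n; exists z.
have [nl|l0] := dec l; last first.
  case: nll => [[z]|nl']; first by rewrite l0 eqxx.
  case: ng => z /negP[]; apply/eqP; apply: (affine_mul_eq0 Pl' nl' Pg) => w.
  by rewrite -[RHS](h w) l0; ring.
have [nl'|l0] := dec l'; last first.
  case: nf => z /negP[]; apply/eqP; apply: (affine_mul_eq0 Pl nl Pf) => w.
  by rewrite -[RHS](h w) l0; ring.
have [[c' c'0 ec']|[a [b [ab la lb]]]] := affine_cases (conj Pl' nl').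
  have [[c c0 ec]|[a [b [ab la lb]]]] := affine_cases (conj Pl nl).
    left; exists (- c' / c); first by rewrite mulf_neq0 ?oppr_eq0 ?invr_eq0.
    move=> z; have := h z; rewrite ec ec' => e.
    apply: (mulfI c0); have -> : c * f z = - (c' * g z) by lra.
    by field.
  right; case: (@affine_prime 2 l l' g a b) => //.
  - by move=> z lz; have := h z; rewrite lz mul0r add0r.
  - by move=> [c e]; have := e a; rewrite ec' la mulr0 => c'e; rewrite c'e eqxx in c'0.
  move=> [q Pq eq]; exists l, q; split=> //; first by split=> //; apply: nzMr eq.
  by move=> z _ /eqP; rewrite eq mulf_eq0 => /orP[]/eqP; [left|right].
case: (@affine_prime 2 l' l f a b) => //.
- by move=> z lz; have := h z; rewrite lz mul0r addr0.
- move=> [c e]; left.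
  have eg z : c * f z + g z = 0.
    apply: (@affine_mul_eq0 R 3 l' (fun z => c * f z + g z)) => //.
      by apply: PolD => //; apply: PolZ.
    by move=> w; rewrite -[RHS](h w) e; ring.
  have c0 : c != 0.
    by case: ng => z; apply: contraNneq => c0; have := eg z; rewrite c0 mul0r add0r => ->.
  exists (- c^-1); first by rewrite oppr_eq0 invr_eq0.
  move=> z; have -> : g z = - (c * f z) by have := eg z; lra.
  by field.
move=> [q Pq eq]; right; exists l', q; split=> //; first by split=> //; apply: nzMr eq.
by move=> z /eqP; rewrite eq mulf_eq0 => /orP[]/eqP; [left|right].
Qed.

Lemma nz_affine (al be ga : R) : [|| al != 0, be != 0 | ga != 0] -> nz (affine al be ga).
Proof.
move=> h; apply: contrapT => n; move: h.
have z x y : affine al be ga (x, y) = 0.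
  by apply/eqP/negPn/negP => hz; apply: n; exists (x, y).
have := z 0 0; have := z 1 0; have := z 0 1; rewrite /affine /= => h1 h2 h3.
have -> : ga = 0 by lra. have -> : al = 0 by lra. have -> : be = 0 by lra.
by rewrite eqxx.
Qed.

Lemma dec_nz f : nz f \/ forall z, f z = 0.
Proof.
have [|n] := pselect (nz f); [by left|right=> z].
by apply/eqP/negPn/negP => kz; apply: n; exists z.
Qed.

(* A combination [l f + l' g] with affine [l], [l'] has six coefficients; five
   conditions force it to split off two chords of the common zero set. *)
Lemma cubic_cubic f g : form 3 f -> form 3 g ->
  (exists2 c, c != 0 & forall z, f z = c * g z) \/
  exists l1 l2 q, [/\ form 1 l1, form 1 l2, form 2 q &
    forall z, f z = 0 -> g z = 0 -> [\/ l1 z = 0, l2 z = 0 | q z = 0]].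
Proof.
move=> [Pf nf] [Pg ng]; pose S z := f z = 0 /\ g z = 0.
have n1 : form 1 (fun _ : R * R => 1 : R).
  by split; [apply: Pol_cst|exists (0, 0); apply: oner_neq0].
have n2 : form 2 (fun _ : R * R => 1 : R).
  by split; [apply: Pol_cst|exists (0, 0); apply: oner_neq0].
have [[a [b [ab [fa ga] [fb gb]]]]|[l fl hl]] := two_or_line S; last first.
  right; exists l, (fun=> 1), (fun=> 1); split=> // z fz gz.
  by constructor 1; apply: hl.
pose L1 := @line_fun R a b; have fL1 := form_line ab.
have [[c [d [cd [[fc gc] lc] [[fd gd] ld]]]]|[l fl hl]] :=
    two_or_line (fun z => S z /\ L1 z != 0); last first.
  right; exists L1, l, (fun=> 1); split=> // z fz gz.
  have [h|h] := eqVneq (L1 z) 0; [by constructor 1|constructor 2].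
  by apply: hl.
have [t [t' [ut lt lt']]] := two_off d fL1.1 lc.
pose e k z := nth 0 [:: f z; z.1 * f z; z.2 * f z; g z; z.1 * g z; z.2 * g z] k.
(* With the common zeros at parameters 0 and 1 this makes five zeros of a quartic on the first
   chord, then four zeros of the cubic quotient on the second. *)
pose s := [:: on_param a b 2; on_param a b 3; on_param a b 4; on_param c d t; on_param c d t'].
have [co [[k k6 ck] hco]] := @lin_dep R 6 e s isT.
pose l z := affine (co 1%N) (co 2%N) (co 0%N) z.
pose l' z := affine (co 4) (co 5) (co 3) z.
pose h z := l z * f z + l' z * g z.
have hE z : \sum_(k < 6) co k * e k z = h z.
  by rewrite !big_ord_recl big_ord0 /e /= /bump /= /h /l /l' /affine; ring.
have hs z : z \in s -> h z = 0 by move=> /hco; rewrite hE.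
have hS z : S z -> h z = 0 by move=> [fz gz]; rewrite /h fz gz; ring.
have Pl : Pol 1 l := Pol_affine _ _ _; have Pl' : Pol 1 l' := Pol_affine _ _ _.
have Ph : Pol 4 h := PolD (PolM Pl Pf) (PolM Pl' Pg).
have nll : nz l \/ nz l'.
  move: k k6 ck; do 3 (case=> [_ ck|]; first by left; apply: nz_affine; rewrite ck ?orbT).
  by do 3 (case=> [_ ck|]; first by right; apply: nz_affine; rewrite ck ?orbT).
have [nh|h0] := dec_nz h; last first.
  case: (syzygy (conj Pf nf) (conj Pg ng) Pl Pl' nll h0); first by left.
  move=> [l1 [q [fl1 fq hq]]]; right; exists l1, (fun=> 1), q; split=> // z fz gz.
  by case: (hq z fz gz); [constructor 1|constructor 3].
right; have [||h1 Ph1 eh1] := @chord_factor 3 h a b [:: 0; 1; 2; 3; 4] ab Ph _ erefl.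
- exact: (nat_seq_uniq 5).
- move=> x; rewrite !inE => /or4P[/eqP->|/eqP->|/eqP->|/orP[/eqP->|/eqP->]].
  + by rewrite on_param0 hS.
  + by rewrite on_param1 hS.
  + by rewrite hs ?inE ?eqxx ?orbT.
  + by rewrite hs ?inE ?eqxx ?orbT.
  + by rewrite hs ?inE ?eqxx ?orbT.
have nh1 := nzMr nh eh1.
have h1z z : h z = 0 -> L1 z != 0 -> h1 z = 0.
  by rewrite eh1 => /eqP; rewrite mulf_eq0 => /orP[/eqP|/eqP//]; rewrite /L1 => ->; rewrite eqxx.
have [|q Pq eq] := @chord_factor 2 h1 c d [:: 0; 1; t; t'] cd Ph1 ut erefl.
  move=> x; rewrite !inE => /or4P[/eqP->|/eqP->|/eqP->|/eqP->].
  + by rewrite on_param0 h1z ?hS.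
  + by rewrite on_param1 h1z ?hS.
  + by rewrite h1z ?hs ?inE ?eqxx ?orbT.
  + by rewrite h1z ?hs ?inE ?eqxx ?orbT.
exists L1, (line_fun c d), q; split=> //.
- exact: form_line.
- by split=> //; apply: nzMr eq.
move=> z fz gz; have /eqP := hS z (conj fz gz).
by rewrite eh1 eq !mulf_eq0 => /or3P[]/eqP; [constructor 1|constructor 2|constructor 3].
Qed.

(** The argument for two cubics, with [l q + c f]: four coefficients against two conditions on one
    chord and one on another. If the combination is identically zero, [q] divides [f]. *)
Lemma conic_cubic q f : form 2 q -> form 3 f ->
  (exists2 l, form 1 l & forall z, f z = l z * q z) \/
  exists l1 l2 l3, [/\ form 1 l1, form 1 l2, form 1 l3 &
    forall z, q z = 0 -> f z = 0 -> [\/ l1 z = 0, l2 z = 0 | l3 z = 0]].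
Proof.
move=> [Pq nq] [Pf nf]; pose S z := q z = 0 /\ f z = 0.
have n1 : form 1 (fun _ : R * R => 1 : R).
  by split; [apply: Pol_cst|exists (0, 0); apply: oner_neq0].
have [[a [b [ab [qa fa] [qb fb]]]]|[l fl hl]] := two_or_line S; last first.
  right; exists l, (fun=> 1), (fun=> 1); split=> // z fz gz.
  by constructor 1; apply: hl.
pose L1 := @line_fun R a b; have fL1 := form_line ab.
have [[c [d [cd [[qc fc] lc] [[qd fd] ld]]]]|[l fl hl]] :=
    two_or_line (fun z => S z /\ L1 z != 0); last first.
  right; exists L1, l, (fun=> 1); split=> // z fz gz.
  have [h|h] := eqVneq (L1 z) 0; [by constructor 1|constructor 2].
  by apply: hl.
have [t [t' [ut lt _]]] := two_off d fL1.1 lc.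
pose e k z := nth 0 [:: q z; z.1 * q z; z.2 * q z; f z] k.
pose s := [:: on_param a b 2; on_param a b 3; on_param c d t].
have [co [[k k4 ck] hco]] := @lin_dep R 4 e s isT.
pose l z := affine (co 1%N) (co 2%N) (co 0%N) z.
pose h z := l z * q z + co 3 * f z.
have hE z : \sum_(k < 4) co k * e k z = h z.
  by rewrite !big_ord_recl big_ord0 /e /= /bump /= /h /l /affine; ring.
have hs z : z \in s -> h z = 0 by move=> /hco; rewrite hE.
have hS z : S z -> h z = 0 by move=> [fz gz]; rewrite /h fz gz; ring.
have Pl : Pol 1 l := Pol_affine _ _ _.
have Ph : Pol 3 h := PolD (PolM Pl Pq) (PolZ _ Pf).
have [nh|h0] := dec_nz h; last first.
  left; have [c3|c3] := eqVneq (co 3) 0.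
    have nl : nz l.
      move: k k4 ck; do 3 (case=> [_ ck|]; first by apply: nz_affine; rewrite ck ?orbT).
      by case=> // _; rewrite c3 eqxx.
    case: nq => z /negP[]; apply/eqP; apply: (affine_mul_eq0 Pl nl Pq) => w.
    by rewrite -[RHS](h0 w) /h c3; ring.
  have ef z : f z = - (co 3)^-1 * l z * q z.
    have e0 : l z * q z = - (co 3 * f z) by have := h0 z; rewrite /h; lra.
    by rewrite -mulrA e0; field.
  exists (fun z => - (co 3)^-1 * l z) => //.
  by split; [apply: PolZ|apply: nzMl ef].
right; have [||h1 Ph1 eh1] := @chord_factor 2 h a b [:: 0; 1; 2; 3] ab Ph _ erefl.
- exact: (nat_seq_uniq 4).
- move=> x; rewrite !inE => /or4P[/eqP->|/eqP->|/eqP->|/eqP->].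
  + by rewrite on_param0 hS.
  + by rewrite on_param1 hS.
  + by rewrite hs ?inE ?eqxx ?orbT.
  + by rewrite hs ?inE ?eqxx ?orbT.
have nh1 := nzMr nh eh1.
have h1z z : h z = 0 -> L1 z != 0 -> h1 z = 0.
  by rewrite eh1 => /eqP; rewrite mulf_eq0 => /orP[/eqP|/eqP//]; rewrite /L1 => ->; rewrite eqxx.
have [||l3 Pl3 el3] := @chord_factor 1 h1 c d [:: 0; 1; t] cd Ph1 _ erefl.
- by move: ut; rewrite (cat_uniq [:: 0; 1; t] [:: t']) => /and3P[].
- move=> x; rewrite !inE => /or3P[/eqP->|/eqP->|/eqP->].
  + by rewrite on_param0 h1z ?hS.
  + by rewrite on_param1 h1z ?hS.
  + by rewrite h1z ?hs ?inE ?eqxx ?orbT.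
exists L1, (line_fun c d), l3; split=> //.
- exact: form_line.
- by split=> //; apply: nzMr el3.
move=> z fz gz; have /eqP := hS z (conj fz gz).
by rewrite eh1 el3 !mulf_eq0 => /or3P[]/eqP; [constructor 1|constructor 2|constructor 3].
Qed.

(** One condition on a combination of the two forces it to split off the chord through two common
    zeros. *)
Lemma conic_conic q q' : form 2 q -> form 2 q' ->
  (exists2 c, c != 0 & forall z, q' z = c * q z) \/
  exists l1 l2, [/\ form 1 l1, form 1 l2 &
    forall z, q z = 0 -> q' z = 0 -> l1 z = 0 \/ l2 z = 0].
Proof.
move=> [Pq nq] [Pq' nq']; pose S z := q z = 0 /\ q' z = 0.
have n1 : form 1 (fun _ : R * R => 1 : R).
  by split; [apply: Pol_cst|exists (0, 0); apply: oner_neq0].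
have [[a [b [ab [qa fa] [qb fb]]]]|[l fl hl]] := two_or_line S; last first.
  by right; exists l, (fun=> 1); split=> // z fz gz; left; apply: hl.
pose e k z := nth 0 [:: q z; q' z] k.
have [co [[k k2 ck] hco]] := @lin_dep R 2 e [:: on_param a b 2] isT.
pose h z := co 0%N * q z + co 1%N * q' z.
have hE z : \sum_(k < 2) co k * e k z = h z.
  by rewrite !big_ord_recl big_ord0 /e /= /bump /= /h addr0.
have hs : h (on_param a b 2) = 0 by rewrite -hE hco ?inE.
have hS z : S z -> h z = 0 by move=> [fz gz]; rewrite /h fz gz; ring.
have Ph : Pol 2 h := PolD (PolZ _ Pq) (PolZ _ Pq').
have [nh|h0] := dec_nz h; last first.
  have n0 f (c : R) : nz f -> (forall z, c * f z = 0) -> c = 0.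
    by move=> [z fz] hz; have /eqP := hz z; rewrite mulf_eq0 (negbTE fz) orbF => /eqP.
  have c1 : co 1%N != 0.
    apply/negP => /eqP c1; have c0 : co 0%N = 0.
      by apply: (n0 q) => // z; rewrite -[RHS](h0 z) /h c1; ring.
    by move: k k2 ck; case=> [|[|//]] _; rewrite ?c0 ?c1 eqxx.
  have c0 : co 0%N != 0.
    apply/negP => /eqP c0; case/negP: c1; apply/eqP.
    by apply: (n0 q') => // z; rewrite -[RHS](h0 z) /h c0; ring.
  left; exists (- co 0%N / co 1%N); first by rewrite mulf_neq0 ?oppr_eq0 ?invr_eq0.
  move=> z; apply: (mulfI c1); have := h0 z; rewrite /h => e0.
  have -> : co 1%N * q' z = - (co 0%N * q z) by lra.
  by field.
right; have [||l Pl el] := @chord_factor 1 h a b [:: 0; 1; 2] ab Ph _ erefl.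
- exact: (nat_seq_uniq 3).
- move=> x; rewrite !inE => /or3P[/eqP->|/eqP->|/eqP->].
  + by rewrite on_param0 hS.
  + by rewrite on_param1 hS.
  + exact: hs.
exists (line_fun a b), l; split=> //.
- exact: form_line.
- by split=> //; apply: nzMr el.
move=> z fz gz; have /eqP := hS z (conj fz gz).
by rewrite el mulf_eq0 => /orP[]/eqP; [left|right].
Qed.

Lemma line_fun_trans x y u v : x != y -> line_fun x y u = 0 -> line_fun x y v = 0 ->
  line_fun x u v = 0 :> R.
Proof.
move=> xy; rewrite /line_fun => h1 h2.
have ne : (y.1 - x.1 != 0) || (y.2 - x.2 != 0).
  rewrite -negb_and; apply: contra xy; rewrite !subr_eq0 => /andP[/eqP e1 /eqP e2].
  by apply/eqP; move: e1 e2; case: (x) => ? ?; case: (y) => ? ? /= -> ->.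
case/orP: ne => ne; apply: (mulfI ne); rewrite mulr0.
  transitivity ((u.1 - x.1) * ((y.1 - x.1) * (v.2 - x.2) - (y.2 - x.2) * (v.1 - x.1))
    - (v.1 - x.1) * ((y.1 - x.1) * (u.2 - x.2) - (y.2 - x.2) * (u.1 - x.1))); first by ring.
  by rewrite h1 h2; ring.
transitivity ((u.2 - x.2) * ((y.1 - x.1) * (v.2 - x.2) - (y.2 - x.2) * (v.1 - x.1))
    - (v.2 - x.2) * ((y.1 - x.1) * (u.2 - x.2) - (y.2 - x.2) * (u.1 - x.1))); first by ring.
by rewrite h1 h2; ring.
Qed.

Lemma form_collinear l x y v : form 1 l -> l x = 0 -> l y = 0 -> l v = 0 ->
  line_fun x y v = 0.
Proof.
move=> [/Pol1P[A [B [C ->]]] nl] h1 h2 h3.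
have [xy|xy] := eqVneq x y; first by rewrite xy /line_fun; ring.
move: h1 h2 h3 nl; rewrite /affine /line_fun => h1 h2 h3 nl.
have e1 : A * (y.1 - x.1) + B * (y.2 - x.2) = 0 by lra.
have e2 : A * (v.1 - x.1) + B * (v.2 - x.2) = 0 by lra.
have [a0|a0] := eqVneq A 0; last first.
  apply: (mulfI a0); rewrite mulr0.
  transitivity ((A * (y.1 - x.1) + B * (y.2 - x.2)) * (v.2 - x.2)
    - (y.2 - x.2) * (A * (v.1 - x.1) + B * (v.2 - x.2))); first by ring.
  by rewrite e1 e2; ring.
have [b0|b0] := eqVneq B 0.
  case: nl => w; rewrite a0 b0; move: h1; rewrite a0 b0 => h1.
  have -> : C = 0 by lra.
  by rewrite !mul0r !addr0 eqxx.
apply: (mulfI b0); rewrite mulr0.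
transitivity ((y.1 - x.1) * (A * (v.1 - x.1) + B * (v.2 - x.2))
  - (v.1 - x.1) * (A * (y.1 - x.1) + B * (y.2 - x.2))); first by ring.
by rewrite e1 e2; ring.
Qed.

Lemma form_on_line l x y v : Pol 1 l -> x != y -> l x = 0 -> l y = 0 ->
  line_fun x y v = 0 -> l v = 0.
Proof.
move=> /Pol1P[A [B [C ->]]] xy; rewrite /affine /line_fun => h1 h2 h3.
have ne : (y.1 - x.1 != 0) || (y.2 - x.2 != 0).
  rewrite -negb_and; apply: contra xy; rewrite !subr_eq0 => /andP[/eqP e1 /eqP e2].
  by apply/eqP; move: e1 e2; case: (x) => ? ?; case: (y) => ? ? /= -> ->.
have e1 : A * (y.1 - x.1) + B * (y.2 - x.2) = 0 by lra.
suff e2 : A * (v.1 - x.1) + B * (v.2 - x.2) = 0 by lra.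
case/orP: ne => ne; apply: (mulfI ne); rewrite mulr0.
  transitivity ((v.1 - x.1) * (A * (y.1 - x.1) + B * (y.2 - x.2)) +
   B * ((y.1 - x.1) * (v.2 - x.2) - (y.2 - x.2) * (v.1 - x.1))); first by ring.
  by rewrite e1 h3; ring.
transitivity ((v.2 - x.2) * (A * (y.1 - x.1) + B * (y.2 - x.2)) -
   A * ((y.1 - x.1) * (v.2 - x.2) - (y.2 - x.2) * (v.1 - x.1))); first by ring.
by rewrite e1 h3; ring.
Qed.

End Intersections.

(** * Cubics along strips of the triangular lattice *)

Section Strips.
Variables (R : realFieldType) (I : finType) (z : I -> R * R) (t : R).
Implicit Types (p q x y u : I).
Let a i := (z i).1 + t * (z i).2.
Let b i := (z i).2.
Hypothesis a_inj : injective a.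
Local Notation rich3 := (rich3 a b).
Local Notation blk := (blk a b).
Local Notation verts := (verts a b).

(** Concurrence of dual lines is collinearity of the points; the shear by [t] cancels in the
    determinant. *)
Lemma blk_line x y u : x != y ->
  (u \in blk x y) = (line_fun (z x) (z y) (z u) == 0).
Proof.
move=> xy; have ne := slope_neq a_inj xy; rewrite inE /ht /cross.
rewrite -subr_eq0 /line_fun.
have e : (a u * ((b y - b x) / (a x - a y)) + b u - (a x * ((b y - b x) / (a x - a y)) + b x))
    * (a x - a y) =
  - (((z y).1 - (z x).1) * ((z u).2 - (z x).2) - ((z y).2 - (z x).2) * ((z u).1 - (z x).1)).
  transitivity ((a u - a x) * (b y - b x) + (b u - b x) * (a x - a y)); last by rewrite /a /b; ring.
  by field.
by rewrite -[LHS]orbF -(negbTE ne) -mulf_eq0 e oppr_eq0.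
Qed.

Lemma rich3C x y u : rich3 x y u -> rich3 y x u.
Proof. by rewrite /rich3 (finset.setUC [set y]). Qed.

Lemma rich3r x y u : rich3 x y u -> rich3 x u y.
Proof. by rewrite /rich3 -!finset.setUA (finset.setUC [set u]). Qed.

Lemma rich3rot x y u : rich3 x y u -> rich3 y u x.
Proof. by move=> /rich3C/rich3r. Qed.

Lemma rich3_neq x y u : rich3 x y u -> [/\ x != y, y != u & x != u].
Proof.
case=> _ c; split; apply/negP => /eqP e; move: c; rewrite e.
- by rewrite finset.setUid cards2; case: (_ != _).
- by rewrite -finset.setUA finset.setUid cards2; case: (_ != _).
- by rewrite (finset.setUC [set u]) -finset.setUA finset.setUid cards2; case: (_ != _).
Qed.

Lemma rich3_blk x y u : rich3 x y u -> [set x; y; u] = blk x y.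
Proof.
move=> h; have [xy _ _] := rich3_neq h; case: h => h _.
by apply: (blk_vertsE a_inj h); rewrite ?inE ?eqxx ?orbT.
Qed.

Lemma rich3_uniq x y u u' : rich3 x y u -> rich3 x y u' -> u = u'.
Proof.
move=> h h'; have [_ yu xu] := rich3_neq h.
have : u \in [set x; y; u'] by rewrite (rich3_blk h') -(rich3_blk h) !inE eqxx orbT.
by rewrite !inE (eq_sym u x) (eq_sym u y) (negbTE xu) (negbTE yu) => /eqP.
Qed.

Lemma chasles_rich (e : nat -> nat -> I) (f : R * R -> R) :
    (forall i j i' j', (i < 3)%N -> (j < 3)%N -> (i' < 3)%N -> (j' < 3)%N ->
       e i j = e i' j' -> i = i' /\ j = j') ->
    (forall i, (i < 3)%N -> rich3 (e i 0%N) (e i 1%N) (e i 2%N) /\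
       rich3 (e 0%N i) (e 1%N i) (e 2%N i)) ->
    Pol 3 f ->
    (forall i j, (i < 3)%N -> (j < 3)%N -> (i, j) != (2%N, 2%N) -> f (z (e i j)) = 0) ->
  f (z (e 2%N 2%N)) = 0.
Proof.
move=> inj T Pf fe.
pose r i := line_fun (z (e i 0%N)) (z (e i 1%N)).
pose c j := line_fun (z (e 0%N j)) (z (e 1%N j)).
have rE i u : (i < 3)%N -> (r i (z u) == 0) = (u \in [set e i 0%N; e i 1%N; e i 2%N]).
  move=> i3; have [h _] := T i i3; have [ne _ _] := rich3_neq h.
  by rewrite (rich3_blk h) blk_line.
have cE i u : (i < 3)%N -> (c i (z u) == 0) = (u \in [set e 0%N i; e 1%N i; e 2%N i]).
  move=> i3; have [_ h] := T i i3; have [ne _ _] := rich3_neq h.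
  by rewrite (rich3_blk h) blk_line.
apply: (chasles (x := fun i j => z (e i j)) (r := r) (c := c)) => //.
- by move=> i i3; split; apply: Pol_line_fun.
- move=> i j i3 j3; split; apply/eqP; rewrite ?rE ?cE // !inE.
    by move: j3; case: j => [|[|[|]]] //; rewrite eqxx ?orbT.
  by move: i3; case: i => [|[|[|]]] //; rewrite eqxx ?orbT.
move=> i k j i3 k3 j3 ik; rewrite rE // cE // !inE; split; apply/negP => h; case/negP: ik.
  by case/orP: h => [/orP[]|] /eqP/inj h; apply/eqP; case: h.
by case/orP: h => [/orP[]|] /eqP/inj h; apply/eqP; case: h.
Qed.

Lemma chasles9 x00 x01 x02 x10 x11 x12 x20 x21 x22 (f : R * R -> R) :
    uniq [:: x00; x01; x02; x10; x11; x12; x20; x21; x22] ->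
    [/\ rich3 x00 x01 x02, rich3 x10 x11 x12 & rich3 x20 x21 x22] ->
    [/\ rich3 x00 x10 x20, rich3 x01 x11 x21 & rich3 x02 x12 x22] ->
    Pol 3 f ->
    {in [:: x00; x01; x02; x10; x11; x12; x20; x21], forall x, f (z x) = 0} ->
  f (z x22) = 0.
Proof.
move=> un [r0 r1 r2] [c0 c1 c2] Pf h.
pose s := [:: x00; x01; x02; x10; x11; x12; x20; x21; x22].
apply: (@chasles_rich (fun i j => nth x00 s (3 * i + j)) f) => //.
- move=> i j i' j' i3 j3 i'3 j'3 /eqP; rewrite nth_uniq //= => [/eqP e||]; lia.
- by case=> [|[|[|]]].
move=> i j i3 j3; rewrite xpair_eqE => ne.
have lt : (3 * i + j < 8)%N by lia.
apply: h; rewrite /s -[X in nth _ X _]/([:: x00; x01; x02; x10; x11; x12; x20; x21] ++ [:: x22]).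
by rewrite nth_cat lt mem_nth.
Qed.

(* The nine points of a Chasles configuration: [c_ij] is on the lines of
   [al_i], [be_j] and of [al_j], [be_i]. *)
Definition hexad al0 al1 al2 be0 be1 be2 c01 c02 c12 : Prop :=
  [/\ uniq [:: al0; al1; al2; be0; be1; be2],
      c12 \notin [:: al0; al1; al2; be0; be1; be2],
      rich3 c01 al0 be1 /\ rich3 c01 al1 be0,
      rich3 c02 al0 be2 /\ rich3 c02 al2 be0 &
      rich3 c12 al1 be2 /\ rich3 c12 al2 be1].

(** A further coincidence would give two three-point lines sharing two points, and thus equal third
    points that are known to differ. *)
Lemma hexad_uniq al0 al1 al2 be0 be1 be2 c01 c02 c12 :
  hexad al0 al1 al2 be0 be1 be2 c01 c02 c12 ->
  uniq [:: c01; c02; c12; al0; al1; al2; be0; be1; be2].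
Proof.
case=> un; rewrite !inE !negb_or -?andbA.
move=> /and5P[n0 n1 n2 m0 /andP[m1 m2]] [A01 A10] [A02 A20] [A12 A21].
have := un; rewrite /= !inE !negb_or -?andbA.
move=> /and5P[u01 u02 v00 v01 /and5P[v02 u12 v10 v11 /and5P[v12 v20 v21 v22 /and4P[w01 w02 w12 _]]]].
have [d1 _ d2] := rich3_neq A01; have [d3 _ d4] := rich3_neq A10.
have [d5 _ d6] := rich3_neq A02; have [d7 _ d8] := rich3_neq A20.
have F x y v v' : v != v' -> rich3 x y v -> rich3 x y v' -> False.
  by move=> ne h h'; rewrite (rich3_uniq h h') eqxx in ne.
have e1 : c01 != c02.
  by apply/eqP => e; subst c02; apply: (F _ _ _ _ w12 A01 A02).
have e2 : c01 != c12.
  by apply/eqP => e; subst c12; apply: (F _ _ _ _ w02 A10 A12).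
have e3 : c02 != c12.
  by apply/eqP => e; subst c12; apply: (F _ _ _ _ w01 A20 A21).
have e4 : c01 != al2.
  apply/eqP => e; subst c01.
  exact: (F al2 be1 _ _ n0 (rich3r (rich3C A21)) (rich3r A01)).
have e5 : c01 != be2.
  apply/eqP => e; subst c01.
  exact: (F al1 be2 _ _ m0 (rich3r (rich3C A12)) (rich3C A10)).
have e6 : c02 != al1.
  apply/eqP => e; subst c02.
  exact: (F al1 be2 _ _ n0 (rich3r (rich3C A12)) (rich3r A02)).
have e7 : c02 != be1.
  apply/eqP => e; subst c02.
  exact: (F al2 be1 _ _ m0 (rich3r (rich3C A21)) (rich3C A20)).
by rewrite e1 e2 e3 e4 e5 e6 e7 d1 d2 d3 d4 d5 d6 d7 d8 n0 n1 n2 m0 m1 m2 u01 u02 v00 v01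
  v02 u12 v10 v11 v12 v20 v21 v22 w01 w02 w12.
Qed.

(** The six three-point lines are laid out as rows and columns of a grid with [be0] in the last
    corner. *)
Lemma hexad_be0 al0 al1 al2 be0 be1 be2 c01 c02 c12 (f : R * R -> R) :
  hexad al0 al1 al2 be0 be1 be2 c01 c02 c12 -> Pol 3 f ->
  {in [:: c01; c02; c12; al0; al1; al2; be1; be2], forall x, f (z x) = 0} ->
  f (z be0) = 0.
Proof.
move=> H Pf h; have un := hexad_uniq H; case: H => _ _ [A01 A10] [A02 A20] [A12 A21].
apply: (@chasles9 be1 c12 al2 al0 be2 c02 c01 al1 be0) => //.
- rewrite -(perm_uniq (s1 := [:: c01; c02; c12; al0; al1; al2; be0; be1; be2])) //.
  apply/allP => x _ /=; apply/eqP; lia.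
- split; [exact: rich3rot (rich3rot A21)|exact: rich3rot A02|exact: A10].
- split; [exact: rich3C (rich3rot A01)|exact: rich3r A12|exact: rich3C A20].
move=> x; rewrite !inE => hx; apply: h; rewrite !inE.
by move: hx; do 8!(case: (x == _) => //).
Qed.

Lemma hexad_be2 al0 al1 al2 be0 be1 be2 c01 c02 c12 (f : R * R -> R) :
  hexad al0 al1 al2 be0 be1 be2 c01 c02 c12 -> Pol 3 f ->
  {in [:: c01; c02; c12; al0; al1; al2; be0; be1], forall x, f (z x) = 0} ->
  f (z be2) = 0.
Proof.
move=> H Pf h; have un := hexad_uniq H; case: H => _ _ [A01 A10] [A02 A20] [A12 A21].
apply: (@chasles9 c01 be0 al1 be1 al2 c12 al0 c02 be2) => //.
- rewrite -(perm_uniq (s1 := [:: c01; c02; c12; al0; al1; al2; be0; be1; be2])) //.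
  apply/allP => x _ /=; apply/eqP; lia.
- split; [exact: rich3r A10|exact: rich3rot (rich3r A21)|exact: rich3C A02].
- split; [exact: rich3r A01|exact: rich3r (rich3rot (rich3rot A20))|exact: rich3C A12].
move=> x; rewrite !inE => hx; apply: h; rewrite !inE.
by move: hx; do 8!(case: (x == _) => //).
Qed.

Lemma hexad_swap al0 al1 al2 be0 be1 be2 c01 c02 c12 :
  hexad al0 al1 al2 be0 be1 be2 c01 c02 c12 ->
  hexad be0 be1 be2 al0 al1 al2 c01 c02 c12.
Proof.
case=> un n [A01 A10] [A02 A20] [A12 A21].
have p : perm_eq [:: be0; be1; be2; al0; al1; al2] [:: al0; al1; al2; be0; be1; be2].
  by rewrite -[X in perm_eq X]/([:: be0; be1; be2] ++ [:: al0; al1; al2]) perm_catC.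
split; [by rewrite (perm_uniq p)|by rewrite (perm_mem p)|..];
  by split; apply: rich3r.
Qed.

(** Nine points fix a cubic: the centre [p0], the row points [p1], [p2], [q], and five of the six
    points on the first three lines. Chasles yields the sixth, [B 0], and then each further [B]
    followed by the [A] of the same index. *)
Lemma strip_cubic N p0 p1 p2 q (A B : nat -> I) : (2 < N)%N ->
    (forall i j, (i <= N)%N -> (j <= N)%N ->
      (A i != B j) /\ (i != j -> (A i != A j) /\ (B i != B j))) ->
    (forall i, (i <= N)%N -> rich3 p0 (A i) (B i)) ->
    (forall i, (i + 1 <= N)%N -> rich3 p1 (A i) (B (i + 1)%N)) ->
    (forall i, (i + 2 <= N)%N -> rich3 p2 (A i) (B (i + 2)%N)) ->
    (forall i, (i + 1 <= N)%N -> rich3 q (A (i + 1)%N) (B i)) ->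
  exists f, [/\ form 3 f, f (z p0) = 0 &
    forall i, (i <= N)%N -> f (z (A i)) = 0 /\ f (z (B i)) = 0].
Proof.
move=> N2 D T0 T1 T2 T3.
have [f [Pf nf fs]] := @cubic_through R
  [:: z p0; z p1; z p2; z q; z (A 0%N); z (A 1%N); z (A 2%N); z (B 1%N); z (B 2%N)] isT.
exists f; split=> //; first by apply: fs; rewrite !inE eqxx.
have [f0 f1 f2 fq] : [/\ f (z p0) = 0, f (z p1) = 0, f (z p2) = 0 & f (z q) = 0].
  by split; apply: fs; rewrite !inE eqxx ?orbT.
have [a0 a1 a2 b1 b2] : [/\ f (z (A 0%N)) = 0, f (z (A 1%N)) = 0, f (z (A 2%N)) = 0,
    f (z (B 1%N)) = 0 & f (z (B 2%N)) = 0].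
  by split; apply: fs; rewrite !inE eqxx ?orbT.
have U i i' i'' j j' j'' : (maxn i (maxn i' i'') <= N)%N -> (maxn j (maxn j' j'') <= N)%N ->
    [&& i != i', i != i'' & i' != i''] -> [&& j != j', j != j'' & j' != j''] ->
    uniq [:: A i; A i'; A i''; B j; B j'; B j''] /\
    p0 \notin [:: A i; A i'; A i''; B j; B j'; B j''].
  rewrite !geq_max => /and3P[iN i'N i''N] /and3P[jN j'N j''N] /and3P[i1 i2 i3] /and3P[j1 j2 j3].
  have AA (x y : nat) : (x <= N)%N -> (y <= N)%N -> x != y -> A x != A y.
    by move=> xN yN ne; have [_ h] := D x y xN yN; have [] := h ne.
  have BB (x y : nat) : (x <= N)%N -> (y <= N)%N -> x != y -> B x != B y.
    by move=> xN yN ne; have [_ h] := D x y xN yN; have [] := h ne.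
  have AB (x y : nat) : (x <= N)%N -> (y <= N)%N -> A x != B y.
    by move=> xN yN; have [] := D x y xN yN.
  have pA (x : nat) : (x <= N)%N -> p0 != A x by move=> /T0/rich3_neq[].
  have pB' (x : nat) : (x <= N)%N -> p0 != B x by move=> /T0/rich3_neq[].
  by rewrite /= !inE !negb_or !AA // !BB // !AB // !pA // !pB'.
(* The configuration through [p0], [p1], [p2], in which [B (i + 3)] is the new point. *)
have W1 i : (i + 3 <= N)%N -> hexad (A i) (A (i + 1)%N) (A (i + 2)%N)
    (B (i + 3)%N) (B (i + 2)%N) (B (i + 1)%N) p2 p1 p0.
  move=> iN; have [||||un n0] := @U i (i + 1)%N (i + 2)%N (i + 3)%N (i + 2)%N (i + 1)%N; try lia.
  split=> //.
  - split; first by apply: T2; lia.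
    have -> : (i + 3 = (i + 1) + 2)%N by lia.
    apply: T2; lia.
  - split; first by apply: T1; lia.
    have -> : (i + 3 = (i + 2) + 1)%N by lia.
    apply: T1; lia.
  - by split; apply: T0; lia.
(* The configuration through [p0], [p1], [q]; it yields [A (i + 2)], and [B 0] at the start. *)
have W0 i : (i + 2 <= N)%N -> hexad (A (i + 1)%N) (A i) (A (i + 2)%N)
    (B (i + 1)%N) (B (i + 2)%N) (B i) p1 q p0.
  move=> iN; have [||||un n0] := @U (i + 1)%N i (i + 2)%N (i + 1)%N (i + 2)%N i; try lia.
  split=> //.
  - split; last by apply: T1; lia.
    have -> : (i + 2 = (i + 1) + 1)%N by lia.
    apply: T1; lia.
  - split; first by apply: T3; lia.
    have -> : (i + 2 = (i + 1) + 1)%N by lia.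
    apply: T3; lia.
  - by split; apply: T0; lia.
have in8 (s : seq I) : all (fun x => f (z x) == 0) s -> {in s, forall x, f (z x) = 0}.
  by move=> /allP h x xs; apply/eqP/h.
have stepB i : (i + 3 <= N)%N -> f (z (A i)) = 0 -> f (z (A (i + 1)%N)) = 0 ->
    f (z (A (i + 2)%N)) = 0 -> f (z (B (i + 1)%N)) = 0 -> f (z (B (i + 2)%N)) = 0 ->
    f (z (B (i + 3)%N)) = 0.
  move=> iN e1 e2 e3 e4 e5; apply: (hexad_be0 (W1 i iN) Pf).
  by apply: in8; rewrite /= f0 f1 f2 e1 e2 e3 e4 e5 !eqxx.
have stepA i : (i + 2 <= N)%N -> f (z (A i)) = 0 -> f (z (A (i + 1)%N)) = 0 ->
    f (z (B i)) = 0 -> f (z (B (i + 1)%N)) = 0 -> f (z (B (i + 2)%N)) = 0 ->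
    f (z (A (i + 2)%N)) = 0.
  move=> iN e1 e2 e3 e4 e5; apply: (hexad_be2 (hexad_swap (W0 i iN)) Pf).
  by apply: in8; rewrite /= f0 f1 fq e1 e2 e3 e4 e5 !eqxx.
have b0 : f (z (B 0%N)) = 0.
  apply: (hexad_be2 (W0 0%N _) Pf); first lia.
  by apply: in8; rewrite /= f0 f1 fq a0 a1 a2 b1 b2 !eqxx.
have main i : (i + 2 <= N)%N -> [/\ f (z (A i)) = 0, f (z (A (i + 1)%N)) = 0,
    f (z (A (i + 2)%N)) = 0, f (z (B i)) = 0 & f (z (B (i + 1)%N)) = 0 /\ f (z (B (i + 2)%N)) = 0].
  elim: i => [|i IH] iN; first by rewrite !add0n.
  have [|e1 e2 e3 e4 [e5 e6]] := IH; first lia.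
  have e7 : f (z (B (i + 3)%N)) = 0 by apply: stepB => //; lia.
  have e8 : f (z (A (i + 3)%N)) = 0.
    have -> : (i + 3 = (i + 1) + 2)%N by lia.
    apply: stepA; rewrite -?addnA //; lia.
  have -> : (i.+1 = i + 1)%N by lia.
  by rewrite -!addnA.
move=> i iN; have [lt|ge] := ltnP i 2.
  case: i lt {iN} => [|[|//]] _; by [].
have [|e1 e2 e3 _ [_ e6]] := main (i - 2)%N; first lia.
by rewrite subnK in e3 e6.
Qed.

End Strips.

(** * Runs of good vertices along one dual line *)

Section Pencil.
Variables (R : realFieldType) (I : finType) (z : I -> R * R) (t : R).
Let a i := (z i).1 + t * (z i).2.
Let b i := (z i).2.
Hypothesis a_inj : injective a.
Local Notation blk := (blk a b).
Local Notation thru := (thru a b).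
Local Notation cross := (cross a b).
Local Notation bad := (bad_level a b 2).

Definition bad_count p := #|[set T in bad | p \in T]|.

Lemma thru_cross p s k : k \in thru p s -> k != p -> s = cross p k.
Proof. by rewrite inE => /eqP h kp; apply: cross_uniq; rewrite 1?eq_sym. Qed.

Lemma run_cubic p N (s : nat -> R) : (2 < N)%N ->
    (forall i, (i <= N)%N -> thru p (s i) \in verts a b /\ thru p (s i) \notin bad) ->
    (forall i j, (i < j)%N -> (j <= N)%N -> s i < s j) ->
    (forall i, (i < N)%N -> novert a b p (s i) (s i.+1)) ->
  exists f, [/\ form 3 f, f (z p) = 0 & forall i, (i <= N)%N ->
    forall r, r \in thru p (s i) -> f (z r) = 0].
Proof.
move=> N2 hs lts nv.
have st s' : star a b (s', ht a b p s') = thru p s'.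
  by apply/setP => l; rewrite !inE /side /= subr_eq0 eq_sym.
have [|||A [B [p1 [p2 [q [T0 T1 T2 T3]]]]]] := @run_strip _ _ a b a_inj N p s.
- exact: ltnW.
- by move=> i iN; apply: goodn_level; rewrite ?st //; case: (hs i iN).
- by move=> i iN; split; [apply: lts|apply: nv].
have A0 i : (i <= N)%N -> s i = cross p (A i) /\ s i = cross p (B i).
  move=> iN; have [r e] := T0 i iN; have [h1 _ h2] := rich3_neq r.
  by split; apply: thru_cross; rewrite 1?eq_sym // e !inE eqxx ?orbT.
have [||||| f [ff fp fAB]] := @strip_cubic _ _ z t a_inj N p p1 p2 q A B N2.
- move=> i j iN jN; have [Ai Bi] := A0 i iN; have [Aj Bj] := A0 j jN.
  have ne : i != j -> s i != s j.
    by rewrite neq_ltn => /orP[] lt; [rewrite lt_eqF //|rewrite gt_eqF //]; apply: lts.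
  split.
    have [e|/ne] := eqVneq i j; last by apply: contraNneq => e; rewrite Ai Bj e.
    by subst j; have [r _] := T0 i iN; have [_] := rich3_neq r.
  by move=> /ne h; split; apply: contraNneq h => e; [rewrite Ai Aj e|rewrite Bi Bj e].
- by move=> i /T0[].
- exact: T1.
- exact: T2.
- exact: T3.
exists f; split=> // i iN r; have [_ ->] := T0 i iN; have [h1 h2] := fAB i iN.
by rewrite !inE => /orP[/orP[]|] /eqP->.
Qed.

(** Bad vertices cut the dual line of [p] into at most [bad_count p + 1] runs. [E] holds the bad
    vertices and the first three of each run, which disposes of runs too short for [strip_cubic]. *)
Lemma pencil_cubics p : exists (f : nat -> R * R -> R) (E : {set {set I}}),
  [/\ forall k, form 3 (f k) /\ f k (z p) = 0, (#|E| <= 4 * bad_count p + 3)%N &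
      forall q, q != p -> blk p q \in E \/ (#|blk p q| = 3%N /\
        exists2 k, (k < bad_count p + 1)%N & forall r, r \in blk p q -> f k (z r) = 0)].
Proof.
pose xs := sort <=%R (undup [seq cross p j | j <- enum I & j != p]).
pose m := size xs; pose s i := nth 0 xs i.
have xsP u : reflect (exists2 j, j != p & u = cross p j) (u \in xs).
  rewrite mem_sort mem_undup; apply: (iffP mapP) => [[j]|[j jp ->]].
    by rewrite mem_filter => /andP[jp _] ->; exists j.
  by exists j; rewrite // mem_filter jp mem_enum.
have xs_sorted : sorted <%R xs by rewrite sort_lt_sorted undup_uniq.
have lts i j : (i < j)%N -> (j < m)%N -> s i < s j.
  move=> ij jm; apply: (sorted_ltn_nth lt_trans) => //; rewrite inE //; exact: ltn_trans jm.
have sxs i : (i < m)%N -> s i \in xs by move=> im; apply: mem_nth.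
have nv i : (i.+1 < m)%N -> novert a b p (s i) (s i.+1).
  move=> im u /andP[u1 u2] [j jp hj].
  have /(nthP 0)[k km ek] : u \in xs.
    by apply/xsP; exists j => //; apply: cross_uniq; rewrite 1?eq_sym.
  have [ki|ik] := leqP k i.
    move: u1; apply/negP; rewrite -leNgt -ek -/(s k).
    by move: ki; rewrite leq_eqVlt => /orP[/eqP->//|lt]; rewrite ltW // lts // ltnW.
  move: u2; apply/negP; rewrite -leNgt -ek -/(s k).
  by move: ik; rewrite leq_eqVlt => /orP[/eqP<-//|lt]; rewrite ltW // lts.
have sV i : (i < m)%N -> thru p (s i) \in verts a b.
  by move=> /sxs/xsP[j jp ->]; apply: blk_verts; rewrite // eq_sym.
pose good i := (i < m)%N && (thru p (s i) \notin bad).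
pose bads := [seq i <- iota 0 m | ~~ good i].
have size_bads : (size bads <= bad_count p)%N.
  rewrite /bad_count cardE -(size_map (fun i => thru p (s i))); apply: uniq_leq_size.
    rewrite map_inj_in_uniq ?filter_uniq ?iota_uniq // => i j.
    rewrite !mem_filter !mem_iota !add0n => /and3P[_ _ im] /and3P[_ _ jm] e.
    have [k kp ek] := xsP _ (sxs i im).
    have kT : k \in thru p (s j) by rewrite -e ek inE ht_cross // eq_sym.
    have sij : s i = s j by rewrite ek -(thru_cross kT kp).
    by case: (ltngtP i j) => // lt; [have := lts _ _ lt jm|have := lts _ _ lt im];
      rewrite sij ltxx.
  move=> T /mapP[i]; rewrite mem_filter mem_iota add0n => /and3P[gi _ im] ->.
  rewrite mem_enum inE; move: gi; rewrite /good im /= negbK => -> /=.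
  by rewrite inE.
pose sts := [seq i <- iota 0 m | good i && ((i == 0%N) || ~~ good i.-1)].
have size_sts : (size sts <= bad_count p + 1)%N.
  have sub : {subset sts <= 0%N :: [seq i.+1 | i <- bads]}.
    move=> i; rewrite mem_filter mem_iota add0n => /and3P[/andP[_ h] _ im].
    case: i h im => [|i] //= ng im; rewrite inE /=; apply/mapP; exists i => //.
    by rewrite mem_filter ng mem_iota add0n (ltnW im).
  have := uniq_leq_size (filter_uniq _ (iota_uniq 0 m)) sub.
  by rewrite /= size_map => h; apply: leq_trans h _; rewrite addn1 ltnS.
have start i : good i -> exists j, [/\ j \in sts, (j <= i)%N &
    forall k, (j <= k <= i)%N -> good k].
  elim: i => [|i IH] gi.
    exists 0%N; split=> //; last by move=> k; rewrite leqn0 => /andP[_ /eqP->].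
    by rewrite mem_filter gi mem_iota; case/andP: gi.
  have [gi'|ngi] := boolP (good i).
    have [j [js ji h]] := IH gi'; exists j; split=> //; first exact: leqW.
    by move=> k /andP[jk]; rewrite leq_eqVlt => /orP[/eqP->//|ki]; apply: h; rewrite jk.
  exists i.+1; split=> //; last first.
    by move=> k h; have -> : k = i.+1 by lia.
  by rewrite mem_filter gi ngi orbT mem_iota; case/andP: gi.
have [f0 [Pf0 nf0 f0p]] := @cubic_through R [:: z p] isT.
(* The cubic is that of the longest run starting at [j]; if no four good vertices start there, any
   cubic through [p] serves. *)
have /choice[f fP] : forall j, exists f, [/\ form 3 f, f (z p) = 0 &
    forall i, (j + 3 <= i)%N -> (forall k, (j <= k <= i)%N -> good k) ->
      forall r, r \in thru p (s i) -> f (z r) = 0].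
  move=> j.
  have [[e he]|no] := pselect (exists e, `[< (j + 3 <= e)%N /\
      forall k, (j <= k <= e)%N -> good k >]); last first.
    exists f0; split=> [||i ji gi r _]; [by []|by apply: f0p; rewrite inE|].
    by case: no; exists i; apply/asboolP.
  have ub e' : `[< (j + 3 <= e')%N /\ forall k, (j <= k <= e')%N -> good k >] -> (e' <= m)%N.
    move=> /asboolP[h1 h2]; have /andP[h3 _] : good e' by apply: h2; lia.
    exact: ltnW.
  have [e1 /asboolP[je ge] emax] := ex_maxnP (ex_intro _ e he) ub.
  have e1m : (e1 < m)%N by have /andP[] : good e1 by apply: ge; lia.
  have [||||f [ff fp fr]] := @run_cubic p (e1 - j) (fun i => s (j + i)%N).
  - lia.
  - move=> i iN; have /andP[im ib] : good (j + i)%N by apply: ge; lia.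
    by split=> //; apply: sV.
  - by move=> i k ik kN; apply: lts; lia.
  - by move=> i iN; rewrite addnS; apply: nv; lia.
  exists f; split=> // i ji gi r.
  have ie : (i <= e1)%N by apply: emax; apply/asboolP.
  have {1}-> : i = (j + (i - j))%N by lia.
  by apply: fr; lia.
pose E1 := [set T in bad | p \in T].
pose E2 := [set thru p (s (nth 0%N sts q.1 + q.2)%N) | q : 'I_(bad_count p + 1) * 'I_3].
exists (fun k => f (nth 0%N sts k)), (E1 :|: E2); split.
- by move=> k; have [] := fP (nth 0%N sts k).
- apply: leq_trans (leq_card_setU _ _) _.
  have hE2 : (#|E2| <= (bad_count p + 1) * 3)%N.
    by apply: leq_trans (leq_imset_card _ _) _; rewrite card_prod !card_ord.
  by apply: leq_trans (leq_add (leqnn _) hE2) _; rewrite -/(bad_count p); lia.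
move=> q qp.
have /(nthP 0)[i im ei] : cross p q \in xs by apply/xsP; exists q.
rewrite /blk -ei -/(s i).
have [gi|ngi] := boolP (good i); last first.
  left; apply/finset.setUP; left; apply/setIdP; split; last by rewrite inE.
  by move: ngi; rewrite /good im /= negbK.
have [j [js ji gk]] := start i gi.
have jE : nth 0%N sts (index j sts) = j by apply: nth_index.
have jlt : (index j sts < bad_count p + 1)%N by apply: leq_trans size_sts; rewrite index_mem.
have [ge|lt] := leqP (j + 3) i; last first.
  left; apply/finset.setUP; right; have d : (i - j < 3)%N by lia.
  apply/imsetP; exists (Ordinal jlt, Ordinal d) => //=.
  by rewrite jE subnKC.
right; split.
  have /andP[_ nb] := gi.
  by apply: (good_vert_card3 (a := a) (b := b)); apply: (not_bad_good (sV i im) nb).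
exists (index j sts) => // r; rewrite jE; have [_ _] := fP j; exact.
Qed.

(** Double counting of incidences with [bad_level 2], whence [49 = 7 ^ 2]. *)
Lemma sum_bad_count : (\sum_p bad_count p <=
  49 * (22 * #|I| + 18 * #|double_verts a b|))%N.
Proof.
have h := @sum_bad_level _ _ a b a_inj 2; rewrite (_ : 7 ^ 2 = 49)%N // in h.
apply: leq_trans h.
have -> : (\sum_p bad_count p = \sum_p \sum_(T in bad) (p \in T))%N.
  apply: eq_bigr => p _; rewrite /bad_count -sum1_card big_mkcond [RHS]big_mkcond /=.
  by apply: eq_bigr => T _; rewrite inE; case: (T \in bad); case: (p \in T).
rewrite exchange_big /=; apply: leq_sum => T _.
by rewrite -sum1_card [leqRHS]big_mkcond /=; apply: leq_sum => p _; case: (p \in T).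
Qed.

End Pencil.

(** * Rotating a line about the points of a line *)

Section Sweep.
Variables (R : realFieldType) (I : finType) (z : I -> R * R).
Hypothesis z_inj : injective z.
Implicit Types (p q : I) (l : R * R -> R).

Definition zeros l : {set I} := [set p | l (z p) == 0].

Definition chord p q : {set I} := [set r | line_fun (z p) (z q) (z r) == 0].

Lemma zerosP l p : reflect (l (z p) = 0) (p \in zeros l).
Proof. by rewrite inE; apply: eqP. Qed.

Lemma card_low_rank (X : {set I}) (k : I -> R) D : {in X &, injective k} ->
  (#|[set q in X | #|[set q' in X | (k q' < k q)%R]| <= D]| <= D + 1)%N.
Proof.
move=> kinj; set Y := [set q in X | _].
have [->|[q0 q0Y]] := set_0Vmem Y; first by rewrite cards0.
case: (@arg_maxP _ _ _ q0 (fun q => q \in Y) k q0Y) => q qY qmax.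
rewrite (cardsD1 q) qY addnC leq_add2r.
have := qY; rewrite inE => /andP[qX]; apply: leq_trans.
apply/subset_leq_card/fintype.subsetP => q' /setD1P[q'q q'Y].
have q'X : q' \in X by case/setIdP: q'Y.
have le : k q' <= k q := qmax _ q'Y.
rewrite inE q'X lt_neqAle le andbT.
by apply: contra q'q => /eqP /kinj->.
Qed.

Variables (m D : nat) (l0 : R * R -> R) (L : nat -> R * R -> R) (Q S : {set I}).
Hypotheses (fl0 : form 1 l0) (fL : forall j, form 1 (L j)).
Hypothesis QL : forall q, q \in Q -> exists2 j, (j < m)%N & L j (z q) = 0.
Local Notation Q2 := (Q :\: zeros l0).
Hypothesis SL : S \subset zeros l0.
Hypothesis few_lonely : forall p, p \in S ->
  (#|[set q in Q2 | [forall q' in Q2, (q' != q) ==> (q' \notin chord p q)]]| <= D)%N.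

Let al := l0 (1, 0) - l0 (0, 0).
Let be := l0 (0, 1) - l0 (0, 0).
Let ga := l0 (0, 0).
Let De := al ^+ 2 + be ^+ 2.
(** With [l0] this gives orthogonal coordinates; [w] runs along the line. *)
Let w (x : R * R) := - be * x.1 + al * x.2.

Lemma affine_val l : Pol 1 l -> forall x,
  l x = (l (1, 0) - l (0, 0)) * x.1 + (l (0, 1) - l (0, 0)) * x.2 + l (0, 0).
Proof. by move=> /Pol1P[a [b [c ->]]] x; rewrite /affine /=; ring. Qed.

Lemma l0E x : l0 x = al * x.1 + be * x.2 + ga.
Proof. exact: affine_val fl0.1 x. Qed.

Lemma sweep_det p : p \in zeros l0 -> De != 0.
Proof.
move=> /zerosP pl; apply/negP => /eqP /sqr_sum_eq0[a0 b0].
have g0 : ga = 0 by move: pl; rewrite l0E a0 b0; lra.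
by case: fl0 => _ [x]; rewrite l0E a0 b0 g0 !mul0r !addr0 eqxx.
Qed.

(** The inverse slope of the direction from [p] on [l0] to [q], finite for every [q] off [l0]. *)
Let slope p q := (w (z q) - w (z p)) / l0 (z q).

Lemma line_funE x y y' : De * line_fun x y y' =
  (l0 y - l0 x) * (w y' - w x) - (w y - w x) * (l0 y' - l0 x).
Proof. by rewrite !l0E /De /w /line_fun; ring. Qed.

Lemma slope_chord p q q' : p \in zeros l0 -> q \in Q2 -> q' \in Q2 ->
  q' \in chord p q -> slope p q' = slope p q.
Proof.
move=> pl /setDP[_ ql] /setDP[_ q'l]; rewrite inE => /eqP h.
move/zerosP: pl => pl.
rewrite inE in ql; rewrite inE in q'l.
have := line_funE (z p) (z q) (z q'); rewrite h mulr0 pl !subr0 => e.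
by apply/eqP; rewrite /slope eqr_div //; apply/eqP; lra.
Qed.

Lemma pt_coord x y : De != 0 -> l0 x = l0 y -> w x = w y -> x = y.
Proof.
case: x y => [x1 x2] [y1 y2] D0; rewrite !l0E /w /= => h1 h2.
have e1 : De * (x1 - y1) = 0.
  transitivity (al * ((al * x1 + be * x2 + ga) - (al * y1 + be * y2 + ga))
    - be * ((- be * x1 + al * x2) - (- be * y1 + al * y2))); first by rewrite /De; ring.
  by rewrite h1 h2; ring.
have e2 : De * (x2 - y2) = 0.
  transitivity (be * ((al * x1 + be * x2 + ga) - (al * y1 + be * y2 + ga))
    + al * ((- be * x1 + al * x2) - (- be * y1 + al * y2))); first by rewrite /De; ring.
  by rewrite h1 h2; ring.
move/eqP: e1; move/eqP: e2; rewrite !mulf_eq0 (negbTE D0) /= !subr_eq0.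
by move=> /eqP -> /eqP ->.
Qed.

(* On a line missing [p], the inverse of [l0] is an affine function of the slope
   seen from [p]; so slopes seen from two points are affinely related. *)
Lemma slope_line l p : Pol 1 l -> p \in zeros l0 -> l (z p) != 0 -> exists A B,
  forall q, q \in Q2 -> l (z q) = 0 -> (l0 (z q))^-1 * l (z p) = - (A + B * slope p q).
Proof.
move=> Pl pl lp; have D0 := sweep_det pl; move/zerosP: pl => pl.
pose a1 := l (1, 0) - l (0, 0); pose b1 := l (0, 1) - l (0, 0).
pose A := (a1 * al + b1 * be) / De; pose B := (b1 * al - a1 * be) / De.
have E x : l x = A * l0 x + B * w x + (l (0, 0) - A * ga).
  by rewrite (affine_val Pl) l0E /A /B /w -/a1 -/b1 /De; field; exact: D0.
exists A, B => q /setDP[_ ql] lq; rewrite inE in ql.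
have e1 := E (z p); rewrite pl mulr0 add0r in e1.
have e2 := E (z q); rewrite lq in e2.
have e3 : l (z p) = - (A * l0 (z q) + B * (w (z q) - w (z p))).
  by rewrite e1; lra.
by rewrite e3 /slope; field.
Qed.

Lemma slope_inj l p : Pol 1 l -> p \in zeros l0 -> l (z p) != 0 ->
  {in Q2 :&: zeros l &, injective (slope p)}.
Proof.
move=> Pl pl lp q q' /setIP[q2 /zerosP lq] /setIP[q'2 /zerosP lq'] e.
have [A [B h]] := slope_line Pl pl lp.
have e1 := h q q2 lq; have e2 := h q' q'2 lq'; rewrite e -e2 in e1.
have {e1} e1 : l0 (z q) = l0 (z q') by apply: invr_inj; apply: (mulIf lp).
apply/z_inj/(pt_coord (sweep_det pl) e1).
have {}q'2 : l0 (z q') != 0 by case/setDP: q'2 => _; rewrite inE.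
move/eqP: e; rewrite /slope e1 eqr_div // => /eqP /(mulIf q'2).
by move/eqP; rewrite -subr_eq0 opprB addrA subrK subr_eq0 => /eqP.
Qed.

Lemma slope_rel l p p' : Pol 1 l -> p \in zeros l0 -> p' \in zeros l0 ->
  l (z p) != 0 -> l (z p') != 0 -> exists rho tau, rho != 0 /\
  forall q, q \in Q2 :&: zeros l -> slope p' q = rho * slope p q + tau.
Proof.
move=> Pl pl p'l lp lp'; have D0 := sweep_det pl.
pose a1 := l (1, 0) - l (0, 0); pose b1 := l (0, 1) - l (0, 0).
pose A := (a1 * al + b1 * be) / De; pose B := (b1 * al - a1 * be) / De.
have E x : l x = A * l0 x + B * w x + (l (0, 0) - A * ga).
  by rewrite (affine_val Pl) l0E /A /B /w -/a1 -/b1 /De; field; exact: D0.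
exists (l (z p') / l (z p)), (- A * (w (z p) - w (z p')) / l (z p)).
split; first by rewrite mulf_neq0 // invr_eq0.
move=> q /setIP[/setDP[_ ql] /zerosP lq]; rewrite inE in ql.
move/zerosP: pl => pl; move/zerosP: p'l => p'l.
have e1 := E (z p); rewrite pl mulr0 add0r in e1.
have e1' := E (z p'); rewrite p'l mulr0 add0r in e1'.
have e2 := E (z q); rewrite lq in e2.
apply: (mulIf lp); apply: (mulIf ql); rewrite /slope.
transitivity ((w (z q) - w (z p')) * l (z p)); first by field.
transitivity (l (z p') * (w (z q) - w (z p)) - A * (w (z p) - w (z p')) * l0 (z q)); last by field; rewrite lp.
rewrite e1 e1'; have -> : A * (w (z p) - w (z p')) * l0 (z q) = (w (z p) - w (z p')) * (A * l0 (z q)) by ring.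
have -> : A * l0 (z q) = - (B * w (z q) + (l (0, 0) - A * ga)) by lra.
by ring.
Qed.

Let X j := Q2 :&: zeros (L j).

(** From any two centres the points on [L j] appear in the same or in reversed order. So the first
    [D + 1] of them seen from any centre are among the first or the last [D + 1] seen from one fixed
    [r]. *)
Lemma candidates j : exists F : {set I}, (#|F| <= 2 * (D + 1))%N /\
  forall p q, p \in zeros l0 -> L j (z p) != 0 -> q \in X j ->
    (#|[set q' in X j | (slope p q' < slope p q)%R]| <= D)%N -> q \in F.
Proof.
have [[r [rl Lr]]|no] := pselect (exists r, r \in zeros l0 /\ L j (z r) != 0); last first.
  exists finset.set0; rewrite cards0; split=> // p q pl Lp _ _.
  by case: no; exists p.
have inj := slope_inj (fL j).1 rl Lr.
exists ([set q in X j | (#|[set q' in X j | (slope r q' < slope r q)%R]| <= D)%N] :|: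
  [set q in X j | (#|[set q' in X j | (- slope r q' < - slope r q)%R]| <= D)%N]).
split.
  apply: leq_trans (leq_card_setU _ _) _; rewrite mul2n -addnn; apply: leq_add.
    exact: (card_low_rank (k := slope r)).
  apply: (card_low_rank (k := fun q => - slope r q)) => x y xX yX /oppr_inj.
  exact: inj.
move=> p q pl Lp qX low.
have [rho [tau [rho0 h]]] := slope_rel (fL j).1 rl pl Lr Lp.
rewrite !inE -!andb_orr; apply/andP; split; first by move: qX; rewrite !inE.
have [pos|neg] : 0 < rho \/ rho < 0 by case: (ltgtP rho 0) rho0 => //; [right|left].
  apply/orP; left; apply: leq_trans low; apply/subset_leq_card/fintype.subsetP => q'.
  by move=> /setIdP[q'X lt]; rewrite inE q'X !h // ltrD2r ltr_pM2l.
apply/orP; right; apply: leq_trans low; apply/subset_leq_card/fintype.subsetP => q'.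
by move=> /setIdP[q'X]; rewrite ltrN2 inE q'X !h // ltrD2r ltr_nM2l.
Qed.

Lemma zeros_chord p p' q : p \in zeros l0 -> p' \in zeros l0 -> p != p' ->
  p' \in chord q p -> q \in zeros l0.
Proof.
move=> pl p'l pp'; have D0 := sweep_det pl.
move/zerosP: pl => pl; move/zerosP: p'l => p'l; rewrite inE => /eqP h.
have := line_funE (z q) (z p) (z p'); rewrite h mulr0 pl p'l !sub0r => e.
apply/zerosP; apply/eqP; move: pp'; apply: contraNT => ql.
apply/eqP/z_inj/(pt_coord D0); first by rewrite pl p'l.
by apply: (mulfI ql); lra.
Qed.

Lemma chordC p q : chord p q = chord q p.
Proof.
apply/setP => r; rewrite !inE /line_fun; apply/eqP/eqP => h.
  by rewrite -[RHS]oppr0 -h; ring.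
by rewrite -[RHS]oppr0 -h; ring.
Qed.

Lemma chord_l p q : p \in chord p q.
Proof. by rewrite inE line_fun_l. Qed.

Lemma chord_r p q : q \in chord p q.
Proof. by rewrite inE line_fun_r. Qed.

Lemma chord_rot p q r : r \in chord p q -> p \in chord q r.
Proof. by rewrite !inE /line_fun => /eqP h; apply/eqP; rewrite -[RHS]h; ring. Qed.

(* Sweep a line around [p]: the first event that is not lonely occurs among the
   first few points of two of the lines [L j], in an order independent of [p]. *)
Lemma sweep_bound : (D < #|Q2|)%N -> (#|S| <= m + (m * (2 * (D + 1))) ^ 2)%N.
Proof.
move=> DQ; have /choice[F FP] := candidates.
pose FF := \bigcup_(j in [set: 'I_m]) F j.
have cF : (#|FF| <= m * (2 * (D + 1)))%N.
  apply: leq_trans (card_bigcup_le _ _) _.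
  rewrite -[X in (_ <= X * _)%N](card_ord m) -cardsT -sum_nat_const.
  by apply: leq_sum => j _; case: (FP j).
(* A line [L j] with a point of [Q] off [l0] differs from [l0] and so contains at most one centre;
   these centres are set aside. *)
pose N := \bigcup_(j in [set: 'I_m]) [set p in S | (X j != finset.set0) && (L j (z p) == 0)].
have cN : (#|N| <= m)%N.
  apply: leq_trans (card_bigcup_le _ _) _.
  rewrite -[leqRHS](card_ord m) -cardsT -sum1_card; apply: leq_sum => j _.
  rewrite leqNgt; apply/negP => /card_gt1P[p [p' [/setIdP[pS /andP[X0 /eqP Lp]] /setIdP[p'S /andP[_ /eqP Lp']] pp']]].
  have /set0Pn[q /setIP[/setDP[_ /negP ql] /zerosP Lq]] := X0; apply: ql.
  have pl := fintype.subsetP SL _ pS; have p'l := fintype.subsetP SL _ p'S.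
  apply: (zeros_chord pl p'l pp'); rewrite inE; apply/eqP.
  exact: (form_collinear (fL j)).
rewrite -(cardsID N); apply: leq_add.
  by apply: leq_trans (subset_leq_card _) cN; apply: finset.subsetIr.
apply: leq_trans (_ : #|finset.setX FF FF| <= _)%N; last first.
  by rewrite cardsX expnS expn1 leq_mul.
(* A centre is recovered as the point where the chord of the two candidates meets [l0]. *)
apply: (@card_le_rel _ _ _ _ (fun p u => [/\ p \in zeros l0, p \in chord u.1 u.2,
    u.1 != u.2 & u.1 \in Q2])); last first.
  move=> p p' [q q'] _ _ /= [pl pj qq' q2] [p'l p'j _ _].
  apply/eqP/negPn/negP => pp'; have /setDP[_ /negP ql] := q2; apply: ql.
  apply: (zeros_chord pl p'l pp'); move: pj p'j; rewrite !inE => /eqP h1 /eqP h2.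
  by apply/eqP; apply: line_fun_trans h1 h2; rewrite (inj_eq z_inj).
move=> p /setDP[pS pN]; have pl := fintype.subsetP SL _ pS.
set lone := [set q in Q2 | [forall q' in Q2, (q' != q) ==> (q' \notin chord p q)]].
have hlone : (#|lone| <= D)%N := few_lonely pS.
have [q0 q0P] : exists q, q \in Q2 :\: lone.
  have : (0 < #|Q2 :\: lone|)%N.
    have := subset_leq_card (finset.subsetIr Q2 lone); rewrite -(cardsID lone Q2) in DQ.
    by move: DQ hlone; lia.
  by case/card_gt0P => q h; exists q.
case: (@arg_minP _ _ _ q0 (fun q => q \in Q2 :\: lone) (slope p) q0P) => q qP qmin.
have /setDP[q2 qlone] := qP.
have [q' [q'2 q'q jqq']] : exists q', [/\ q' \in Q2, q' != q & q' \in chord p q].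
  move: qlone; rewrite inE q2 /= negb_forall => /existsP[q'].
  rewrite !negb_imply => /and4P[h1 h2 h3 _]; by exists q'.
have sl : slope p q' = slope p q by apply: slope_chord.
have inF x : x \in Q2 -> slope p x = slope p q -> x \in FF.
  move=> x2 sx; have [j jm Lx] := QL (fintype.subsetP (finset.subsetDl _ _) _ x2).
  have xX : x \in X j by apply/setIP; split=> //; apply/zerosP.
  apply/bigcupP; exists (Ordinal jm); rewrite ?finset.in_setT //; apply: ((FP j).2 p x pl _ xX).
    apply/negP => Lp; case/negP: pN; apply/bigcupP; exists (Ordinal jm); rewrite ?finset.in_setT //.
    by rewrite inE pS /= Lp andbT; apply/finset.set0Pn; exists x.
  (* By minimality of [q] all points with smaller slope are lonely, so there are at most [D] of
     them. *)
  apply: leq_trans hlone; apply/subset_leq_card/fintype.subsetP => y /setIdP[yX lt].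
  have y2 : y \in Q2 by case/setIP: yX.
  apply/negPn/negP => ny; move: lt; apply/negP; rewrite -leNgt sx.
  by apply: qmin; apply/setDP.
exists (q, q'); first by apply/setXP; split; apply: inF.
split=> //=; last by rewrite eq_sym.
exact: chord_rot.
Qed.

End Sweep.

(** * Point sets covered by lines and conics *)

Section Covers.
Variables (R : realFieldType) (I : finType) (z : I -> R * R).
Hypothesis z_inj : injective z.
Implicit Types (p q r x y : I) (l f g : R * R -> R) (A B : {set I}).
Local Notation zeros := (zeros z).
Local Notation chord := (chord z).

Lemma form_one d : form d (fun _ : R * R => 1 : R).
Proof. by split; [apply: Pol_cst|exists (0, 0); apply: oner_neq0]. Qed.

(** Nonzero constants are forms of every degree and have no zeros, so they may fill up the lists. *)
Definition cov m c A : Prop := exists (l k : nat -> R * R -> R),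
  [/\ forall i, form 1 (l i), forall i, form 2 (k i) & forall p, p \in A ->
    (exists2 i, (i < m)%N & l i (z p) = 0) \/ (exists2 i, (i < c)%N & k i (z p) = 0)].

Lemma cov_sub m c A B : A \subset B -> cov m c B -> cov m c A.
Proof.
move=> /fintype.subsetP AB [l [k [fl fk h]]]; exists l, k; split=> // p /AB; exact: h.
Qed.

Lemma cov_le m c m' c' A : (m <= m')%N -> (c <= c')%N -> cov m c A -> cov m' c' A.
Proof.
move=> mm cc [l [k [fl fk h]]]; exists l, k; split=> // p /h[] [i im e]; [left|right];
  exists i => //; exact: leq_trans im _.
Qed.

Lemma cov_U m c m' c' A B : cov m c A -> cov m' c' B -> cov (m + m') (c + c') (A :|: B).
Proof.
move=> [l [k [fl fk h]]] [l' [k' [fl' fk' h']]].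
exists (fun i => if (i < m)%N then l i else l' (i - m)%N),
  (fun i => if (i < c)%N then k i else k' (i - c)%N); split=> [i|i|p].
- by case: ifP.
- by case: ifP.
case/finset.setUP => [/h|/h'] [] [i im e].
- by left; exists i; [lia|rewrite im].
- by right; exists i; [lia|rewrite im].
- by left; exists (m + i)%N; [lia|rewrite ltnNge leq_addr addKn].
- by right; exists (c + i)%N; [lia|rewrite ltnNge leq_addr addKn].
Qed.

Lemma cov_0 m c : cov m c finset.set0.
Proof.
exists (fun _ _ => 1), (fun _ _ => 1); split=> [i|i|p]; try exact: form_one.
by rewrite inE.
Qed.

Lemma cov_bigU K m c (A : nat -> {set I}) B : (forall k, (k < K)%N -> cov m c (A k)) ->
  (forall p, p \in B -> exists2 k, (k < K)%N & p \in A k) -> cov (K * m) (K * c) B.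
Proof.
elim: K B => [|K IH] B hA hB.
  apply: (cov_sub _ (cov_0 _ _)); apply/fintype.subsetP => p /hB[k]; lia.
have h : cov (K * m) (K * c) (B :\: A K).
  apply: IH => [k kK|p /setDP[/hB[k kK pk] pA]]; first by apply: hA; lia.
  exists k => //; move: kK; rewrite ltnS leq_eqVlt => /orP[/eqP e|//].
  by rewrite -e pk in pA.
rewrite !mulSn; apply: cov_sub (cov_U (hA K (leqnn _)) h).
by apply/fintype.subsetP => p pB; rewrite !inE pB andbT orbN.
Qed.

Lemma cov_zeros1 l : form 1 l -> cov 1 0 (zeros l).
Proof.
move=> fl; exists (fun=> l), (fun _ _ => 1); split=> // [i|p /zerosP h]; first exact: form_one.
by left; exists 0%N.
Qed.

Lemma cov_zeros2 l : form 2 l -> cov 0 1 (zeros l).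
Proof.
move=> fl; exists (fun _ _ => 1), (fun=> l); split=> // [i|p /zerosP h]; first exact: form_one.
by right; exists 0%N.
Qed.

Lemma line_at p : exists2 l, form 1 l & l (z p) = 0.
Proof.
exists (line_fun (z p) ((z p).1 + 1, (z p).2)); last exact: line_fun_l.
by apply: form_line; case: (z p) => u v; rewrite xpair_eqE negb_and /= -subr_eq0 opprD addNKr oppr_eq0 oner_eq0.
Qed.

Lemma cov_point p : cov 1 0 [set p].
Proof.
have [l fl lp] := line_at p; apply: cov_sub (cov_zeros1 fl).
by apply/fintype.subsetP => q /set1P->; apply/zerosP.
Qed.

Lemma cov_card A : cov #|A| 0 A.
Proof.
have -> : #|A| = (#|A| * 1)%N by rewrite muln1.
rewrite -[X in cov _ X](muln0 #|A|) => //.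
have [->|[p0 _]] := set_0Vmem A; first by rewrite cards0; apply: cov_0.
apply: (@cov_bigU _ _ _ (fun k => [set nth p0 (enum A) k])) => [k _|p pA].
  exact: cov_point.
exists (index p (enum A)); first by rewrite cardE index_mem mem_enum.
by rewrite inE nth_index // mem_enum.
Qed.

Lemma chordP p q r : reflect (line_fun (z p) (z q) (z r) = 0) (r \in chord p q).
Proof. by rewrite inE; apply: eqP. Qed.

Lemma chord_eq p q r : p != q -> r != p -> r \in chord p q -> chord p r = chord p q.
Proof.
move=> pq rp /chordP h; have zpq : z p != z q by rewrite (inj_eq z_inj).
apply/setP => s; apply/chordP/chordP => hs; last exact: line_fun_trans h hs.
apply: (line_fun_trans (y := z r)) => //; first by rewrite (inj_eq z_inj) eq_sym.
by move: h; rewrite /line_fun => h; rewrite -[RHS]oppr0 -h; ring.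
Qed.

Lemma cov_blocks p (E : {set {set I}}) :
  cov #|E| 0 [set q | (q != p) && (chord p q \in E)].
Proof.
have -> : #|E| = (#|E| * 1)%N by rewrite muln1.
rewrite -[X in cov _ X](muln0 #|E|).
apply: (@cov_bigU _ _ _ (fun k => [set q | (q != p) && (chord p q == nth finset.set0 (enum E) k)])).
  move=> k _; set A := [set q | _].
  have [->|[q0]] := set_0Vmem A; first exact: cov_0.
  rewrite inE => /andP[q0p /eqP e].
  have fl : form 1 (line_fun (z p) (z q0)) by apply: form_line; rewrite (inj_eq z_inj) eq_sym.
  apply: cov_sub (cov_zeros1 fl); apply/fintype.subsetP => q; rewrite inE => /andP[_ /eqP e'].
  by have := chord_r z p q; rewrite e' -e => /chordP h; apply/zerosP.
move=> q; rewrite inE => /andP[qp qE]; exists (index (chord p q) (enum E)).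
  by rewrite cardE index_mem mem_enum.
by rewrite inE qp nth_index ?eqxx ?mem_enum.
Qed.

Lemma form_line_zeros d f l : form d.+1 f -> form 1 l ->
  (#|zeros f :&: zeros l| <= d.+1)%N \/ exists2 g, form d g & forall u, f u = l u * g u.
Proof.
move=> [Pf nf] [Pl nl]; have [le|lt] := leqP #|zeros f :&: zeros l| d.+1; [by left|right].
pose s := [seq z p | p <- take d.+2 (enum (zeros f :&: zeros l))].
have [||u /mapP[p /mem_take]|g Pg e] := @line_factor R d f l s Pl nl Pf.
- by rewrite map_inj_uniq // take_uniq // enum_uniq.
- by rewrite size_map size_takel // -cardE.
- by rewrite mem_enum => /setIP[/zerosP fp /zerosP lp] ->.
by exists g => //; split=> //; apply: nzMr e.
Qed.

Lemma cov_mul l (q : R * R -> R) f : form 1 l -> form 2 q -> (forall u, f u = l u * q u) ->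
  cov 1 1 (zeros f).
Proof.
move=> fl fq e; apply: cov_sub (cov_U (cov_zeros1 fl) (cov_zeros2 fq)).
apply/fintype.subsetP => p /zerosP/eqP; rewrite e mulf_eq0 => /orP[]/eqP h; apply/finset.setUP;
  [left|right]; exact/zerosP.
Qed.

(** * Intersections with a cubic not covered by a line and a conic *)

Section CubicPart.
Variables (f : R * R -> R).
Hypotheses (ff : form 3 f) (fcov : ~ cov 1 1 (zeros f)).

Lemma cubic_line_card l : form 1 l -> (#|zeros f :&: zeros l| <= 3)%N.
Proof.
move=> fl; have [//|[q fq e]] := form_line_zeros ff fl.
by case: fcov; apply: cov_mul fl fq e.
Qed.

(** The common zeros lie on three lines, with at most three points of the cubic on each. *)
Lemma cubic_conic_card (q : R * R -> R) : form 2 q -> (#|zeros f :&: zeros q| <= 9)%N.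
Proof.
move=> fq; have [[l fl e]|[l1 [l2 [l3 [f1 f2 f3 h]]]]] := conic_cubic fq ff.
  by case: fcov; apply: cov_mul fl fq e.
have sub : zeros f :&: zeros q \subset (zeros f :&: zeros l1) :|: (zeros f :&: zeros l2)
    :|: (zeros f :&: zeros l3).
  apply/fintype.subsetP => p /setIP[/zerosP fp /zerosP qp].
  by rewrite !inE fp eqxx /=; case: (h _ qp fp) => ->; rewrite eqxx ?orbT.
apply: leq_trans (subset_leq_card sub) _.
apply: leq_trans (leq_card_setU _ _) _; apply: (@leq_add _ _ 6 3); last exact: cubic_line_card.
by apply: leq_trans (leq_card_setU _ _) _; apply: (@leq_add _ _ 3 3); apply: cubic_line_card.
Qed.

(** The common zeros lie on two lines and a conic: [3 + 3 + 9]. *)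
Lemma cubic_cubic_card g : form 3 g -> (exists2 c, c != 0 & forall u, f u = c * g u) \/
  (#|zeros f :&: zeros g| <= 15)%N.
Proof.
move=> fg; have [|[l1 [l2 [q [f1 f2 fq h]]]]] := cubic_cubic ff fg; [by left|right].
have sub : zeros f :&: zeros g \subset (zeros f :&: zeros l1) :|: (zeros f :&: zeros l2)
    :|: (zeros f :&: zeros q).
  apply/fintype.subsetP => p /setIP[/zerosP fp /zerosP qp].
  by rewrite !inE fp eqxx /=; case: (h _ fp qp) => ->; rewrite eqxx ?orbT.
apply: leq_trans (subset_leq_card sub) _.
apply: leq_trans (leq_card_setU _ _) _; apply: (@leq_add _ _ 6 9); last exact: cubic_conic_card.
by apply: leq_trans (leq_card_setU _ _) _; apply: (@leq_add _ _ 3 3); apply: cubic_line_card.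
Qed.

End CubicPart.

Lemma conic_line_card (q : R * R -> R) l : form 2 q -> ~ cov 2 0 (zeros q) -> form 1 l ->
  (#|zeros q :&: zeros l| <= 2)%N.
Proof.
move=> fq nc fl; have [//|[l' fl' e]] := form_line_zeros fq fl.
case: nc; apply: cov_sub (cov_U (cov_zeros1 fl) (cov_zeros1 fl')).
apply/fintype.subsetP => p /zerosP/eqP; rewrite e mulf_eq0 => /orP[]/eqP h; apply/finset.setUP;
  [left|right]; exact/zerosP.
Qed.

End Covers.

Lemma card_pairs (T U : finType) (A : {set T}) (B : T -> {set U}) :
  #|[set u : T * U | (u.1 \in A) && (u.2 \in B u.1)]| = (\sum_(x in A) #|B x|)%N.
Proof.
transitivity (\sum_(x in A) \sum_(y in B x) 1)%N.
  by rewrite pair_big_dep /= -sum1_card; apply: eq_bigl => u; rewrite inE.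
by apply: eq_bigr => x _; rewrite sum1_card.
Qed.

Lemma card3_third (T : finType) (A : {set T}) p x q q' : #|A| = 3%N ->
  p \in A -> x \in A -> q \in A -> q' \in A -> p != x -> q != p -> q != x ->
  q' != p -> q' != x -> q = q'.
Proof.
move=> A3 pA xA qA q'A px qp qx q'p q'x; apply/eqP/negPn/negP => qq'.
have : [set p; x; q; q'] \subset A.
  by apply/fintype.subsetP => y; rewrite !inE => /orP[/orP[/orP[]|]|] /eqP->.
move/subset_leq_card; rewrite A3 -!finset.setUA !cardsU1 cards1 !inE !negb_or px.
by rewrite (eq_sym p q) qp (eq_sym p) q'p (eq_sym x q) qx (eq_sym x) q'x qq'.
Qed.

Section Lonely.
Variables (R : realFieldType) (I : finType) (z : I -> R * R).
Implicit Types (p q : I) (Q : {set I}).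
Local Notation chord := (chord z).

Lemma chord_third p q : #|chord p q| = 3%N -> p != q -> exists x,
  [/\ x \in chord p q, x != p, x != q & chord p q = [set p; q; x]].
Proof.
move=> c3 pq.
have : (0 < #|chord p q :\ p :\ q|)%N.
  have := cardsD1 p (chord p q); have := cardsD1 q (chord p q :\ p).
  by rewrite c3 chord_l finset.in_setD1 chord_r (eq_sym q) pq; lia.
case/card_gt0P => x; rewrite !inE => /and3P[xq xp xT].
have xT' : x \in chord p q by rewrite inE.
exists x; split=> //; apply/setP => y; rewrite [in RHS]inE !finset.in_set1 in_set2.
apply/idP/idP => [yT|/orP[/orP[]|] /eqP-> //]; last 2 first.
- exact: chord_l.
- exact: chord_r.
have [//|yp] := eqVneq y p; have [//|yq] := eqVneq y q.
by rewrite (card3_third c3 (chord_l _ _ _) (chord_r _ _ _) yT xT') ?eqxx.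
Qed.

Definition lonely Q p :=
  [set q in Q | [forall q' in Q, (q' != q) ==> (q' \notin chord p q)]].

Lemma lonelyP Q p q : q \in lonely Q p ->
  q \in Q /\ forall q', q' \in Q -> q' != q -> q' \notin chord p q.
Proof.
move=> /setIdP[qQ /forall_inP h]; split=> // q' q'Q q'q.
by have /implyP := h q' q'Q; apply.
Qed.

Lemma not_lonelyP Q p q : q \in Q -> q \notin lonely Q p ->
  exists q', [/\ q' \in Q, q' != q & q' \in chord p q].
Proof.
move=> qQ; rewrite inE qQ /= negb_forall => /existsP[q'].
by rewrite !negb_imply => /and4P[h1 h2 h3 _]; exists q'.
Qed.

Lemma lonely_blocks Q p (E : {set {set I}}) :
  (#|[set q in lonely Q p | chord p q \in E]| <= #|E|)%N.
Proof.
apply: (@card_le_rel _ _ _ _ (fun q T => T = chord p q)).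
  by move=> q /setIdP[_ qE]; exists (chord p q).
move=> q q' T /setIdP[/lonelyP[qQ h] _] /setIdP[/lonelyP[q'Q _] _] -> e.
apply/eqP/negPn/negP => ne; have := h q' q'Q; rewrite eq_sym => /(_ ne) /negP; apply.
by rewrite e chord_r.
Qed.

End Lonely.

(** * A cubic that few lines and conics do not cover *)

Section Endgame.
Variables (R : realFieldType) (I : finType) (z : I -> R * R).
Hypothesis z_inj : injective z.
Variables (d : I -> nat) (M : nat).
Hypothesis M_gt0 : (0 < M)%N.
Hypothesis sum_d : (\sum_p d p <= M * #|I|)%N.
Hypothesis pencil : forall p, exists (f : nat -> R * R -> R) (E : {set {set I}}),
  [/\ forall k, form 3 (f k) /\ f k (z p) = 0, (#|E| <= d p)%N &
      forall q, q != p -> chord z p q \in E \/ (#|chord z p q| = 3%N /\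
        exists2 k, (k < d p)%N & forall r, r \in chord z p q -> f k (z r) = 0)].
Implicit Types (p q r x y : I) (l f g : R * R -> R) (A B : {set I}).
Local Notation zeros := (zeros z).
Local Notation chord := (chord z).
Local Notation lonely := (lonely z).
Local Notation cov := (cov z).
Local Notation n := #|I|.

(** Markov's inequality. *)
Lemma atypical_card T : (#|[set p | (T < d p)%N]| * T <= M * n)%N.
Proof.
apply: leq_trans sum_d; rewrite -sum_nat_const [leqRHS](bigID (fun p => T < d p)%N) /=.
apply: leq_trans (leq_addr _ _).
rewrite (eq_bigl (fun p => T < d p)%N) => [|p]; last by rewrite inE.
by apply: leq_sum => p /ltnW.
Qed.

Section CubicCase.
Variable f : R * R -> R.
Let D := (100 * M)%N.
Hypotheses (ff : form 3 f) (fcov : ~ cov (3 * D) D (zeros f)).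

Lemma cubic_ncov : ~ cov 1 1 (zeros f).
Proof. by move=> h; apply: fcov; apply: cov_le h; rewrite /D; lia. Qed.

(** If [f] missed [p], no cubic through [p] would be a multiple of [f], and each would share with
    [f] only points of two lines and a conic. Adding the lines in [E], at most [3 d p] lines and
    [d p] conics would cover [f]. *)
Lemma typical_on_cubic p : (d p <= D)%N -> p \in zeros f.
Proof.
move=> dp; apply/negPn/negP => /zerosP pf; apply: fcov.
have [g [E [fg cE h]]] := pencil p.
pose B2 := [set q | (q != p) && (chord p q \in E)].
have c1 : cov (d p * 2) (d p * 1) (zeros f :\: B2).
  apply: (@cov_bigU _ _ _ _ _ _ (fun k => zeros f :&: zeros (g k))).
    move=> k _; have [fk gp] := fg k.
    have [[c c0 e]|[l1 [l2 [q [f1 f2 fq hq]]]]] := cubic_cubic ff fk.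
      by case: pf; rewrite e gp mulr0.
    apply: cov_sub (cov_U (cov_U (cov_zeros1 z f1) (cov_zeros1 z f2)) (cov_zeros2 z fq)).
    apply/fintype.subsetP => x /setIP[/zerosP fx /zerosP gx]; rewrite !inE.
    by case: (hq _ fx gx) => ->; rewrite eqxx ?orbT.
  move=> q /setDP[fq qB]; have qp : q != p.
    by apply: contraNneq qB => e; case: pf; rewrite -e; move/zerosP: fq.
  have [qE|[_ [k kd hk]]] := h q qp; first by rewrite inE qp qE in qB.
  by exists k => //; apply/setIP; split=> //; apply/zerosP/hk/chord_r.
have c2 := cov_blocks z_inj p E.
apply: (cov_le _ _ (cov_sub _ (cov_U c1 c2))); [lia|lia|].
by apply/fintype.subsetP => q fq; rewrite finset.in_setU finset.in_setD fq andbT orNb.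
Qed.

(** If [q] is lonely and [p q] is not in [E], its third point lies on [f] and on a cubic of the
    pencil not proportional to [f], since that cubic contains [q]. Each cubic allows 15 such points,
    and the third point determines [q]. *)
Lemma cubic_lonely p : (d p <= D)%N -> (#|lonely (~: zeros f) p| <= 16 * d p)%N.
Proof.
move=> dp; have pf := typical_on_cubic dp.
have [g [E [fg cE h]]] := pencil p.
pose S2 := [set q in lonely (~: zeros f) p | chord p q \notin E].
pose U (k : 'I_(d p)) := if (#|zeros f :&: zeros (g k)| <= 15)%N then zeros f :&: zeros (g k)
  else finset.set0.
have c1 := lonely_blocks z (~: zeros f) p E.
have c2 : (#|S2| <= 15 * d p)%N.
  apply: (@leq_trans #|\bigcup_(k in [set: 'I_(d p)]) U k|); last first.
    apply: leq_trans (card_bigcup_le _ _) _.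
    rewrite mulnC -[X in (_ <= X * _)%N](card_ord (d p)) -cardsT -sum_nat_const.
    by apply: leq_sum => k _; rewrite /U; case: ifP => // _; rewrite cards0.
  apply: (@card_le_rel _ _ _ _ (fun q x =>
    [/\ #|chord p q| = 3%N, x \in chord p q, x != p & x != q])).
    move=> q /setIdP[/lonelyP[qf lq] qE]; rewrite finset.in_setC in qf.
    have qp : q != p by apply: contraNneq qf => ->.
    have [qE'|[c3 [k kd hk]]] := h q qp; first by rewrite qE' in qE.
    have [|x [xT xp xq _]] := chord_third c3 _; first by rewrite eq_sym.
    exists x => //; apply/bigcupP; exists (Ordinal kd); first exact: finset.in_setT.
    have fx : x \in zeros f.
      by apply/negPn/negP => xf; have := lq x; rewrite finset.in_setC xf => /(_ isT xq) /negP.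
    rewrite /U /=; have [[c c0 e]|le] := cubic_cubic_card z_inj ff cubic_ncov (fg k).1.
      case/negP: qf; apply/zerosP; rewrite e hk ?mulr0 //; exact: chord_r.
    by rewrite le; apply/setIP; split=> //; apply/zerosP/hk.
  move=> q q' x /setIdP[/lonelyP[qf _] _] /setIdP[/lonelyP[q'f _] _].
  move=> [c3 xT xp xq] [c3' xT' _ xq']; rewrite finset.in_setC in qf; rewrite finset.in_setC in q'f.
  have qp : q != p by apply: contraNneq qf => ->.
  have q'p : q' != p by apply: contraNneq q'f => ->.
  have pq : p != q by rewrite eq_sym.
  have pq' : p != q' by rewrite eq_sym.
  have e : chord p q = chord p q'.
    by rewrite -(chord_eq z_inj pq xp xT) (chord_eq z_inj pq' xp xT').
  apply: (card3_third c3 (chord_l _ _ _) xT (chord_r _ _ _)) => //.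
  - by rewrite e chord_r.
  - by rewrite eq_sym.
  - by rewrite eq_sym.
  - by rewrite eq_sym.
rewrite -(cardsID [set q | chord p q \in E]) mulSn; apply: leq_add.
  apply: leq_trans cE; apply: leq_trans c1; apply/subset_leq_card/fintype.subsetP => q.
  by move=> /setIP[h1]; rewrite inE => h2; apply/setIdP.
apply: leq_trans c2; apply/subset_leq_card/fintype.subsetP => q.
by move=> /setDP[h1]; rewrite inE => h2; apply/setIdP.
Qed.

(** Count pairs of a typical [p] and a [q] in [Q] not lonely from [p]. There are at most [3 |Q|^2],
    since [p] lies on [f] and on a chord of two points of [Q]. If [|Q| > 20 D] there are at least a
    fifth of [|Typ| |Q|], too many as [99 |Q| <= |Typ|]. *)
Lemma cubic_case : (#|~: zeros f| <= 20 * D)%N.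
Proof.
set Q := ~: zeros f; pose Typ := [set p | (d p <= D)%N].
have atyp := atypical_card D.
have D0 : (0 < D)%N by rewrite /D; lia.
have TypC : (#|Typ| + #|[set p | (D < d p)%N]| = n)%N.
  by rewrite -(cardsC Typ); congr addn; apply: eq_card => p; rewrite !inE ltnNge.
have Qle : (#|Q| <= #|[set p | (D < d p)%N]|)%N.
  apply/subset_leq_card/fintype.subsetP => q; rewrite /Q finset.in_setC => qf; rewrite inE ltnNge.
  by apply: contra qf; apply: typical_on_cubic.
pose PQ := [set u : I * I | (u.1 \in Typ) && (u.2 \in Q :\: lonely Q u.1)].
have low : (#|Typ| * (#|Q| - 16 * D) <= #|PQ|)%N.
  rewrite [leqRHS](card_pairs Typ (fun p => Q :\: lonely Q p)) -sum_nat_const.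
  apply: leq_sum => p; rewrite inE => dp.
  have := cubic_lonely dp; rewrite -/Q; have := cardsID (lonely Q p) Q.
  have : (#|Q :&: lonely Q p| <= #|lonely Q p|)%N.
    by apply/subset_leq_card/finset.subsetIr.
  have : (16 * d p <= 16 * D)%N by rewrite leq_mul2l dp.
  set u1 := #|Q :&: _|; set u2 := #|lonely _ _|; set u3 := #|_ :\: _|; set u4 := #|Q|; lia.
have up : (#|PQ| <= 3 * (#|Q| * #|Q|))%N.
  rewrite -cardsX mulnC -sum_nat_const.
  pose W (v : I * I) := if v.1 == v.2 then finset.set0 else
    [set (p, v.1) | p in zeros f :&: chord v.1 v.2].
  apply: leq_trans (_ : #|\bigcup_(v in finset.setX Q Q) W v| <= _)%N.
    apply/subset_leq_card/fintype.subsetP => -[p q].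
    move=> /[1!inE]/= /andP[] /[1!inE] dp /setDP[qQ ql].
    have [q' [q'Q q'q q'c]] := not_lonelyP qQ ql.
    apply/bigcupP; exists (q, q'); first exact/setXP.
    rewrite /W /= eq_sym (negbTE q'q); apply/imsetP; exists p => //; apply/setIP; split.
      exact: typical_on_cubic.
    exact: chord_rot.
  apply: leq_trans (card_bigcup_le _ _) _; apply: leq_sum => -[q q'] _.
  rewrite /W /=; case: eqVneq => [_|ne]; first by rewrite cards0.
  apply: leq_trans (leq_imset_card _ _) _.
  apply: (cubic_line_card z_inj ff cubic_ncov).
  by apply: form_line; rewrite (inj_eq z_inj).
move: atyp TypC Qle (leq_trans low up).
set ty := #|Typ|; set at_ := #|[set p | _]|; set k := #|Q| => h1 h2 h3 h4.
rewrite leqNgt; apply/negP => kD.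
have h5 : (at_ * 100 <= n)%N.
  rewrite -(leq_pmul2l M_gt0); apply: leq_trans h1; rewrite /D; nia.
have h6 : (99 * k <= ty)%N by lia.
have h7 : (k <= 5 * (k - 16 * D))%N by lia.
have h8 : (99 * k * (k - 16 * D) <= 3 * (k * k))%N.
  by apply: leq_trans h4; rewrite leq_mul2r h6 orbT.
nia.
Qed.

End CubicCase.

End Endgame.

(** * Lines from a point off a conic *)

Section Conic.
Variables (R : realFieldType) (I : finType) (z : I -> R * R).
Hypothesis z_inj : injective z.
Variable d : I -> nat.
Hypothesis pencil : forall p, exists (f : nat -> R * R -> R) (E : {set {set I}}),
  [/\ forall k, form 3 (f k) /\ f k (z p) = 0, (#|E| <= d p)%N &
      forall q, q != p -> chord z p q \in E \/ (#|chord z p q| = 3%N /\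
        exists2 k, (k < d p)%N & forall r, r \in chord z p q -> f k (z r) = 0)].
Implicit Types (p r x y w : I) (l f g : R * R -> R) (A B : {set I}).
Local Notation zeros := (zeros z).
Local Notation chord := (chord z).
Local Notation cov := (cov z).
Local Notation n := #|I|.

Lemma chord_zeros l p r x : form 1 l -> p != r -> p \in zeros l -> r \in zeros l ->
  x \in chord p r -> x \in zeros l.
Proof.
move=> [Pl _] pr /zerosP pl /zerosP rl /chordP h; apply/zerosP.
by apply: form_on_line Pl _ pl rl h; rewrite (inj_eq z_inj).
Qed.

Variable q : R * R -> R.
Hypotheses (fq : form 2 q) (qcov : ~ cov 2 0 (zeros q)).

Lemma conic_chord p r : p != r -> (#|zeros q :&: chord p r| <= 2)%N.
Proof.
move=> pr; apply: (conic_line_card z_inj fq qcov); apply: form_line.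
by rewrite (inj_eq z_inj).
Qed.

Lemma conic_chord_eq x y w : x != y -> x \in zeros q -> y \in zeros q -> w \in zeros q ->
  w \in chord x y -> w != x -> w = y.
Proof.
move=> xy xq yq wq wc wx; apply/eqP/negPn/negP => wy.
have : [set x; y; w] \subset zeros q :&: chord x y.
  apply/fintype.subsetP => u; rewrite !finset.in_setU !finset.in_set1.
  case/orP => [/orP[]|] /eqP->; apply/finset.setIP; split=> //.
    exact: chord_l.
  exact: chord_r.
move/subset_leq_card => h; have := leq_trans h (conic_chord xy).
by rewrite -finset.setUA cardsU1 cards2 in_set2 negb_or xy eq_sym wx eq_sym wy.
Qed.

Definition paired p x := [exists y, (y \in zeros q) && (y != x) && (chord p x == [set p; x; y])].

Definition unpaired p := [set x in zeros q | ~~ paired p x].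

Lemma pairedP p x : x \in zeros q -> x \notin unpaired p ->
  exists y, [/\ y \in zeros q, y != x & chord p x = [set p; x; y]].
Proof.
move=> xq; rewrite inE xq negbK => /existsP[y /andP[/andP[h1 h2] /eqP h3]].
by exists y.
Qed.

(** A line in [E] has at most two points of the conic, and a cubic not divisible by [q] at most six.
    If the cubic is [l q], then [l] contains [p], and an unpaired point lies on [l]: otherwise the
    third point of its line would be on the conic. *)
Lemma card_unpaired p : p \notin zeros q -> (#|unpaired p| <= 8 * d p)%N.
Proof.
move=> pq; have [g [E [fg cE h]]] := pencil p.
have px x : x \in zeros q -> p != x by move=> xq; apply: contraNneq pq => ->.
pose UE := \bigcup_(T in E) (zeros q :&: [set x | chord p x == T]).
pose U (k : 'I_(d p)) :=
  [set x in unpaired p | (#|chord p x| == 3%N) && (chord p x \subset zeros (g k))].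
have sub : unpaired p \subset UE :|: \bigcup_(k in [set: 'I_(d p)]) U k.
  apply/fintype.subsetP => x xu; have /setIdP[xq _] := xu.
  have xp : x != p by rewrite eq_sym px.
  apply/finset.setUP; have [xE|[c3 [k kd hk]]] := h x xp.
    by left; apply/bigcupP; exists (chord p x) => //; apply/finset.setIP; rewrite inE.
  right; apply/bigcupP; exists (Ordinal kd); first exact: finset.in_setT.
  rewrite inE xu c3 eqxx /=; apply/fintype.subsetP => r /hk e; exact/zerosP.
apply: leq_trans (subset_leq_card sub) _; apply: leq_trans (leq_card_setU _ _) _.
rewrite (_ : 8 = 2 + 6)%N // mulnDl; apply: leq_add.
  apply: leq_trans (card_bigcup_le _ _) _; apply: leq_trans (_ : #|E| * 2 <= _)%N.
    rewrite -sum_nat_const; apply: leq_sum => T _.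
    have [->|[x0 /finset.setIP[x0q]]] := set_0Vmem (zeros q :&: [set x | chord p x == T]).
      by rewrite cards0.
    rewrite inE => /eqP e; apply: leq_trans (conic_chord (px _ x0q)).
    apply/subset_leq_card/fintype.subsetP => x /finset.setIP[xq]; rewrite inE => /eqP e'.
    by apply/finset.setIP; split=> //; rewrite e -e' chord_r.
  by rewrite mulnC leq_mul2l cE.
apply: leq_trans (card_bigcup_le _ _) _.
rewrite mulnC -[X in (_ <= X * _)%N](card_ord (d p)) -cardsT -sum_nat_const.
apply: leq_sum => k _; have [fk gp] := fg k.
have [[l fl e]|[l1 [l2 [l3 [f1 f2 f3 hl]]]]] := conic_cubic fq fk; last first.
  have s : U k \subset (zeros q :&: zeros l1) :|: (zeros q :&: zeros l2)
      :|: (zeros q :&: zeros l3).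
    apply/fintype.subsetP => x /setIdP[/setIdP[xq _] /andP[_ /fintype.subsetP /(_ x)]].
    move=> /(_ (chord_r _ _ _)) /zerosP gx; rewrite !finset.in_setU !finset.in_setI !xq /=.
    by move/zerosP: xq => xq; rewrite !inE; case: (hl _ xq gx) => ->; rewrite eqxx ?orbT.
  apply: leq_trans (subset_leq_card s) _; apply: leq_trans (leq_card_setU _ _) _.
  apply: (@leq_add _ _ 4 2); last exact: conic_line_card.
  apply: leq_trans (leq_card_setU _ _) _.
  by apply: (@leq_add _ _ 2 2); apply: conic_line_card.
apply: leq_trans (_ : 2 <= 6)%N => //.
apply: leq_trans (conic_line_card z_inj fq qcov fl); apply/subset_leq_card/fintype.subsetP.
have lp : p \in zeros l.
  apply/zerosP; move: gp; rewrite e => /eqP; rewrite mulf_eq0 => /orP[]/eqP // qp.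
  by case/negP: pq; apply/zerosP.
move=> x /setIdP[xu /andP[/eqP c3 /fintype.subsetP xg]]; have /setIdP[xq xnp] := xu.
apply/finset.setIP; split=> //; apply/negPn/negP => xl.
have [y [yc yp yx ce]] := chord_third c3 (px x xq).
case/negP: xnp; apply/existsP; exists y; rewrite yx ce eqxx !andbT.
have /zerosP := xg y yc; rewrite e => /eqP; rewrite mulf_eq0 => /orP[]/eqP yl; last exact/zerosP.
move/(introT (zerosP z l y)) in yl; case/negP: xl; apply: (chord_zeros fl _ lp yl); first by rewrite eq_sym.
by apply: chord_rot; rewrite chordC.
Qed.

End Conic.

Lemma power_bounds (M D : nat) : (M <= D)%N -> (100 <= D)%N ->
  [/\ (11 * (16 * M * D ^ 4) <= D ^ 7)%N,
      (M * (3 * D) + M + 1 + M * D * (20 * D) <= D ^ 4)%N,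
      (16 * D ^ 4 * (D ^ 4 + (D ^ 4 * (2 * (11 * (16 * M * D ^ 4) + 1))) ^ 2) <= D ^ 32)%N,
      (1000 * M <= D ^ 32)%N & (20 * D <= D ^ 7)%N].
Proof.
move=> MD D100; have D0 : (0 < D)%N by lia.
have pw i j : (i <= j)%N -> (D ^ i <= D ^ j)%N by apply: leq_pexp2l.
have stp c i : (c <= 100)%N -> (c * D ^ i <= D ^ i.+1)%N.
  by move=> c100; rewrite expnS leq_mul2r (leq_trans c100 D100) orbT.
have b1 : (11 * (16 * M * D ^ 4) <= D ^ 7)%N.
  rewrite -(mulnA 16); apply: leq_trans (stp 11 6 isT)%N; rewrite leq_mul2l.
  apply: leq_trans (stp 16 5 isT)%N.
  by rewrite leq_mul2l expnS leq_mul2r MD orbT.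
split=> //.
- have h1 : (M * (3 * D) <= 3 * D ^ 3)%N.
    rewrite mulnCA leq_mul2l /=; apply: leq_trans (_ : D * D <= _)%N; first by rewrite leq_mul2r MD orbT.
    by rewrite mulnn pw.
  have h2 : (M <= D ^ 3)%N by apply: leq_trans MD _; rewrite -{1}(expn1 D) pw.
  have h3 : (1 <= D ^ 3)%N by rewrite expn_gt0 D0.
  have h4 : (M * D * (20 * D) <= 20 * D ^ 3)%N.
    by rewrite mulnCA leq_mul2l /= !expnS expn0 muln1 mulnA leq_mul2r leq_mul2r MD !orbT.
  apply: leq_trans (stp 25 3 isT)%N; move: h1 h2 h3 h4; set u := (D ^ 3)%N.
  by set a := (M * (3 * D))%N; set b := (M * D * _)%N; clear; lia.
- rewrite (_ : 32 = 5 + 27)%N // expnD; apply: leq_mul; first exact: stp.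
  apply: leq_trans (stp 2 26 isT)%N; rewrite [leqRHS]mul2n -[leqRHS]addnn; apply: leq_add; first exact: pw.
  apply: (@leq_trans ((D ^ 13) ^ 2)%N);
    last by rewrite -expnM; apply: pw.
  rewrite leq_exp2r //; apply: (@leq_trans (D ^ 4 * D ^ 9)%N); last by rewrite -expnD; apply: pw.
  rewrite leq_mul2l.
  apply/orP; right; apply: leq_trans (stp 2 8 isT)%N; rewrite leq_mul2l /=.
  apply: leq_trans (stp 2 7 isT)%N; have h3 : (1 <= D ^ 7)%N by rewrite expn_gt0 D0.
  by rewrite mul2n -addnn; apply: leq_add.
- apply: leq_trans (pw 3 32 isT)%N; rewrite !expnS expn0 muln1.
  rewrite (_ : 1000 = 10 * 100)%N // -mulnA mulnC -mulnA; apply: leq_mul; last by rewrite leq_mul //; lia.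
  lia.
by rewrite -{1}(expn1 D); apply: leq_trans (stp 20 1 isT)%N (pw 2 7 isT)%N.
Qed.

(** * Point sets covered by few lines and conics *)

Section Degenerate.
Variables (R : realFieldType) (I : finType) (z : I -> R * R).
Hypothesis z_inj : injective z.
Variables (d : I -> nat) (M : nat).
Hypothesis M_gt0 : (0 < M)%N.
Hypothesis sum_d : (\sum_p d p <= M * #|I|)%N.
Hypothesis pencil : forall p, exists (f : nat -> R * R -> R) (E : {set {set I}}),
  [/\ forall k, form 3 (f k) /\ f k (z p) = 0, (#|E| <= d p)%N &
      forall q, q != p -> chord z p q \in E \/ (#|chord z p q| = 3%N /\
        exists2 k, (k < d p)%N & forall r, r \in chord z p q -> f k (z r) = 0)].
Implicit Types (p r x y w : I) (l f g q : R * R -> R) (A B Q : {set I}).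
Local Notation zeros := (zeros z).
Local Notation chord := (chord z).
Local Notation cov := (cov z).
Local Notation lonely := (lonely z).
Local Notation unpaired := (unpaired z).
Local Notation n := #|I|.
Let D := (100 * M)%N.

Lemma card_atypical : (#|[set p | (D < d p)%N]| * 100 <= n)%N.
Proof.
have := atypical_card sum_d D; set k := #|_| => h.
by rewrite -(leq_pmul2l M_gt0); apply: leq_trans h; rewrite /D; nia.
Qed.

Section LargeConic.
Variable q : R * R -> R.
Hypotheses (fq : form 2 q) (qcov : ~ cov (20 * D) 0 (zeros q)).

Lemma conic_ncov : ~ cov 2 0 (zeros q).
Proof. by move=> h; apply: qcov; apply: cov_le h; rewrite /D; lia. Qed.

Lemma conic_large : (20 * D < #|zeros q|)%N.
Proof.
rewrite ltnNge; apply/negP => le; apply: qcov.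
exact: cov_le (cov_card z (zeros q)).
Qed.

(** A typical point off the conic pairs up more than half of its points, and a pair so obtained
    determines the point as the only other one on its chord. So there are at most [5 / 3] times as
    many such points as points on the conic. *)
Lemma conic_size : (n <= 4 * #|zeros q|)%N.
Proof.
pose T := [set p in ~: zeros q | (d p <= D)%N].
pose PQ := [set u : I * I | (u.1 \in T) && (u.2 \in zeros q :\: unpaired q u.1)].
have low : (#|T| * (#|zeros q| - 8 * D) <= #|PQ|)%N.
  rewrite [leqRHS](card_pairs T (fun p => zeros q :\: unpaired q p)) -sum_nat_const.
  apply: leq_sum => p /setIdP[]; rewrite finset.in_setC => pq dp.
  have := card_unpaired z_inj pencil fq conic_ncov pq.
  have := cardsID (unpaired q p) (zeros q).
  have : (#|zeros q :&: unpaired q p| <= #|unpaired q p|)%N.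
    by apply/subset_leq_card/finset.subsetIr.
  have : (8 * d p <= 8 * D)%N by rewrite leq_mul2l dp.
  set u1 := #|_ :&: _|; set u2 := #|unpaired _ _|; set u3 := #|_ :\: _|; set u4 := #|zeros q|; lia.
have up : (#|PQ| <= #|zeros q| * #|zeros q|)%N.
  rewrite -cardsX; apply: (@card_le_rel _ _ _ _ (fun u v =>
    [/\ u.2 = v.1, v.2 \in zeros q, v.2 != v.1 & chord u.1 v.1 = [set u.1; v.1; v.2]])).
    move=> [p x] /[1!inE] /= /andP[_ /setDP[xq xu]].
    have [y [yq yx e]] := pairedP xq xu.
    by exists (x, y) => //; apply/setXP.
  move=> [p x] [p' x'] [x0 y] /[1!inE] /= /andP[/setIdP[pq _] _].
  move=> /[1!inE] /= /andP[/setIdP[p'q _] /setDP[x'q _]].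
  move=> [ex yq yx e] [ex' _ _ e']; subst x x'; congr pair.
  rewrite finset.in_setC in pq; rewrite finset.in_setC in p'q.
  have px : p != x0 by apply: contraNneq pq => ->.
  have p'x : p' != x0 by apply: contraNneq p'q => ->.
  have yp : y \in chord x0 p by rewrite chordC e !inE eqxx orbT.
  have yp' : y \in chord x0 p' by rewrite chordC e' !inE eqxx orbT.
  have xp : x0 != p by rewrite eq_sym.
  have xp' : x0 != p' by rewrite eq_sym.
  have : p \in chord p' x0.
    rewrite (chordC z p') -(chord_eq z_inj xp' yx yp') (chord_eq z_inj xp yx yp).
    exact: chord_r.
  rewrite e' !finset.in_setU !finset.in_set1 => /orP[/orP[]|] /eqP // e1.
    by rewrite e1 eqxx in px.
  by rewrite e1 yq in pq.
have cT : (n <= #|zeros q| + #|T| + #|[set p | (D < d p)%N]|)%N.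
  rewrite -(cardsC (zeros q)) -addnA leq_add2l; apply: leq_trans (leq_card_setU _ _).
  apply/subset_leq_card/fintype.subsetP => p pq; rewrite finset.in_setU.
  by rewrite [p \in T]inE pq [p \in [set p | _]]inE /= ltnNge orbN.
have := card_atypical; have := conic_large; move: cT (leq_trans low up).
set g := #|zeros q|; set t := #|T|; set k := #|_| => h1 h2 h3 h4.
have h5 : (3 * g <= 5 * (g - 8 * D))%N by lia.
have h6 : (t * (3 * g) <= 5 * (g * g))%N by nia.
have h7 : (3 * t <= 5 * g)%N.
  have g0 : (0 < g)%N by lia.
  by rewrite -(leq_pmul2r g0); lia.
lia.
Qed.

(** From a typical point on the conic, the three-point lines to its other points have their third
    points off the conic, and these are distinct. *)
Lemma conic_off : (n <= 8 * #|~: zeros q|)%N.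
Proof.
have [x xq dx] : exists2 x, x \in zeros q & (d x <= D)%N.
  have : (0 < #|zeros q :\: [set p | (D < d p)%N]|)%N.
    have := cardsID [set p | (D < d p)%N] (zeros q).
    have := subset_leq_card (finset.subsetIr (zeros q) [set p | (D < d p)%N]).
    have := card_atypical; have := conic_size; have := conic_large.
    set u1 := #|[set p | _]|; set u2 := #|zeros q|; set u3 := #|_ :&: _|.
    set u4 := #|_ :\: _|; lia.
  case/card_gt0P => x /setDP[xq]; rewrite inE -leqNgt => dx.
  by exists x.
have [g [E [fg cE h]]] := pencil x.
pose A := zeros q :\ x.
have c1 : (#|[set y in A | chord x y \in E]| <= #|E|)%N.
  apply: (@card_le_rel _ _ _ _ (fun y T => T = chord x y)).
    by move=> y /setIdP[_ yE]; exists (chord x y).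
  move=> y y' T /setIdP[/setD1P[yx yq] _] /setIdP[/setD1P[y'x y'q] _] -> e.
  apply: (conic_chord_eq z_inj fq conic_ncov _ xq) => //; first by rewrite eq_sym.
  by rewrite -e chord_r.
have c2 : (#|[set y in A | chord x y \notin E]| <= #|~: zeros q|)%N.
  apply: (@card_le_rel _ _ _ _ (fun y w => [/\ w \in chord x y, w != x & w != y])).
    move=> y /setIdP[/setD1P[yx yq] yE].
    have [yE'|[c3 _]] := h y yx; first by rewrite yE' in yE.
    have xy : x != y by rewrite eq_sym.
    have [w [wc wx wy _]] := chord_third c3 xy.
    exists w => //; rewrite finset.in_setC; apply/negP => wq.
    by rewrite (conic_chord_eq z_inj fq conic_ncov xy xq yq wq wc wx) eqxx in wy.
  move=> y y' w /setIdP[/setD1P[yx yq] _] /setIdP[/setD1P[y'x y'q] _].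
  move=> [wc wx wy] [wc' _ wy'].
  have xy : x != y by rewrite eq_sym.
  have xy' : x != y' by rewrite eq_sym.
  apply: (conic_chord_eq z_inj fq conic_ncov xy' xq) => //.
  by rewrite -(chord_eq z_inj xy' wx wc') (chord_eq z_inj xy wx wc) chord_r.
have c3 : (#|A| = #|[set y in A | chord x y \in E]| + #|[set y in A | chord x y \notin E]|)%N.
  rewrite -(cardsID [set y | chord x y \in E] A); congr addn; apply: eq_card => y.
    by rewrite finset.in_setI !(inE, finset.in_set).
  by rewrite finset.in_setD andbC !(inE, finset.in_set).
have c4 := cardsD1 x (zeros q); rewrite xq in c4.
have := conic_size; have := conic_large; move: c1 c2 c3 c4 cE; rewrite -/A.
set u1 := #|_|; set u2 := #|E|; set u3 := #|[set y in A | _]|; set u4 := #|A|.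
set u5 := #|zeros q|; set u6 := #|~: _|; lia.
Qed.

End LargeConic.

Lemma card_pairs_bad (X Y : {set I}) (B : I -> {set I}) :
  (forall p, p \in Y -> (#|B p| <= 8 * d p)%N) ->
  (#|[set u : I * I | (u.1 \in Y) && (u.2 \in B u.1)]| <= 8 * (M * n))%N.
Proof.
move=> h; rewrite card_pairs; apply: leq_trans (_ : (8 * \sum_p d p <= _)%N); last first.
  by rewrite leq_mul2l sum_d.
rewrite big_distrr /= [leqRHS](bigID (mem Y)) /=; apply: leq_trans (leq_addr _ _).
by apply: leq_sum => p; apply: h.
Qed.

(** Let [p] be on [q'] only and [x] on [q] only. Outside few exceptional pairs the third point of
    [p x] lies on [q], by pairing from [p], and on [q'], by pairing from [x]. It is one of at most
    four common points, and with [x] it determines [p]; so there are too few pairs. *)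
Lemma conic_unique q q' : form 2 q -> form 2 q' -> ~ cov (20 * D) 0 (zeros q) ->
  ~ cov (20 * D) 0 (zeros q') -> (1000 * M < n)%N -> zeros q' \subset zeros q.
Proof.
move=> fq fq' qc qc' Mn.
have [[c c0 e]|[l1 [l2 [f1 f2 h]]]] := conic_conic fq fq'.
  apply/fintype.subsetP => p /zerosP pq; apply/zerosP/eqP; move/eqP: pq.
  by rewrite e mulf_eq0 (negbTE c0).
have nc := conic_ncov qc; have nc' := conic_ncov qc'.
pose C := zeros q :&: zeros q'; pose X := zeros q :\: zeros q'; pose Y := zeros q' :\: zeros q.
have cC : (#|C| <= 4)%N.
  have s : C \subset (zeros q :&: zeros l1) :|: (zeros q :&: zeros l2).
    apply/fintype.subsetP => p /finset.setIP[pq /zerosP pq'].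
    rewrite finset.in_setU !finset.in_setI pq /=; move/zerosP: pq => pq.
    by rewrite !inE; case: (h _ pq pq') => ->; rewrite eqxx ?orbT.
  apply: leq_trans (subset_leq_card s) _; apply: leq_trans (leq_card_setU _ _) _.
  by apply: (@leq_add _ _ 2 2); apply: (conic_line_card z_inj).
pose W1 := [set u : I * I | (u.1 \in Y) && (u.2 \in unpaired q u.1)].
pose W2 := [set u : I * I | (u.1 \in X) && (u.2 \in unpaired q' u.1)].
have cW1 : (#|W1| <= 8 * (M * n))%N.
  apply: card_pairs_bad => // p /setDP[_ pq]; exact: (card_unpaired z_inj pencil fq nc pq).
have cW2 : (#|W2| <= 8 * (M * n))%N.
  apply: card_pairs_bad => // p /setDP[_ pq]; exact: (card_unpaired z_inj pencil fq' nc' pq).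
pose P := finset.setX Y X.
have c1 : (#|P :&: W1| <= #|W1|)%N by apply/subset_leq_card/finset.subsetIr.
have c2 : (#|(P :\: W1) :&: [set u | (u.2, u.1) \in W2]| <= #|W2|)%N.
  apply: (@card_le_rel _ _ _ _ (fun u v => v = (u.2, u.1))).
    move=> u /finset.setIP[_ /[1!finset.in_set] uW]; by exists (u.2, u.1).
  by move=> [p x] [p' x'] v _ _ -> [-> ->].
have c3 : (#|(P :\: W1) :\: [set u | (u.2, u.1) \in W2]| <= #|finset.setX C X|)%N.
  have hu u : u \in (P :\: W1) :\: [set u | (u.2, u.1) \in W2] ->
      [/\ u.1 \in Y, u.2 \in X, u.2 \notin unpaired q u.1 & u.1 \notin unpaired q' u.2].
    case: u => [p x] /setDP[/setDP[/setXP[pY xX] h1] h2]; split=> //.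
      by apply: contra h1 => hp; rewrite finset.in_set /= pY.
    by apply: contra h2 => hp; rewrite finset.in_set /= finset.in_set /= xX.
  apply: (@card_le_rel _ _ _ _ (fun u v => [/\ v.2 = u.2, v.1 \in chord u.1 u.2,
      v.1 != u.1, v.1 != u.2 & v.1 \in zeros q'])).
    move=> u /hu[/setDP[pq' pq] /[dup] uX /setDP[xq xq'] h1 h2].
    have [y [yq yx e]] := pairedP xq h1; have [y' [yq' yp e']] := pairedP pq' h2.
    have yy : y' = y.
      have : y' \in chord u.1 u.2 by rewrite chordC e' !inE eqxx orbT.
      rewrite e !finset.in_setU !finset.in_set1 (negbTE yp) /= => /orP[/eqP ex|/eqP //].
      by rewrite -ex yq' in xq'.
    rewrite yy in yp yq'; exists (y, u.2); last by split=> //=; rewrite e !inE eqxx orbT.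
    by apply/setXP; split=> //; apply/finset.setIP.
  move=> [p x] [p' x'] [y x0] /hu[/= /setDP[pq' _] _ _ _] /hu[/= /setDP[p'q' _] _ _ _].
  move=> [-> /= yc yp yx yq'] [<- yc' yp' _ _]; congr pair.
  have cyp r : y \in chord r x -> y != r -> r \in chord y x.
    by move=> yr _; rewrite chordC; apply: chord_rot.
  have py : p != y by rewrite eq_sym.
  have p'y : p' != y by rewrite eq_sym.
  symmetry; apply: (conic_chord_eq z_inj fq' nc' yp) => //.
  by rewrite (chord_eq z_inj yx py (cyp _ yc yp)); apply: cyp.
have cP : (#|P| <= 16 * (M * n) + 4 * #|X|)%N.
  rewrite -(cardsID W1) -(cardsID [set u | (u.2, u.1) \in W2] (P :\: W1)).
  have c4 : (#|finset.setX C X| <= 4 * #|X|)%N by rewrite cardsX leq_mul2r cC orbT.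
  move: c1 c2 c3 c4 cW1 cW2; set u1 := #|_ :&: W1|; set u2 := #|W1|; set u3 := #|_ :&: _|.
  set u4 := #|W2|; set u5 := #|_ :\: _|; set u6 := #|_|; set u7 := #|X|; set u8 := (M * n)%N; lia.
exfalso; move: cP; rewrite cardsX.
have := cardsID (zeros q') (zeros q); have := cardsID (zeros q) (zeros q').
rewrite (finset.setIC (zeros q')) -/C -/X -/Y.
have := conic_size fq qc; have := conic_size fq' qc'; have := max_card (mem X).
move: Mn cC; set u1 := #|zeros q|; set u2 := #|zeros q'|; set x := #|X|; set y := #|Y|.
set c := #|C|; set k := #|I| => h1 h2 h3 h4 h5 h6 h7 h8.
have h9 : (k <= 5 * x)%N by lia.
have h10 : (k <= 5 * y)%N by lia.
have h11 : (k * k <= 25 * (y * x))%N by nia.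
nia.
Qed.

(** The richest line has at least [n / (8 m)] points of [Q], and at most [n / (16 m)] points have
    [d p > 16 M m]. So [S] has at least [n / (16 m)] points, more than [sweep_bound] allows if many
    points of [Q] are off the line. *)
Lemma line_step m Q : (0 < m)%N -> cov m 0 Q -> (n <= 8 * #|Q|)%N ->
  (forall l p, form 1 l -> p \in Q -> p \in zeros l ->
    #|lonely (Q :\: zeros l) p| <= 11 * d p)%N ->
  (16 * m * (m + (m * (2 * (11 * (16 * M * m) + 1))) ^ 2) < n)%N ->
  exists2 l, form 1 l & (#|Q :\: zeros l| <= 11 * (16 * M * m))%N.
Proof.
move=> m0 [l [k [fl _ hl]]] nQ few big.
pose c (i : 'I_m) := #|Q :&: zeros (l i)|.
have [i0 imax] : exists i0, forall i, (c i <= c i0)%N.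
  by case: (@arg_maxnP 'I_m (Ordinal m0) xpredT c isT) => i0 _ h; exists i0 => i; apply: h.
exists (l i0) => //; set D1 := (16 * M * m)%N.
pose S := [set p in Q :&: zeros (l i0) | (d p <= D1)%N].
have cQ : (#|Q| <= m * c i0)%N.
  apply: (@leq_trans #|\bigcup_(i in [set: 'I_m]) (Q :&: zeros (l i))|).
    apply/subset_leq_card/fintype.subsetP => p pQ; have [[i im e]|[]//] := hl p pQ.
    apply/bigcupP; exists (Ordinal im); first exact: finset.in_setT.
    by apply/finset.setIP; split=> //; apply/zerosP.
  apply: leq_trans (card_bigcup_le _ _) _.
  rewrite -[X in (_ <= X * _)%N](card_ord m) -cardsT -sum_nat_const.
  by apply: leq_sum => i _; apply: imax.
have cS : (c i0 <= #|S| + #|[set p | (D1 < d p)%N]|)%N.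
  apply: leq_trans (leq_card_setU _ _).
  apply/subset_leq_card/fintype.subsetP => p pq; rewrite finset.in_setU.
  by rewrite [p \in S]inE pq [p \in [set p | _]]inE /= ltnNge orbN.
have at1 : (#|[set p | (D1 < d p)%N]| * (16 * m) <= n)%N.
  rewrite -(leq_pmul2l M_gt0); apply: leq_trans (atypical_card sum_d D1).
  by rewrite /D1 (mulnC 16) -mulnA mulnCA.
have nS : (n <= 16 * m * #|S|)%N.
  move: cQ cS at1 nQ; set u1 := #|Q|; set u2 := c i0; set u3 := #|S|; set u4 := #|_|.
  set u5 := #|I| => h1 h2 h3 h4; have : (m * u2 <= m * (u3 + u4))%N by rewrite leq_mul2l h2 orbT.
  lia.
rewrite leqNgt; apply/negP => lt.
have SQ : S \subset zeros (l i0).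
  by apply/fintype.subsetP => p /setIdP[/finset.setIP[]].
have QL p : p \in Q -> exists2 j, (j < m)%N & l j (z p) = 0.
  by move=> /hl[//|[]].
have lon p : p \in S -> (#|lonely (Q :\: zeros (l i0)) p| <= 11 * D1)%N.
  move=> /setIdP[/finset.setIP[pQ pl] dp]; apply: leq_trans (few _ _ (fl i0) pQ pl) _.
  by rewrite leq_mul2l dp.
have h := sweep_bound z_inj (fl i0) fl QL SQ lon lt.
have : (16 * m * #|S| <= 16 * m * (m + (m * (2 * (11 * D1 + 1))) ^ 2))%N by rewrite leq_mul2l h orbT.
by move/(leq_trans nS); rewrite leqNgt big.
Qed.

Hypothesis all_cov : forall f, form 3 f -> cov (3 * D) D (zeros f).

(** By averaging some [p0] has [d p0 <= M]; its cubics, its lines in [E] and one line through [p0]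
    itself cover everything. *)
Lemma plane_cov : (0 < n)%N -> cov (M * (3 * D) + M + 1) (M * D) [set: I].
Proof.
move=> n0; have [p0 dp] : exists p0, (d p0 <= M)%N.
  apply: contrapT => no; have /card_gt0P[p1 _] := n0.
  have : (\sum_(p in [set: I]) M.+1 <= \sum_p d p)%N.
    rewrite big_set /=; apply: leq_sum => p _; rewrite ltnNge; apply/negP => h.
    by apply: no; exists p.
  rewrite sum_nat_const cardsT => /leq_trans /(_ sum_d); rewrite mulnC leq_mul2r.
  by rewrite (_ : #|I| == 0%N = false) ?ltnn //; apply/eqP; have := n0; set k := #|_|; lia.
have [g [E [fg cE h]]] := pencil p0.
pose B2 := [set q | (q != p0) && (chord p0 q \in E)].
have c1 : cov (d p0 * (3 * D)) (d p0 * D) (~: (B2 :|: [set p0])).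
  apply: (@cov_bigU _ _ _ _ _ _ (fun k => zeros (g k))) => [k _|q].
    exact: all_cov (fg k).1.
  rewrite finset.in_setC finset.in_setU negb_or finset.in_set1 => /andP[qB qp].
  have [qE|[_ [k kd hk]]] := h q qp; first by rewrite inE qp qE in qB.
  by exists k => //; apply/zerosP/hk/chord_r.
have c2 := cov_U c1 (cov_U (cov_blocks z_inj p0 E) (cov_point z p0)).
apply: (cov_le _ _ (cov_sub _ c2)).
- rewrite addnA leq_add2r; apply: leq_add; last exact: leq_trans cE dp.
  by rewrite leq_mul2r dp orbT.
- by rewrite !addn0 leq_mul2r dp orbT.
by apply/fintype.subsetP => q _; rewrite finset.in_setU finset.in_setC orNb.
Qed.

(** The third point on the line from [p] to a lonely point cannot be in [Q], so it is in [B], and it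
    determines the lonely point. Lines in [E] add one each. *)
Lemma card_lonely Q B l p : form 1 l -> p \in zeros l ->
  (forall x w, x \in Q -> x \notin zeros l -> w \in chord p x -> w != p -> w != x ->
     w \in Q :|: B) ->
  (#|lonely (Q :\: zeros l) p| <= d p + #|B|)%N.
Proof.
move=> fl pl hQ; have [g [E [fg cE h]]] := pencil p.
set L := lonely _ p.
rewrite -(cardsID [set x | chord p x \in E] L); apply: leq_add.
  apply: leq_trans (leq_trans (lonely_blocks z (Q :\: zeros l) p E) cE).
  apply/subset_leq_card/fintype.subsetP => x /finset.setIP[xL].
  by rewrite [x \in [set x | _]]inE => xE; rewrite inE xL.
have nl x : x \in Q :\: zeros l -> p != x.
  by move=> /setDP[_]; apply: contraNneq => <-.
apply: (@card_le_rel _ _ _ _ (fun x w =>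
    [/\ #|chord p x| = 3%N, w \in chord p x, w != p & w != x])).
  move=> x /setDP[xL xE]; have [x2 hx] := lonelyP xL; have px := nl x x2.
  have /setDP[xQ xl] := x2.
  have xp : x != p by rewrite eq_sym.
  have [xE'|[c3 _]] := h x xp.
    by rewrite inE xE' in xE.
  have [w [wc wp wx _]] := chord_third c3 px.
  exists w => //; have /finset.setUP[wQ|//] := hQ x w xQ xl wc wp wx.
  have : w \notin chord p x; last by rewrite wc.
  apply: hx => //; apply/setDP; split=> //.
  apply: contra xl => wl; have pw : p != w by rewrite eq_sym.
  by apply: (chord_zeros z_inj fl pw pl wl); rewrite (chord_eq z_inj px wp wc) chord_r.
move=> x x' w /setDP[/lonelyP[/nl px _] _] /setDP[/lonelyP[/nl px' _] _].
move=> [c3 wc wp wx] [_ wc' _ wx'].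
apply: (card3_third c3 (chord_l _ _ _) wc (chord_r _ _ _)); try by rewrite eq_sym.
by rewrite -(chord_eq z_inj px wp wc) (chord_eq z_inj px' wp wc') chord_r.
Qed.

(** Every other large conic of the covering has all its points on [q], and each small one is
    replaced by [20 D] lines. *)
Lemma conic_off_cov q : form 2 q -> ~ cov (20 * D) 0 (zeros q) -> (1000 * M < n)%N ->
  cov (M * (3 * D) + M + 1 + M * D * (20 * D)) 0 (~: zeros q).
Proof.
move=> fq qc Mn; have [|l [k [fl fk h]]] := plane_cov; first by apply: leq_trans Mn; lia.
set m1 := (_ + 1)%N; pose A := [set p | [exists i : 'I_m1, l i (z p) == 0]].
have c1 : cov m1 0 A.
  exists l, k; split=> // p; rewrite inE => /existsP[i /eqP e]; left; by exists i.
have c2 : cov (M * D * (20 * D)) (M * D * 0) (~: zeros q :\: A).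
  apply: (@cov_bigU _ _ _ _ _ _ (fun i => zeros (k i) :\: zeros q)) => [i _|p].
    have [c|nc] := pselect (cov (20 * D) 0 (zeros (k i))).
      by apply: cov_sub c; apply: finset.subsetDl.
    have := conic_unique fq (fk i) qc nc Mn; rewrite -finset.setD_eq0 => /eqP->.
    exact: cov_0.
  move=> /setDP[]; rewrite finset.in_setC => pq pA.
  have [[i im e]|[i im e]] := h p (finset.in_setT _).
    case/negP: pA; rewrite inE; apply/existsP; exists (Ordinal im); exact/eqP.
  by exists i => //; apply/setDP; split=> //; apply/zerosP.
apply: cov_le (cov_sub _ (cov_U c1 c2)) => //; first by rewrite muln0.
by apply/fintype.subsetP => p pq; rewrite finset.in_setU finset.in_setD pq andbT orbN.
Qed.

(** If a large conic [q] exists, a line [l] is found for the points off [q] and the cubic is [q l];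
    otherwise [l] alone contains almost all points. *)
Lemma degenerate_case : (D ^ 32 < n)%N ->
  exists2 f, form 3 f & (#|~: zeros f| <= D ^ 7)%N.
Proof.
have D100 : (100 <= D)%N by rewrite /D; lia.
have MD : (M <= D)%N by rewrite /D; lia.
have m0 : (0 < D ^ 4)%N by rewrite expn_gt0 (leq_trans _ D100).
have [b1 b2 b3 b4 _] := power_bounds MD D100 => big.
have {}b3 := leq_ltn_trans b3 big; have Mn := leq_ltn_trans b4 big.
have n0 : (0 < n)%N := leq_trans (ltn0Sn _) Mn.
clear b4 big.
have [[q [fq qc]]|no] := pselect (exists q, form 2 q /\ ~ cov (20 * D) 0 (zeros q)).
  have cQ : cov (D ^ 4) 0 (~: zeros q) := cov_le b2 (leqnn _) (conic_off_cov fq qc Mn).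
  have [|l fl hl] := line_step m0 cQ (conic_off fq qc) _ b3.
    move=> l p fl; rewrite finset.in_setC => pq pl.
    apply: leq_trans (card_lonely (B := unpaired q p) fl pl _) _.
      (* A third point on the conic must be unpaired: its partner would be [x], which is off the
         conic. This gives [d p + 8 d p <= 11 d p]. *)
      move=> x w; rewrite !finset.in_setC => xq xl wc wp wx; rewrite finset.in_setU finset.in_setC.
      case: (boolP (w \in zeros q)) => //= wq; apply/negPn/negP => wu.
      have [y [yq yw e]] := pairedP wq wu.
      have px : p != x by apply: contraNneq xl => <-.
      have : x \in chord p w by rewrite (chord_eq z_inj px wp wc) chord_r.
      rewrite e !finset.in_setU !finset.in_set1 eq_sym (negbTE px) (eq_sym x) (negbTE wx) /=.
      by move=> /eqP xy; rewrite xy yq in xq.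
    have := card_unpaired z_inj pencil fq (conic_ncov qc) pq.
    by set u := #|_|; clear; lia.
  exists (fun u => q u * l u); last first.
    apply: leq_trans b1; apply: leq_trans hl; apply/subset_leq_card/fintype.subsetP => p.
    rewrite finset.in_setC finset.in_setD finset.in_setC !inE mulf_eq0 negb_or.
    by rewrite andbC.
  case: fq fl => Pq [u qu] [Pl nl]; split; first exact: PolM Pq Pl.
  apply: contrapT => no; case/negP: qu; apply/eqP; apply: (affine_mul_eq0 Pl nl Pq) => v.
  by apply/eqP/negPn/negP => h; apply: no; exists v; rewrite mulrC.
have cI : cov (D ^ 4) 0 [set: I].
  have [l [k [fl fk h]]] := plane_cov n0.
  pose A := [set p | [exists i : 'I_(M * (3 * D) + M + 1), l i (z p) == 0]].
  have c1 : cov (M * (3 * D) + M + 1) 0 A.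
    by exists l, k; split=> // p; rewrite inE => /existsP[i /eqP e]; left; exists i.
  have c2 : cov (M * D * (20 * D)) (M * D * 0) (~: A).
    apply: (@cov_bigU _ _ _ _ _ _ (fun i => zeros (k i))) => [i _|p].
      by apply: contrapT => nc; apply: no; exists (k i).
    rewrite finset.in_setC => pA; have [[i im e]|[i im e]] := h p (finset.in_setT _).
      case/negP: pA; rewrite inE; apply/existsP; exists (Ordinal im); exact/eqP.
    by exists i => //; apply/zerosP.
  apply: cov_le (cov_sub _ (cov_U c1 c2)) => //; first by rewrite muln0.
  by apply/fintype.subsetP => p _; rewrite finset.in_setU finset.in_setC orbN.
have [||l [Pl nl] hl] := line_step m0 cI _ _ b3.
- by rewrite cardsT leq_pmull.
- move=> l p fl _ pl; apply: leq_trans (card_lonely (B := finset.set0) fl pl _) _.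
    by move=> x w _ _ _ _ _; rewrite finset.in_setU finset.in_setT.
  by rewrite cards0 addn0 leq_pmull.
exists l; first by split=> //; apply: Pol_le Pl.
apply: leq_trans b1; apply: leq_trans hl; apply/subset_leq_card/fintype.subsetP => p.
by rewrite finset.in_setC finset.in_setD finset.in_setT andbT.
Qed.

End Degenerate.

Lemma cubic_almost_all (R : realFieldType) (I : finType) (z : I -> R * R)
    (d : I -> nat) (M : nat) : injective z -> (0 < M)%N ->
  (\sum_p d p <= M * #|I|)%N ->
  (forall p, exists (f : nat -> R * R -> R) (E : {set {set I}}),
    [/\ forall k, form 3 (f k) /\ f k (z p) = 0, (#|E| <= d p)%N &
      forall q, q != p -> chord z p q \in E \/ (#|chord z p q| = 3%N /\
        exists2 k, (k < d p)%N & forall r, r \in chord z p q -> f k (z r) = 0)]) ->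
  ((100 * M) ^ 32 < #|I|)%N ->
  exists2 f, form 3 f & (#|~: zeros z f| <= (100 * M) ^ 7)%N.
Proof.
move=> z_inj M0 sd pc.
have [[f [ff nc]]|no] := pselect (exists f, form 3 f /\
  ~ cov z (3 * (100 * M)) (100 * M) (zeros z f)).
  move=> _; exists f => //; apply: leq_trans (cubic_case z_inj M0 sd pc ff nc) _.
  have [||//] := @power_bounds M (100 * M); lia.
apply: (degenerate_case z_inj M0 sd pc) => f ff.
by apply: contrapT => nc; apply: no; exists f.
Qed.

(** * Curves and dual arrangements of finite point sets *)

Section PlaneCurves.
Variable R : realType.
Implicit Types (f : R * R -> R).

Definition coords (u : R * R) : 'I_2 -> R := fun i => if i == ord0 then u.1 else u.2.

Lemma mmeasure_mulX (i : 'I_2) (G : mpoly 2 R) (d : nat) : (mmeasure mdeg G <= d)%N ->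
  (mmeasure mdeg (mpolyX R (mnm1 i) * G) <= d.+1)%N.
Proof.
have [->|G0] := eqVneq G 0; first by rewrite mulr0 mmeasure0.
have X0 : mpolyX R (mnm1 i) != 0 by rewrite -(mmeasure_poly_eq0 mdeg) mmeasureX.
by rewrite msizeM // msizeX mdeg1.
Qed.

Lemma Pol_mpoly d f : Pol d f ->
  exists2 F : mpoly 2 R, (mmeasure mdeg F <= d.+1)%N & forall u, meval (coords u) F = f u.
Proof.
elim: d f => [|d IH] f.
  move=> [c e]; exists (mpolyC 2 c) => [|u]; last by rewrite mevalC e.
  by rewrite mmeasureC; case: eqP.
move=> [c [g [h [/IH[G dG eG] /IH[H dH eH] e]]]].
exists (mpolyC 2 c + mpolyX R (mnm1 ord0) * G + mpolyX R (mnm1 ord_max) * H) => [|u].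
  apply: leq_trans (mmeasureD_le _ _ _) _; rewrite geq_max mmeasure_mulX // andbT.
  apply: leq_trans (mmeasureD_le _ _ _) _; rewrite geq_max mmeasure_mulX // andbT.
  by rewrite mmeasureC; case: eqP.
by rewrite !mevalD !mevalM mevalC !mevalXU eG eH e.
Qed.

Lemma form_curve d f : (0 < d)%N -> form d f ->
  exists2 G : set (R * R), is_curve_deg_le d G & forall u, f u = 0 -> G u.
Proof.
move=> d0 [Pf [v fv]]; have [F dF eF] := Pol_mpoly Pf.
have [F1|F1] := ltnP 1 (mmeasure mdeg F).
  exists (zero_locus F); first by exists F; rewrite F1.
  by move=> u fu; rewrite /zero_locus /= -fu -eF.
(* Here [f] is a nonzero constant without zeros; any curve will do, and a coordinate axis is one. *)
exists (zero_locus (mpolyX R (mnm1 (ord0 : 'I_2)))).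
  exists (mpolyX R (mnm1 ord0)); split=> //.
  by rewrite msizeX mdeg1 ltnS.
move=> u fu; case/negP: fv; rewrite -fu -!eF (msize1_polyC F1) !mevalC; exact: eqxx.
Qed.

End PlaneCurves.

Section Plane.
Variable R : realType.

(** Each pair of points rules out at most one value of [t], and the field is infinite. *)
Lemma generic_direction (I : finType) (z : I -> R * R) : injective z ->
  exists t, injective (fun i => (z i).1 + t * (z i).2).
Proof.
move=> z_inj.
pose s := [seq - ((z u.1).1 - (z u.2).1) / ((z u.1).2 - (z u.2).2) | u <- enum {: I * I}].
have [t ts] : exists t, t \notin s.
  apply: contrapT => no.
  have h : {subset [seq i%:R : R | i <- iota 0 (size s).+1] <= s}.
    by move=> x _; apply/negPn/negP => xs; apply: no; exists x.
  have := uniq_leq_size (nat_seq_uniq R _) h.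
  by rewrite (size_map _ (iota _ _)) size_iota ltnn.
exists t => i j e; apply: z_inj.
have [e2|ne] := eqVneq ((z i).2) ((z j).2).
  move: e; rewrite e2 => /addIr; move: e2; case: (z i) => a b; case: (z j) => a' b' /=.
  by move=> -> ->.
case/negP: ts; apply/mapP; exists (i, j); first by rewrite mem_enum.
have {}ne : (z i).2 - (z j).2 != 0 by rewrite subr_eq0.
apply: (mulIf ne); rewrite /= divfK //; lra.
Qed.

Variable P : {fset (R * R)}.
Local Notation z := (fun p : P => val p).
Variable t : R.
Let a (p : P) := (val p).1 + t * (val p).2.
Let b (p : P) := (val p).2.
Hypothesis a_inj : injective a.

Lemma card_double_verts : (#|double_verts a b| <= ordinary_line_count P)%N.
Proof.
have fin := finite_ordinary_lines P.
rewrite /ordinary_line_count cardfE -cardsT.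
pose r (T : {set P}) (l : fset_set (ordinary_lines P)) := forall p : P, (p \in T) = (val p \in val l).
apply: (card_le_rel (r := r)); last first.
  by move=> T T' l _ _ h h'; apply/setP => p; rewrite h h'.
move=> T /setIdP[Tv /cards2P[i [j [ij eT]]]].
have iT : i \in T by rewrite eT !inE eqxx.
have jT : j \in T by rewrite eT !inE eqxx orbT.
have eb := blk_vertsE a_inj Tv iT jT ij.
pose l := [set w : R * R | line_fun (val i) (val j) w = 0]%classic.
have Tl (p : P) : p \in T = (val p \in l).
  by rewrite eb (blk_line a_inj) //; apply/eqP/idP; rewrite in_setE.
have lP : l \in fset_set (ordinary_lines P).
  rewrite in_fset_set // in_setE; split.
    exists (- ((val j).2 - (val i).2)), ((val j).1 - (val i).1),
      (((val j).2 - (val i).2) * (val i).1 - ((val j).1 - (val i).1) * (val i).2).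
    split.
      rewrite xpair_eqE oppr_eq0 !subr_eq0 andbC; apply: contra ij => /andP[/eqP e1 /eqP e2].
      by apply/eqP/val_inj; move: e1 e2; case: (val i) => ? ?; case: (val j) => ? ? /= -> ->.
    by rewrite /l /line_fun; apply/seteqP; split=> w /= h; rewrite -[RHS]h; ring.
  have -> : [fset w in P | w \in l]%fset = [fset val i; val j]%fset.
    apply/fsetP => w; rewrite !inE /=; apply/andP/orP => [[wP]|].
      rewrite -(Tl [` wP]%fset) eT !inE => /orP[]/eqP e; [left|right]; by rewrite -e.
    by case=> /eqP->; split; rewrite -?Tl; by [apply: valP | apply: iT | apply: jT].
  by rewrite cardfs2 (inj_eq val_inj) ij.
by exists [` lP]%fset.
Qed.

End Plane.

(** * From ordinary lines to a curve, and the constants *)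

Lemma cubic_through_fset (R : realType) (P : {fset (R * R)}) (N : nat) : (0 < N)%N ->
  (ordinary_line_count P <= N * #|` P|)%N -> ((100 * (100 * (80 * N))) ^ 32 < #|` P|)%N ->
  exists2 G, is_curve_deg_le 3 G &
    (#|` [fset w in P | w \notin G]%fset| <= (100 * (100 * (80 * N))) ^ 7)%N.
Proof.
move=> N0 ord; rewrite cardfE => big.
pose z (p : P) : R * R := val p.
have z_inj : injective z := val_inj.
have [t a_inj] := generic_direction z_inj.
pose bc := bad_count z t.
(* The constant is [4 * 49 * (22 + 18 N) + 4 <= 8000 N]. The summand 4 leaves room for the 3 in the
   bound on [E] and the 1 in the number of cubics. *)
have sum_d : (\sum_p (4 * bc p + 4) <= 100 * (80 * N) * #|{: P}|)%N.
  rewrite big_split /= -big_distrr /= sum_nat_const.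
  have := sum_bad_count a_inj; have := card_double_verts a_inj.
  move: ord; rewrite cardfE -/bc.
  set s := (\sum_(_ : _) _)%N; set k := #|_|; set o := ordinary_line_count P; set v := #|_|.
  by move: s k o v; clear -N0 => s k o v h1 h2 h3; nia.
have M0 : (0 < 100 * (80 * N))%N by rewrite !muln_gt0.
have [|f ff hf] := cubic_almost_all z_inj M0 sum_d _ big.
  move=> p; have [f [E [fp cE h]]] := pencil_cubics a_inj p.
  exists f, E; split=> // [|q qp]; first by apply: leq_trans cE _; rewrite leq_add2l.
  have <- : blk (fun i => (z i).1 + t * (z i).2) (fun i => (z i).2) p q = chord z p q.
    by apply/setP => r; rewrite (blk_line a_inj) 1?eq_sym // inE.
  have [|[c3 [k kd hk]]] := h q qp; [by left|right; split=> //; exists k => //].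
  by apply: leq_trans kd _; rewrite /bc; clear; lia.
have [G cG hG] := form_curve (isT : 0 < 3)%N ff.
exists G => //; apply: leq_trans hf; rewrite cardfE -cardsT.
pose r (w : [fset w in P | w \notin G]%fset) (p : P) := val w = val p.
apply: (card_le_rel (r := r)) => [w _|w w' p _ _ e e']; last by apply: val_inj; rewrite e e'.
have : val w \in [fset w in P | w \notin G]%fset := valP w.
rewrite !inE /= => /andP[wP wG]; exists [` wP]%fset => //.
rewrite finset.in_setC; apply: contra wG => /zerosP h; rewrite in_setE; exact: hG.
Qed.

(** With [x = A K]: [x ^ 32 < exp (32 x)], and [32 x <= C K ^ C < exp (C K ^ C)]. *)
Lemma expR_expR_lower (R : realType) (A K C : R) : 0 <= A -> 1 <= K -> 32%:R * A <= C ->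
  1 <= C -> (A * K) ^+ 32 < expR (expR (C * K `^ C)).
Proof.
move=> A0 K1 AC C1; have K0 : 0 <= K by lra.
have KC : K <= K `^ C by rewrite -{1}(powRr1 K0) ler_powR.
have h1 : 32%:R * (A * K) <= C * K `^ C.
  by rewrite mulrA; apply: ler_pM => //; rewrite ?mulr_ge0.
apply: (@lt_le_trans _ _ (expR (32%:R * (A * K)))); last first.
  rewrite ler_expR; apply: le_trans h1 _; apply: le_trans (expR_ge1Dx _); lra.
rewrite expRM_natl ltrXn2r ?expR_ge0 ?mulr_ge0 //.
by apply: lt_le_trans (expR_ge1Dx _); rewrite ltrDr.
Qed.

Local Open Scope classical_set_scope.
Local Open Scope ring_scope.

Theorem theorem1p4 (R : realType) :
  exists C C' : R, [/\ 0 < C, 0 < C' &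
    forall (K : R) (n : nat) (P : {fset (R * R)}),
      1 <= K ->
      #|` P| = n ->
      (ordinary_line_count P)%:R <= K * n%:R ->
      expR (expR (C * K `^ C)) <= n%:R ->
      exists G : set (R * R), is_curve_deg_le 3 G /\
        (#|` [fset z in P | z \notin G]%fset|)%:R <= C' * K `^ C'].
Proof.
(* The last factor 2 comes from rounding [K] up to an integer [N <= 2 K], so that [A K] dominates
   [100 * 8000 N]. *)
pose A : R := 100 * (100 * (80 * 2)).
have A7 : 7 <= A by rewrite /A; lra.
exists (32 * A), (A ^+ 7); split=> [||K n P K1 <- ord big]; rewrite ?exprn_gt0 //; try lra.
pose N := (Num.truncn K).+1.
have KN : K <= N%:R by apply/ltW/truncnS_gt.
have NK : N%:R <= 2 * K :> R.
  have : (Num.truncn K)%:R <= K by rewrite truncn_le (le_trans ler01 K1).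
  by rewrite /N -natr1; lra.
have DA : (100 * (100 * (80 * N)))%:R <= A * K :> R.
  by rewrite !natrM /A; lra.
have [|||G cG hG] := @cubic_through_fset R P N.
- by [].
- by rewrite -(ler_nat R) natrM; apply: le_trans ord _; rewrite ler_wpM2r.
- rewrite -(ltr_nat R) natrX; apply: lt_le_trans big; apply: le_lt_trans (expR_expR_lower _ K1 (lexx _) _); [|lra|lra].
  by rewrite lerXn2r ?nnegrE ?ler0n //; lra.
exists G; split=> //; apply: (@le_trans _ _ ((A * K) ^+ 7)).
  apply: le_trans (_ : ((100 * (100 * (80 * N))) ^ 7)%:R <= _); first by rewrite ler_nat.
  by rewrite natrX lerXn2r ?nnegrE ?ler0n //; nra.
rewrite exprMn; apply: ler_wpM2l; first by rewrite exprn_ge0; lra.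
rewrite -(powR_mulrn 7 (le_trans ler01 K1)).
(* The exponent 7 is raised to [C'] using [7 <= A <= A ^ 7] and [1 <= K]. *)
have A1 : 1 <= A by apply: le_trans A7; rewrite ler1n.
by apply: ler_powR => //; apply: le_trans A7 _; apply: ler_eXnr.
Qed.
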